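(* Fix $p>0$ and let $E\subset\mathbb{R}$ be a compact set. Then there exist initial data $(u(0),u_t(0))$ consisting of $C^\infty(\mathbb{R})$ functions and a smooth solution $u$ to $$u_{tt}-u_{xx}-\tfrac{2(p+2)}{p^2}|u|^pu=0$$ with this initial data (at $t=0$) that blows up at a time $0<T<\infty$ precisely on the set $E$, which is to say: (1) $u(t,x)$ converges to a smooth function of $x\in\mathbb{R}\setminus E$ as $t\to T$; and (2) $\lim_{t\to T}u(t,x)=\infty$ for all $x\in E$.
   Context: All functions are real-valued, with one space dimension. The solution $u$ is defined for all $(t,x)\in[0,T)\times\mathbb{R}$, and the limits $t\to T$ are taken from below. *)

(* Defs.v *)
From Stdlib Require Import Reals.
From Coquelicot Require Import Coquelicot.
Open Scope R_scope.

Definition smooth (f : R -> R) : Prop :=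
  forall (n : nat) (x : R), ex_derive_n f n x.

(* Faithful when the complement of [E] is open: the derivatives at [x] then
   do not depend on the values of [f] on [E]. *)
Definition smooth_off (E : R -> Prop) (f : R -> R) : Prop :=
  forall (n : nat) (x : R), ~ E x -> ex_derive_n f n x.

(* Functions [u t x] are total, but only their values for t in [0,T) matter:
   time derivatives are taken within [0,T), hence are one-sided at t = 0. *)
Definition time (T t : R) : Prop := 0 <= t < T.

Definition is_derive_t (T : R) (u : R -> R -> R) (t x l : R) : Prop :=
  D_in (fun s => u s x) (fun _ => l) (time T) t.

Definition partial_t (T : R) (u ut : R -> R -> R) : Prop :=
  forall t x, time T t -> is_derive_t T u t x (ut t x).

Definition partial_x (T : R) (u ux : R -> R -> R) : Prop :=
  forall t x, time T t -> is_derive (u t) x (ux t x).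

Definition continuous_strip (T : R) (u : R -> R -> R) : Prop :=
  continuous_on (fun z : R * R => time T (fst z))
                (fun z : R * R => u (fst z) (snd z)).

Fixpoint Ck_strip (T : R) (k : nat) (u : R -> R -> R) : Prop :=
  continuous_strip T u /\
  match k with
  | O => True
  | S k' => exists ut ux : R -> R -> R,
      partial_t T u ut /\ partial_x T u ux /\
      Ck_strip T k' ut /\ Ck_strip T k' ux
  end.

Definition smooth_strip (T : R) (u : R -> R -> R) : Prop :=
  forall k : nat, Ck_strip T k u.

(* [Rpower 0 p] is not 0 (Stdlib sets [ln 0 = 0]), but the factor [v] makes
   the product vanish at v = 0, as |v|^p v should. *)
Definition nonlinearity (p v : R) : R := Rpower (Rabs v) p * v.

Definition solves_nlw (p T : R) (u : R -> R -> R) : Prop :=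
  exists ut utt ux uxx : R -> R -> R,
    partial_t T u ut /\ partial_t T ut utt /\
    partial_x T u ux /\ partial_x T ux uxx /\
    forall t x, time T t ->
      utt t x - uxx t x - 2 * (p + 2) / p ^ 2 * nonlinearity p (u t x) = 0.

(* Main.v *)
Require Import Defs.
From Stdlib Require Import Reals Lra Lia Cantor ClassicalEpsilon.
From Coquelicot Require Import Coquelicot.
Open Scope R_scope.

(** The solution is built backwards from a blow-up surface [t = T + h] that touches the line
    [t = T] exactly above [E]: [h] is smooth, nonnegative and vanishes exactly on [E]
    ([height]).  Below such a surface the solution is smooth, so at time [T] it is smooth off
    [E] and infinite on [E].

    Straightening the surface.  In one space dimension the wave operator is a product of two
    null derivatives, so each null coordinate may be reparametrised separately.  Setting
    [x - (t - T) = y - 2 h(y)] and [x + (t - T) = y - 2 s] makes the surface the line [s = 0]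
    and turns the equation into [u_ss + 2 u_sy = c rho u^(p+1)] with [rho = 1 - 2 h'] and
    [c = 2 (p + 2) / p^2] ([pull_wave]).  Derivatives in [y] run along the surface and do not
    worsen the singularity there; derivatives in [s] are recovered from the equation.

    Approximate solution.  For [u = w^(-2/p)] the equation reads
    [w (w_ss + 2 w_sy) = k (w_s^2 + 2 w_s w_y - rho)], [k = 1 + 2/p], which is quadratic.  It is
    solved by a polynomial [w = s (b0 + b1 s + ...)], [b0^2 = rho], one coefficient after the
    other, up to an error of order beyond [s^(2 k)]; if [2 k] is an integer, the resonance at
    that order is met by a logarithmic term ([approximate_profile]).

    Correction.  Writing the solution as [w^(-2/p) + r], the correction solves a Volterra
    equation with a potential of size [mu / s^2], [mu = (2 + 2/p) (1 + 2/p)].  Two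
    integrations in [s] of [s^(m-2)] give [s^m / (m (m - 1))], so this is a contraction on
    functions of size [s^m] as soon as [m (m - 1) > mu], that is [m > 2 + 2/p], the order that
    the approximate solution has reached ([volterra_exists]).  The same estimate, applied to
    differences in [y], shows that [r] is Lipschitz and that the solution of the linearised
    equation is its derivative; iterating, [r] is smooth in [y] ([nonlinear_regularity]).

    The width [sg] of the strip [0 < s < sg] so obtained depends on the surface, while the
    strip must contain all of [0 <= t < T].  Therefore the construction is made for all the
    surfaces [t = T + eps_i h] at once, with bounds uniform in [i], and [i] is then chosen so
    large that [eps_i h < sg / 4] ([blowup_profile]). *)

(** * Calculus preliminaries *)


Lemma rderive_const (a x : R) : is_derive (fun _ => a) x 0.
Proof. apply (is_derive_const (K := R_AbsRing) (V := R_NormedModule)). Qed.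

Lemma rderive_id (x : R) : is_derive (fun x => x) x 1.
Proof. apply (is_derive_id (K := R_AbsRing)). Qed.

Lemma rderive_plus (f g : R -> R) (x l l' : R) :
  is_derive f x l -> is_derive g x l' -> is_derive (fun x => f x + g x) x (l + l').
Proof. apply (is_derive_plus (K := R_AbsRing) (V := R_NormedModule)). Qed.

Lemma rderive_minus (f g : R -> R) (x l l' : R) :
  is_derive f x l -> is_derive g x l' -> is_derive (fun x => f x - g x) x (l - l').
Proof. apply (is_derive_minus (K := R_AbsRing) (V := R_NormedModule)). Qed.

Lemma rderive_mult (f g : R -> R) (x l l' : R) :
  is_derive f x l -> is_derive g x l' -> is_derive (fun x => f x * g x) x (l * g x + f x * l').
Proof. intros. apply (is_derive_mult (K := R_AbsRing)); auto. intros; apply Rmult_comm. Qed.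

Lemma rderive_comp (f g : R -> R) (x l l' : R) :
  is_derive f (g x) l -> is_derive g x l' -> is_derive (fun x => f (g x)) x (l' * l).
Proof. apply (is_derive_comp (K := R_AbsRing) (V := R_NormedModule)). Qed.

Lemma rderive_continuous (f : R -> R) (x l : R) : is_derive f x l -> continuous f x.
Proof.
  intros H. apply (ex_derive_continuous (K := R_AbsRing) (V := R_NormedModule)).
  exists l; exact H.
Qed.

Lemma c2_comp (f g h : R -> R -> R) (x y : R) :
  continuity_2d_pt f (g x y) (h x y) ->
  continuity_2d_pt g x y -> continuity_2d_pt h x y ->
  continuity_2d_pt (fun u v => f (g u v) (h u v)) x y.
Proof.
  intros Hf Hg Hh eps.
  destruct (Hf eps) as [d Hd].
  destruct (Hg d) as [d1 H1], (Hh d) as [d2 H2].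
  assert (Hm : 0 < Rmin d1 d2) by (apply Rmin_pos; apply cond_pos).
  exists (mkposreal _ Hm); simpl; intros u v Hu Hv.
  apply Hd; [apply H1 | apply H2];
    (eapply Rlt_le_trans; [eassumption | first [apply Rmin_l | apply Rmin_r]]).
Qed.

Ltac c2_tac := repeat first
  [ apply continuity_2d_pt_id1 | apply continuity_2d_pt_id2 | apply continuity_2d_pt_const
  | apply continuity_2d_pt_plus | apply continuity_2d_pt_minus | apply continuity_2d_pt_opp
  | apply continuity_2d_pt_mult | assumption ].

Lemma c2_1d (f : R -> R -> R) (g h : R -> R) (x : R) :
  continuity_2d_pt f (g x) (h x) -> continuous g x -> continuous h x ->
  continuous (fun u => f (g u) (h u)) x.
Proof.
  intros Hf Hg Hh.
  apply continuity_2d_pt_filterlim in Hf.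
  apply (continuous_comp_2 (U := R_UniformSpace) (V := R_UniformSpace)
     (W := R_UniformSpace) (X := R_UniformSpace) g h f); auto.
Qed.

Lemma c2_slice (f : R -> R -> R) (x y : R) :
  continuity_2d_pt f x y -> continuous (fun u => f u y) x.
Proof.
  intros H. apply (c2_1d f (fun u => u) (fun _ => y)); auto.
  apply continuous_id. apply continuous_const.
Qed.

Lemma c2_of_1d_snd (g : R -> R) (x y : R) :
  continuous g y -> continuity_2d_pt (fun _ v => g v) x y.
Proof.
  intros H. apply (continuity_1d_2d_pt_comp g (fun _ v => v)).
  apply continuity_pt_filterlim; exact H. apply continuity_2d_pt_id2.
Qed.

Lemma c2_of_1d_fst (g : R -> R) (x y : R) :
  continuous g x -> continuity_2d_pt (fun u _ => g u) x y.
Proof.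
  intros H. apply (continuity_1d_2d_pt_comp g (fun u _ => u)).
  apply continuity_pt_filterlim; exact H. apply continuity_2d_pt_id1.
Qed.

Lemma c2_ext_strip (s1 s2 : R) (f g : R -> R -> R) (x y : R) :
  s1 < x < s2 -> (forall u v, s1 < u < s2 -> f u v = g u v) ->
  continuity_2d_pt f x y -> continuity_2d_pt g x y.
Proof.
  intros Hx Hfg. apply continuity_2d_pt_ext_loc.
  assert (Hm : 0 < Rmin (x - s1) (s2 - x)) by (apply Rmin_pos; lra).
  exists (mkposreal _ Hm); simpl; intros u v Hu Hv. apply Hfg.
  apply Rabs_def2 in Hu.
  pose proof (Rmin_l (x - s1) (s2 - x)). pose proof (Rmin_r (x - s1) (s2 - x)). lra.
Qed.

Lemma locally_between (a b x : R) (P : R -> Prop) :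
  a < x < b -> (forall u, a < u < b -> P u) -> locally x P.
Proof.
  intros Hx HP. assert (Hr : 0 < Rmin (x - a) (b - x)) by (apply Rmin_pos; lra).
  exists (mkposreal _ Hr). simpl. intros u Hu.
  change (Rabs (u - x) < Rmin (x - a) (b - x)) in Hu. apply Rabs_def2 in Hu.
  pose proof (Rmin_l (x - a) (b - x)). pose proof (Rmin_r (x - a) (b - x)).
  apply HP. lra.
Qed.

Lemma mvt_lip (f g : R -> R) (M a b : R) :
  (forall x, Rmin a b <= x <= Rmax a b -> is_derive f x (g x)) ->
  (forall x, Rmin a b <= x <= Rmax a b -> Rabs (g x) <= M) ->
  Rabs (f b - f a) <= M * Rabs (b - a).
Proof.
  intros Hd Hb.
  destruct (MVT_gen f a b g) as [c [Hc1 Hc2]].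
  - intros x Hx. apply Hd; lra.
  - intros x Hx. apply continuity_pt_filterlim.
    eapply rderive_continuous; apply Hd; lra.
  - rewrite Hc2, Rabs_mult. apply Rmult_le_compat_r. apply Rabs_pos. auto.
Qed.

Lemma between_dist (a b x : R) : Rmin a b <= x <= Rmax a b -> Rabs (x - a) <= Rabs (b - a).
Proof.
  intros Hx. destruct (Rle_dec a b).
  - rewrite Rmin_left, Rmax_right in Hx by lra. rewrite !Rabs_pos_eq by lra. lra.
  - rewrite Rmin_right, Rmax_left in Hx by lra.
    rewrite (Rabs_left (b - a)), Rabs_left1 by lra. lra.
Qed.

Lemma taylor_lip (f g : R -> R) (M a b : R) : 0 <= M ->
  (forall x, Rmin a b <= x <= Rmax a b -> is_derive f x (g x)) ->
  (forall x, Rmin a b <= x <= Rmax a b -> Rabs (g x - g a) <= M * Rabs (x - a)) ->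
  Rabs (f b - f a - (b - a) * g a) <= M * (b - a)^2.
Proof.
  intros HM Hd Hb.
  replace (f b - f a - (b - a) * g a) with (f b - b * g a - (f a - a * g a)) by ring.
  replace (M * (b - a)^2) with (M * Rabs (b - a) * Rabs (b - a)).
  - apply (mvt_lip (fun x => f x - x * g a) (fun x => g x - g a)); intros x Hx.
    + apply (rderive_minus f (fun x => x * g a)). auto. auto_derive; auto; ring.
    + eapply Rle_trans; [apply Hb; auto|]. apply Rmult_le_compat_l; auto.
      apply between_dist, Hx.
  - rewrite Rmult_assoc, <- Rabs_mult, Rabs_pos_eq. ring. apply Rle_0_sqr.
Qed.

(** Many derivatives below come out of an estimate that is uniform in the increment. *)
Lemma is_derive_quadratic (f : R -> R) (x l C : R) :
  (forall h, Rabs (f (x + h) - f x - h * l) <= C * h ^ 2) -> is_derive f x l.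
Proof.
  intros H. apply is_derive_Reals. intros eps Heps.
  assert (HC : 0 < Rabs C + 1) by (pose proof (Rabs_pos C); lra).
  exists (mkposreal (eps / (Rabs C + 1)) ltac:(apply Rdiv_lt_0_compat; lra)). simpl.
  intros h Hh Hhd.
  replace ((f (x + h) - f x) / h - l) with ((f (x + h) - f x - h * l) / h) by (field; auto).
  unfold Rdiv. rewrite Rabs_mult, Rabs_inv.
  assert (Hh' : 0 < Rabs h) by (apply Rabs_pos_lt; auto).
  apply Rmult_lt_reg_r with (Rabs h); auto.
  rewrite Rmult_assoc, Rinv_l, Rmult_1_r by lra.
  eapply Rle_lt_trans; [apply H|]. rewrite <- pow2_abs.
  replace (C * Rabs h ^ 2) with (C * Rabs h * Rabs h) by ring.
  apply Rmult_lt_compat_r; auto.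
  apply Rle_lt_trans with ((Rabs C + 1) * Rabs h).
  apply Rmult_le_compat_r; [lra|]. pose proof (Rle_abs C); lra.
  apply Rmult_lt_compat_l with (r := Rabs C + 1) in Hhd; auto.
  replace ((Rabs C + 1) * (eps / (Rabs C + 1))) with eps in Hhd by (field; lra). auto.
Qed.

(** * Weighted symbol classes *)

Lemma Rpower_nonneg x e : 0 <= Rpower x e.
Proof. left; apply exp_pos. Qed.

Definition fam := nat -> R -> R -> R.

(** Functions of size [s^e] near [s = 0], with [k] derivatives in [y] of the same size and a
    Lipschitz last one, as an estimate of increments yields it.  The constants are uniform in
    the index of the family: this makes the strip of existence common to all members. *)
Fixpoint symb (sg : R) (k : nat) (e : R) (f : fam) : Prop :=
  (forall i s y, 0 < s < sg -> continuity_2d_pt (f i) s y) /\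
  (exists C, 0 <= C /\ forall i s y, 0 < s < sg -> Rabs (f i s y) <= C * Rpower s e) /\
  match k with
  | O => exists C, 0 <= C /\ forall i s y y', 0 < s < sg ->
           Rabs (f i s y' - f i s y) <= C * Rpower s e * Rabs (y' - y)
  | S k' => exists g : fam,
      (forall i s y, 0 < s < sg -> is_derive (f i s) y (g i s y)) /\ symb sg k' e g
  end.

Definition ssymb sg e f := forall k, symb sg k e f.

Lemma Rpower_pos x e : 0 < Rpower x e.
Proof. apply exp_pos. Qed.

Lemma symb_cont sg k e f : symb sg k e f ->
  forall i s y, 0 < s < sg -> continuity_2d_pt (f i) s y.
Proof. destruct k; simpl; tauto. Qed.

Lemma symb_bound sg k e f : symb sg k e f ->
  exists C, 0 <= C /\ forall i s y, 0 < s < sg -> Rabs (f i s y) <= C * Rpower s e.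
Proof. destruct k; simpl; tauto. Qed.

Lemma symb_S sg k e f : symb sg (S k) e f -> symb sg k e f.
Proof.
  revert f; induction k; intros f (Hc & Hb & g & Hg & Hk).
  - split; [exact Hc | split; [exact Hb |]].
    destruct (symb_bound _ _ _ _ Hk) as (C & HC & HCb).
    exists C; split; [exact HC |]. intros i s y y' Hs.
    apply mvt_lip with (g := g i s); auto.
  - split; [exact Hc | split; [exact Hb |]].
    exists g; split; auto.
Qed.

Lemma symb_0 sg k e f : symb sg k e f -> symb sg 0 e f.
Proof. induction k; auto. intros H; apply IHk, symb_S, H. Qed.

Lemma symb_lip sg k e f : symb sg k e f ->
  exists C, 0 <= C /\ forall i s y y', 0 < s < sg ->
           Rabs (f i s y' - f i s y) <= C * Rpower s e * Rabs (y' - y).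
Proof. intros H; apply symb_0 in H. apply H. Qed.

Lemma symb_ext sg k e f g :
  (forall i s y, 0 < s < sg -> f i s y = g i s y) -> symb sg k e f -> symb sg k e g.
Proof.
  destruct k; intros Hfg (Hc & (C & HC & Hb) & H).
  all: split; [|split];
    [ intros i s y Hs; apply c2_ext_strip with (3 := Hc i s y Hs) (1 := Hs); auto
    | exists C; split; auto; intros; rewrite <- Hfg; auto |].
  - destruct H as (C' & HC' & H). exists C'; split; auto. intros; rewrite <- !Hfg; auto.
  - destruct H as (f' & Hf' & H). exists f'; split; auto.
    intros i s y Hs. apply is_derive_ext with (f i s); auto.
Qed.

Lemma symb_weaken sg sg' k e e' f : sg' <= sg ->
  (forall s, 0 < s < sg' -> Rpower s e <= Rpower s e') -> symb sg k e f -> symb sg' k e' f.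
Proof.
  intros Hs He. revert f; induction k; intros f (Hc & (C & HC & Hb) & H).
  all: split; [|split]; [intros; apply Hc; lra
    | exists C; split; auto; intros i s y H0; eapply Rle_trans; [apply Hb; lra|];
      apply Rmult_le_compat_l; auto |].
  - destruct H as (C' & HC' & H). exists C'; split; auto. intros i s y y' H0.
    eapply Rle_trans; [apply H; lra|].
    apply Rmult_le_compat_r; [apply Rabs_pos|]. apply Rmult_le_compat_l; auto.
  - destruct H as (f' & Hf' & H). exists f'; split; auto. intros; apply Hf'; lra.
Qed.

Lemma symb_sub sg sg' k e f : sg' <= sg -> symb sg k e f -> symb sg' k e f.
Proof. intros H. apply symb_weaken; auto. intros; lra. Qed.

Lemma Rpower_le_exp s e e' : 0 < s <= 1 -> e' <= e -> Rpower s e <= Rpower s e'.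
Proof.
  intros Hs He. unfold Rpower.
  assert (ln s <= 0). { rewrite <- ln_1. apply Rcomplements.ln_le; lra. }
  destruct (Req_dec (e * ln s) (e' * ln s)) as [->|Hn]; [lra|].
  left; apply exp_increasing. nra.
Qed.

Lemma symb_le sg k e e' f : sg <= 1 -> e' <= e -> symb sg k e f -> symb sg k e' f.
Proof. intros Hs He. apply symb_weaken; [lra|]. intros; apply Rpower_le_exp; lra. Qed.

Lemma symb_add sg k e f g : symb sg k e f -> symb sg k e g ->
  symb sg k e (fun i s y => f i s y + g i s y).
Proof.
  revert f g; induction k;
    intros f g (Hc & (C & HC & Hb) & H) (Hc' & (C' & HC' & Hb') & H').
  all: split; [|split];
    [ intros; apply continuity_2d_pt_plus; auto
    | exists (C + C'); split; [lra|]; intros i s y Hs;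
      eapply Rle_trans; [apply Rabs_triang|];
      specialize (Hb i s y Hs); specialize (Hb' i s y Hs); lra |].
  - destruct H as (D & HD & H), H' as (D' & HD' & H').
    exists (D + D'); split; [lra|]. intros i s y y' Hs.
    replace (f i s y' + g i s y' - (f i s y + g i s y))
      with ((f i s y' - f i s y) + (g i s y' - g i s y)) by ring.
    eapply Rle_trans; [apply Rabs_triang|].
    specialize (H i s y y' Hs); specialize (H' i s y y' Hs). lra.
  - destruct H as (f' & Hf & H), H' as (g' & Hg & H').
    exists (fun i s y => f' i s y + g' i s y); split; auto.
    intros i s y Hs. apply (rderive_plus); auto.
Qed.

Lemma symb_mul sg k e e' f g : symb sg k e f -> symb sg k e' g ->
  symb sg k (e + e') (fun i s y => f i s y * g i s y).
Proof.
  revert e e' f g; induction k; intros e e' f g Hf Hg;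
    pose proof Hf as (Hc & (C & HC & Hb) & H);
    pose proof Hg as (Hc' & (C' & HC' & Hb') & H').
  all: split; [|split];
    [ intros; apply continuity_2d_pt_mult; auto
    | exists (C * C'); split; [nra|]; intros i s y Hs;
      rewrite Rabs_mult, Rpower_plus;
      replace (C * C' * (Rpower s e * Rpower s e')) with
       ((C * Rpower s e) * (C' * Rpower s e')) by ring;
      apply Rmult_le_compat; auto using Rabs_pos |].
  - destruct H as (D & HD & H), H' as (D' & HD' & H').
    exists (D * C' + C * D'); split; [nra|]. intros i s y y' Hs.
    rewrite Rpower_plus.
    replace (f i s y' * g i s y' - (f i s y * g i s y))
      with ((f i s y' - f i s y) * g i s y' + f i s y * (g i s y' - g i s y)) by ring.
    eapply Rle_trans; [apply Rabs_triang|]. rewrite !Rabs_mult.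
    replace ((D * C' + C * D') * (Rpower s e * Rpower s e') * Rabs (y' - y)) with
      ((D * Rpower s e * Rabs (y' - y)) * (C' * Rpower s e')
        + (C * Rpower s e) * (D' * Rpower s e' * Rabs (y' - y))) by ring.
    apply Rplus_le_compat; apply Rmult_le_compat; auto using Rabs_pos.
  - destruct H as (f' & Hf' & H), H' as (g' & Hg' & H').
    exists (fun i s y => f' i s y * g i s y + f i s y * g' i s y); split; auto.
    + intros i s y Hs.
      apply (rderive_mult); auto.
    + apply symb_add; apply IHk; auto using symb_S.
Qed.

Lemma symb_fun_s sg k e (h : R -> R) :
  (forall s, 0 < s < sg -> continuous h s) ->
  (exists C, 0 <= C /\ forall s, 0 < s < sg -> Rabs (h s) <= C * Rpower s e) ->
  symb sg k e (fun _ s _ => h s).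
Proof.
  revert h; induction k; intros h Hc (C & HC & Hb); (split; [|split];
   [intros; apply c2_of_1d_fst; auto | exists C; split; auto |]).
  - exists 0; split; [lra|]. intros. rewrite Rminus_diag, Rabs_R0. lra.
  - exists (fun _ _ _ => 0); split; [intros; apply rderive_const|].
    apply (IHk (fun _ => 0)). intros; apply continuous_const.
    exists 0; split; [lra|]. intros; rewrite Rabs_R0; lra.
Qed.

Lemma symb_const sg k c : symb sg k 0 (fun _ _ _ => c).
Proof.
  apply (symb_fun_s sg k 0 (fun _ => c)). intros; apply continuous_const.
  exists (Rabs c); split; [apply Rabs_pos|]. intros; rewrite Rpower_O; lra.
Qed.

Lemma is_derive_Rpower x q : 0 < x -> is_derive (fun x => Rpower x q) x (q * Rpower x (q - 1)).
Proof. intros H. apply is_derive_Reals, derivable_pt_lim_power, H. Qed.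

Lemma continuous_Rpower x q : 0 < x -> continuous (fun x => Rpower x q) x.
Proof.
  intros H. eapply rderive_continuous; apply is_derive_Rpower, H.
Qed.

Lemma symb_pow_s sg k e : symb sg k e (fun _ s _ => Rpower s e).
Proof.
  apply symb_fun_s.
  - intros; apply continuous_Rpower; lra.
  - exists 1; split; [lra|]. intros. rewrite Rabs_pos_eq. lra. left; apply Rpower_pos.
Qed.

Lemma Rpower_bound q b C x : 0 < b -> b <= x <= C ->
  Rpower x q <= Rpower b q + Rpower C q.
Proof.
  intros Hb Hx. destruct (Rle_dec 0 q) as [Hq|Hq].
  - apply Rle_trans with (Rpower C q).
    apply Rle_Rpower_l; lra. pose proof (Rpower_pos b q); lra.
  - apply Rle_trans with (Rpower b q).
    + replace q with (- - q) by ring. rewrite !(Rpower_Ropp _ (- q)).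
      apply Rinv_le_contravar. apply Rpower_pos. apply Rle_Rpower_l; lra.
    + pose proof (Rpower_pos C q); lra.
Qed.

(** Powers of a symbol of order 0 that is bounded below: the derivative of such
    a power is again of this kind times a derivative of the symbol. *)
Lemma symb_Rpower sg k b f q : 0 < b ->
  (forall i s y, 0 < s < sg -> b <= f i s y) -> symb sg k 0 f ->
  symb sg k 0 (fun i s y => Rpower (f i s y) q).
Proof.
  intros Hb Hfb. revert q; induction k; intros q Hf;
    pose proof Hf as (Hc & (C & HC & Hbd) & H).
  all: assert (HB : forall i s y, 0 < s < sg -> b <= f i s y <= C) by
    (intros i s y Hs; split; [auto|];
     specialize (Hbd i s y Hs); rewrite Rpower_O in Hbd by lra;
     pose proof (Rle_abs (f i s y)); lra).
  all: split; [|split];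
    [ intros i s y Hs; apply (continuity_1d_2d_pt_comp (fun x => Rpower x q) (f i));
      [ apply continuity_pt_filterlim, continuous_Rpower;
        specialize (HB i s y Hs); lra | auto ]
    | exists (Rpower b q + Rpower C q); split;
      [ pose proof (Rpower_pos b q); pose proof (Rpower_pos C q); lra |];
      intros i s y Hs; rewrite Rpower_O, Rmult_1_r by lra;
      rewrite Rabs_pos_eq by (left; apply Rpower_pos);
      apply Rpower_bound; auto |].
  - destruct H as (D & HD & H).
    set (M := Rpower b (q - 1) + Rpower C (q - 1)).
    exists (Rabs q * M * D); split.
    { repeat apply Rmult_le_pos; auto using Rabs_pos. unfold M.
      pose proof (Rpower_pos b (q-1)); pose proof (Rpower_pos C (q-1)); lra. }
    intros i s y y' Hs.
    apply Rle_trans with (Rabs q * M * Rabs (f i s y' - f i s y)).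
    + apply mvt_lip with (g := fun x => q * Rpower x (q - 1)) (f := fun x => Rpower x q).
      * intros x Hx. apply is_derive_Rpower.
        pose proof (HB i s y Hs). pose proof (HB i s y' Hs).
        destruct (Rmin_case_strong (f i s y) (f i s y')  (fun z => b <= z)); lra.
      * intros x Hx. rewrite Rabs_mult. apply Rmult_le_compat_l; [apply Rabs_pos|].
        rewrite Rabs_pos_eq by (left; apply Rpower_pos). apply Rpower_bound; auto.
        pose proof (HB i s y Hs). pose proof (HB i s y' Hs). split.
        -- apply Rle_trans with (2 := proj1 Hx). apply Rmin_glb; lra.
        -- apply Rle_trans with (1 := proj2 Hx). apply Rmax_lub; lra.
    + replace (Rabs q * M * D * Rpower s 0 * Rabs (y' - y)) with
        (Rabs q * M * (D * Rpower s 0 * Rabs (y' - y))) by ring.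
      apply Rmult_le_compat_l; auto.
      apply Rmult_le_pos; auto using Rabs_pos. unfold M.
      pose proof (Rpower_pos b (q-1)); pose proof (Rpower_pos C (q-1)); lra.
  - destruct H as (f' & Hf' & H).
    exists (fun i s y => f' i s y * (q * Rpower (f i s y) (q - 1))). split.
    + intros i s y Hs.
      apply (rderive_comp
        (fun x => Rpower x q) (f i s)); auto.
      apply is_derive_Rpower. specialize (HB i s y Hs). lra.
    + replace 0 with (0 + (0 + 0)) by ring. apply symb_mul; auto.
      apply symb_mul. apply symb_const. apply IHk. apply symb_S; auto.
Qed.

Definition dy (f : fam) : fam := fun i s y => Derive (f i s) y.

Lemma symb_dy sg k e f : symb sg (S k) e f ->
  (forall i s y, 0 < s < sg -> is_derive (f i s) y (dy f i s y)) /\ symb sg k e (dy f).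
Proof.
  intros (_ & _ & g & Hg & H).
  assert (E : forall i s y, 0 < s < sg -> g i s y = dy f i s y).
  { intros; symmetry; apply is_derive_unique; auto. }
  split.
  - intros i s y Hs. rewrite <- E; auto.
  - apply symb_ext with g; auto.
Qed.

Lemma ssymb_dy sg e f : ssymb sg e f ->
  (forall i s y, 0 < s < sg -> is_derive (f i s) y (dy f i s y)) /\ ssymb sg e (dy f).
Proof.
  intros H. split. apply (symb_dy sg 0 e f (H 1%nat)).
  intros k. apply (symb_dy sg k e f (H (S k))).
Qed.


(** * Integration along characteristics *)

(** A function that tends to 0 at [s = 0] becomes continuous on the whole segment of
    integration when it is extended by 0. *)
Definition ext (h : R -> R -> R) (s y : R) : R := if Rle_dec s 0 then 0 else h s y.
Definition pw (e s : R) : R := ext (fun s _ => Rpower s e) s 0.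

Definition wcont (sg e C : R) (h : R -> R -> R) : Prop :=
  (forall s y, 0 < s < sg -> continuity_2d_pt h s y) /\
  (forall s y, 0 < s < sg -> Rabs (h s y) <= C * Rpower s e).

(** The solution of [v_s + c v_y = h] with [v = 0] at [s = 0], by integration along the
    characteristic through [(s, y)]. *)
Definition transport (c : R) (h : R -> R -> R) (s y : R) : R :=
  RInt (fun t => ext h t (y - c * (s - t))) 0 s.

Lemma pw_pos e s : 0 < s -> pw e s = Rpower s e.
Proof. intros H; unfold pw, ext; destruct (Rle_dec s 0); lra. Qed.

Lemma pw_neg e s : s <= 0 -> pw e s = 0.
Proof. intros H; unfold pw, ext; destruct (Rle_dec s 0); lra. Qed.

Lemma ext_pos h s y : 0 < s -> ext h s y = h s y.
Proof. intros H; unfold ext; destruct (Rle_dec s 0); lra. Qed.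

Lemma ext_neg h s y : s <= 0 -> ext h s y = 0.
Proof. intros H; unfold ext; destruct (Rle_dec s 0); lra. Qed.

Lemma pw_nonneg e s : 0 <= pw e s.
Proof.
  unfold pw, ext; destruct (Rle_dec s 0); [lra|]. apply Rpower_nonneg.
Qed.

Lemma ext_bound sg e C h s y : wcont sg e C h -> s < sg ->
  Rabs (ext h s y) <= C * pw e s.
Proof.
  intros [_ Hb] Hs. destruct (Rle_dec s 0) as [H|H].
  - rewrite ext_neg, pw_neg, Rabs_R0 by auto; lra.
  - rewrite ext_pos, pw_pos by lra. apply Hb; lra.
Qed.

Lemma Rpower_small e eps : 0 < e -> 0 < eps ->
  exists d : posreal, forall s, 0 < s < d -> Rpower s e < eps.
Proof.
  intros He Heps. exists (mkposreal _ (Rpower_pos eps (/ e))); simpl; intros s Hs.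
  replace eps with (Rpower (Rpower eps (/ e)) e).
  - unfold Rpower at 1 2. apply exp_increasing. apply Rmult_lt_compat_l; auto.
    apply ln_increasing; lra.
  - rewrite Rpower_mult, Rinv_l, Rpower_1; lra.
Qed.

Lemma pw_small e eps : 0 < e -> 0 < eps ->
  exists d : posreal, forall s, Rabs s < d -> pw e s < eps.
Proof.
  intros He Heps. destruct (Rpower_small e eps He Heps) as [d Hd].
  exists d; intros s Hs. unfold pw, ext; destruct (Rle_dec s 0); auto.
  apply Hd. apply Rabs_def2 in Hs. lra.
Qed.

Lemma pw_derive e s : 0 < e -> is_derive (pw (e + 1)) s ((e + 1) * pw e s).
Proof.
  intros He. destruct (Rtotal_order s 0) as [H|[->|H]].
  - rewrite pw_neg, Rmult_0_r by lra.
    apply is_derive_ext_loc with (fun _ => 0).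
    + apply locally_between with (s - 1) 0. lra. intros; rewrite pw_neg; lra.
    + apply rderive_const.
  - rewrite pw_neg, Rmult_0_r by lra. apply is_derive_Reals. intros eps Heps.
    destruct (pw_small e eps He Heps) as [d Hd]. exists d. intros h Hh Hhd.
    rewrite Rplus_0_l, (pw_neg _ 0), !Rminus_0_r by lra.
    destruct (Rle_dec h 0).
    + rewrite pw_neg by auto. unfold Rdiv; rewrite Rmult_0_l, Rabs_R0. auto.
    + specialize (Hd h Hhd). rewrite pw_pos in * by lra.
      rewrite Rpower_plus, Rpower_1 by lra.
      replace (Rpower h e * h / h) with (Rpower h e) by (field; lra).
      rewrite Rabs_pos_eq; auto. apply Rpower_nonneg.
  - rewrite pw_pos by lra.
    apply is_derive_ext_loc with (fun x => Rpower x (e + 1)).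
    + apply locally_between with 0 (s + 1). lra. intros; rewrite pw_pos; lra.
    + replace e with (e + 1 - 1) at 2 by ring. apply is_derive_Rpower; lra.
Qed.

Lemma ext_c2 sg e C h : 0 < e -> wcont sg e C h ->
  forall s y, s < sg -> continuity_2d_pt (ext h) s y.
Proof.
  intros He Hw s y Hs. destruct (Rtotal_order s 0) as [H|[->|H]].
  - apply c2_ext_strip with (s1 := s - 1) (s2 := 0) (f := fun _ _ => 0).
    lra. intros; rewrite ext_neg; lra. apply continuity_2d_pt_const.
  - intros eps.
    assert (HC : 0 < Rabs C + 1) by (pose proof (Rabs_pos C); lra).
    destruct (pw_small e (eps / (Rabs C + 1)) He) as [d Hd].
    { apply Rdiv_lt_0_compat; auto. apply cond_pos. }
    assert (Hm : 0 < Rmin d sg) by (apply Rmin_pos; auto; apply cond_pos).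
    exists (mkposreal _ Hm); simpl; intros u v Hu _.
    rewrite Rminus_0_r in Hu. rewrite (ext_neg _ 0), Rminus_0_r by lra.
    assert (Hu1 : Rabs u < d) by (eapply Rlt_le_trans; [apply Hu|apply Rmin_l]).
    assert (Hu2 : Rabs u < sg) by (eapply Rlt_le_trans; [apply Hu|apply Rmin_r]).
    eapply Rle_lt_trans; [apply (ext_bound sg e C); auto|].
    { apply Rabs_def2 in Hu2; lra. }
    apply Rle_lt_trans with ((Rabs C + 1) * pw e u).
    { apply Rmult_le_compat_r. apply pw_nonneg. pose proof (Rle_abs C); lra. }
    specialize (Hd u Hu1).
    replace (pos eps) with ((Rabs C + 1) * (eps / (Rabs C + 1))) by (field; lra).
    apply Rmult_lt_compat_l; auto.
  - apply c2_ext_strip with (s1 := 0) (s2 := sg) (f := h). lra.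
    intros; rewrite ext_pos; lra. apply (proj1 Hw); lra.
Qed.

Lemma pw_continuous e s : 0 < e -> continuous (pw e) s.
Proof.
  intros He. apply (c2_slice (ext (fun s _ => Rpower s e))).
  apply (ext_c2 (s + 1) e 1); auto; [|lra]. split.
  - intros s' y Hs. apply (c2_of_1d_fst (fun s => Rpower s e)), continuous_Rpower; lra.
  - intros s' _ _. rewrite Rabs_pos_eq by apply Rpower_nonneg. lra.
Qed.

Lemma is_RInt_pw e s : 0 < e -> 0 <= s -> is_RInt (pw e) 0 s (pw (e + 1) s / (e + 1)).
Proof.
  intros He Hs.
  replace (pw (e + 1) s / (e + 1)) with (minus (pw (e + 1) s / (e + 1)) (pw (e + 1) 0 / (e + 1))).
  - apply (is_RInt_derive (V := R_CompleteNormedModule) (fun s => pw (e + 1) s / (e + 1))).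
    + intros x _. replace (pw e x) with (((e + 1) * pw e x) * / (e + 1)) by (field; lra).
      apply (is_derive_ext (K := R_AbsRing) (V := R_NormedModule) (fun s => / (e + 1) * pw (e + 1) s)).
      intros; simpl; unfold Rdiv; ring.
      rewrite Rmult_comm.
      apply (is_derive_scal (pw (e + 1)) x (/ (e + 1))).
      apply pw_derive; auto.
    + intros; apply pw_continuous; auto.
  - rewrite (pw_neg _ 0) by lra. unfold minus, plus, opp; simpl. field; lra.
Qed.

Section Transport.

Variables (sg e C c : R) (h : R -> R -> R).
Hypotheses (He : 0 < e) (Hw : wcont sg e C h).

Lemma transport_integrand s y t : t < sg ->
  continuous (fun t => ext h t (y - c * (s - t))) t.
Proof.
  intros Ht. apply (c2_1d (ext h) (fun t => t) (fun t => y - c * (s - t))).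
  - apply (ext_c2 sg e C); auto.
  - apply continuous_id.
  - apply (ex_derive_continuous (K := R_AbsRing) (V := R_NormedModule)).
    auto_derive; auto.
Qed.

Lemma transport_ex s y a b : a < sg -> b < sg ->
  ex_RInt (fun t => ext h t (y - c * (s - t))) a b.
Proof.
  intros Ha Hb. apply (ex_RInt_continuous (V := R_CompleteNormedModule)).
  intros z Hz. apply transport_integrand.
  eapply Rle_lt_trans; [apply Hz|]. apply Rmax_lub_lt; auto.
Qed.

Lemma transport_bound s y : 0 <= s < sg ->
  Rabs (transport c h s y) <= C / (e + 1) * pw (e + 1) s.
Proof.
  intros Hs. unfold transport.
  eapply Rle_trans; [apply abs_RInt_le; [lra| apply transport_ex; lra]|].
  replace (C / (e + 1) * pw (e + 1) s) with (RInt (fun t => C * pw e t) 0 s).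
  - apply RInt_le; [lra | | |].
    + apply (ex_RInt_norm (fun t => ext h t (y - c * (s - t)))), transport_ex; lra.
    + apply (ex_RInt_scal (V := R_NormedModule)). eexists; apply is_RInt_pw; lra.
    + intros t Ht. apply (ext_bound sg); auto; lra.
  - apply is_RInt_unique.
    replace (C / (e + 1) * pw (e + 1) s) with (scal C (pw (e + 1) s / (e + 1))).
    + apply (is_RInt_scal (V := R_NormedModule)), is_RInt_pw; lra.
    + unfold scal; simpl; unfold mult; simpl. field; lra.
Qed.

(** Continuity at fixed characteristic [x = y - c s] is uniform continuity on the
    segment; moving the end point costs the sup of the integrand. *)
Lemma transport_c2 s y : 0 < s < sg -> continuity_2d_pt (transport c h) s y.
Proof.
  intros Hs.
  set (K := fun s x => RInt (fun t => ext h t (x + c * t)) 0 s).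
  assert (HK : forall s y, transport c h s y = K s (y - c * s)).
  { intros s' y'. unfold transport, K. apply RInt_ext. intros t _. f_equal. ring. }
  apply continuity_2d_pt_ext with (fun s y => K s (y - c * s)); [intros; auto|].
  apply (c2_comp K (fun s y => s) (fun s y => y - c * s)).
  2: apply continuity_2d_pt_id1.
  2: { c2_tac. }
  set (x := y - c * s). clearbody x. clear HK.
  set (g := fun t x => ext h t (x + c * t)).
  assert (Hg : forall t x, t < sg -> continuity_2d_pt g t x).
  { intros t x' Ht. apply (c2_comp (ext h) (fun t _ => t) (fun t x => x + c * t)).
    apply (ext_c2 sg e C); auto. all: c2_tac. }
  assert (Hex : forall a b x, a < sg -> b < sg -> ex_RInt (fun t => g t x) a b).
  { intros a b x' Ha Hb. apply (ex_RInt_continuous (V := R_CompleteNormedModule)).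
    intros z Hz. apply (c2_slice g). apply Hg.
    eapply Rle_lt_trans; [apply Hz|]. apply Rmax_lub_lt; auto. }
  set (M := Rabs C * Rpower ((s + sg) / 2) e).
  assert (HM : 0 <= M).
  { apply Rmult_le_pos. apply Rabs_pos. apply Rpower_nonneg. }
  assert (Hgb : forall t x, t <= (s + sg) / 2 -> Rabs (g t x) <= M).
  { intros t x' Ht. unfold g. eapply Rle_trans; [apply (ext_bound sg e C); auto; lra|].
    unfold M. apply Rle_trans with (Rabs C * pw e t).
    apply Rmult_le_compat_r. apply pw_nonneg. apply Rle_abs.
    apply Rmult_le_compat_l. apply Rabs_pos.
    destruct (Rle_dec t 0). rewrite pw_neg by auto; apply Rpower_nonneg.
    rewrite pw_pos by lra. apply Rle_Rpower_l; lra. }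
  intros eps.
  assert (He2 : 0 < eps / 2) by (pose proof (cond_pos eps); lra).
  assert (He3 : 0 < eps / 2 / (s + 1)) by (apply Rdiv_lt_0_compat; lra).
  destruct (uniform_continuity_2d_1d g 0 s x (fun t Ht => Hg t x ltac:(lra))
     (mkposreal _ He3)) as [d Hd]. simpl in Hd.
  assert (Hd2 : 0 < Rmin (Rmin s ((sg - s) / 2)) (Rmin d (eps / 2 / (M + 1)))).
  { repeat apply Rmin_pos; try lra. apply cond_pos. apply Rdiv_lt_0_compat; lra. }
  exists (mkposreal _ Hd2). simpl. intros u v Hu Hv.
  assert (A1 : Rabs (u - s) < s).
  { eapply Rlt_le_trans; [apply Hu|]. eapply Rle_trans; apply Rmin_l. }
  assert (A2 : Rabs (u - s) < (sg - s) / 2).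
  { eapply Rlt_le_trans; [apply Hu|]. eapply Rle_trans; [apply Rmin_l|apply Rmin_r]. }
  assert (A3 : Rabs (u - s) < eps / 2 / (M + 1)).
  { eapply Rlt_le_trans; [apply Hu|]. eapply Rle_trans; [apply Rmin_r|apply Rmin_r]. }
  assert (A4 : Rabs (v - x) < d).
  { eapply Rlt_le_trans; [apply Hv|]. eapply Rle_trans; [apply Rmin_r|apply Rmin_l]. }
  apply Rabs_def2 in A1. pose proof A2 as A2'. apply Rabs_def2 in A2'.
  unfold K. change (Rabs (RInt (fun t => g t v) 0 u - RInt (fun t => g t x) 0 s) < eps).
  assert (E : RInt (fun t => g t v) 0 u = RInt (fun t => g t v) 0 s + RInt (fun t => g t v) s u).
  { symmetry. apply (RInt_Chasles (V := R_CompleteNormedModule) (fun t => g t v)); apply Hex; lra. }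
  rewrite E.
  replace (RInt (fun t => g t v) 0 s + RInt (fun t => g t v) s u - RInt (fun t => g t x) 0 s)
    with (RInt (fun t => g t v - g t x) 0 s + RInt (fun t => g t v) s u).
  2: { rewrite (RInt_minus (V := R_CompleteNormedModule) (fun t => g t v) (fun t => g t x))
         by (apply Hex; lra). unfold minus, plus, opp; simpl. ring. }
  eapply Rle_lt_trans; [apply Rabs_triang|].
  assert (B1 : Rabs (RInt (fun t => g t v - g t x) 0 s) <= (s - 0) * (eps / 2 / (s + 1))).
  { apply abs_RInt_le_const. lra.
    apply (ex_RInt_minus (V := R_NormedModule) (fun t => g t v) (fun t => g t x)); apply Hex; lra.
    intros t Ht. left. apply Rabs_def2 in A4.
    pose proof (cond_pos d).
    apply Hd; try lra. rewrite Rminus_diag, Rabs_R0. apply cond_pos. }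
  assert (B2 : Rabs (RInt (fun t => g t v) s u) <= Rabs (u - s) * M).
  { apply (norm_RInt_le_const_abs (V := R_NormedModule) (fun t => g t v) s u _ M).
    - intros t Ht. apply Hgb. eapply Rle_trans; [apply Ht|]. apply Rmax_lub; lra.
    - apply (RInt_correct (V := R_CompleteNormedModule)). apply Hex; lra. }
  assert (B3 : (s - 0) * (eps / 2 / (s + 1)) < eps / 2).
  { replace (eps / 2) with ((s + 1) * (eps / 2 / (s + 1))) at 2 by (field; lra).
    apply Rmult_lt_compat_r; lra. }
  assert (B4 : Rabs (u - s) * M <= eps / 2).
  { replace (eps / 2) with ((eps / 2 / (M + 1)) * (M + 1)) by (field; lra).
    apply Rmult_le_compat; auto using Rabs_pos; lra. }
  lra.
Qed.

Lemma transport_wcont : wcont sg (e + 1) (C / (e + 1)) (transport c h).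
Proof.
  split. intros; apply transport_c2; auto.
  intros s y Hs. rewrite <- pw_pos by lra. apply transport_bound; lra.
Qed.

Variables (C' : R) (h' : R -> R -> R).
Hypotheses (Hw' : wcont sg e C' h')
  (Hd : forall s y, 0 < s < sg -> is_derive (h s) y (h' s y)).

Lemma ext_derive s y : s < sg -> is_derive (ext h s) y (ext h' s y).
Proof.
  intros Hs. destruct (Rle_dec s 0) as [H|H].
  - rewrite ext_neg by lra. apply is_derive_ext with (fun _ => 0).
    intros; rewrite ext_neg; auto.
    apply rderive_const.
  - rewrite ext_pos by lra. apply is_derive_ext with (h s).
    intros; rewrite ext_pos; auto; lra. apply Hd; lra.
Qed.

End Transport.

Lemma transport_dy sg e C C' c h h' : 0 < e -> wcont sg e C h -> wcont sg e C' h' ->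
  (forall s y, 0 < s < sg -> is_derive (h s) y (h' s y)) ->
  forall s y, 0 < s < sg -> is_derive (transport c h s) y (transport c h' s y).
Proof.
  intros He Hw Hw' Hd s y Hs. unfold transport.
  assert (D : forall u t, t < sg ->
    is_derive (fun u => ext h t (u - c * (s - t))) u (ext h' t (u - c * (s - t)))).
  { intros u t Ht.
    replace (ext h' t (u - c * (s - t))) with (1 * ext h' t (u - c * (s - t))) by ring.
    apply (rderive_comp
             (ext h t) (fun u => u - c * (s - t))).
    apply (ext_derive sg); auto.
    auto_derive; auto; ring. }
  replace (RInt (fun t => ext h' t (y - c * (s - t))) 0 s)
    with (RInt (fun t => Derive (fun u => ext h t (u - c * (s - t))) y) 0 s).
  2: { apply RInt_ext. intros t Ht. apply is_derive_unique, D.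
       rewrite Rmin_left, Rmax_right in Ht by lra. lra. }
  apply (is_derive_RInt_param (fun u t => ext h t (u - c * (s - t)))).
  - exists (mkposreal 1 Rlt_0_1). intros u _ t Ht.
    rewrite Rmin_left, Rmax_right in Ht by lra.
    eexists; apply D; lra.
  - intros t Ht. rewrite Rmin_left, Rmax_right in Ht by lra.
    apply continuity_2d_pt_ext_loc with (fun u t => ext h' t (u - c * (s - t))).
    + exists (mkposreal (sg - s) ltac:(lra)). simpl; intros u v _ Hv.
      apply Rabs_def2 in Hv. symmetry. apply is_derive_unique, D. lra.
    + apply (c2_comp (ext h') (fun _ t => t) (fun u t => u - c * (s - t))).
      * apply (ext_c2 sg e C'); auto; lra.
      * apply continuity_2d_pt_id2.
      * c2_tac.
  - exists (mkposreal 1 Rlt_0_1). intros u _.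
    apply (transport_ex sg e C c h He Hw s u); lra.
Qed.

Lemma transport_ds sg e C C' c h h' : 0 < e -> wcont sg e C h -> wcont sg e C' h' ->
  (forall s y, 0 < s < sg -> is_derive (h s) y (h' s y)) ->
  forall s y, 0 < s < sg ->
    is_derive (fun s => transport c h s y) s (h s y - c * transport c h' s y).
Proof.
  intros He Hw Hw' Hd s y Hs. unfold transport.
  assert (D : forall s t, t < sg ->
    is_derive (fun s => ext h t (y - c * (s - t))) s (- c * ext h' t (y - c * (s - t)))).
  { intros u t Ht.
    apply (rderive_comp
             (ext h t) (fun s => y - c * (s - t))).
    apply (ext_derive sg); auto.
    auto_derive; auto; ring. }
  set (r := (sg - s) / 2).
  assert (Hr : 0 < r) by (unfold r; lra).
  replace (h s y - c * RInt (fun t => ext h' t (y - c * (s - t))) 0 s)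
    with (RInt (fun t => Derive (fun s => ext h t (y - c * (s - t))) s) 0 s
           + ext h s (y - c * (s - s)) * 1).
  2: { rewrite ext_pos by lra. rewrite Rminus_diag, Rmult_0_r, Rminus_0_r.
       rewrite (RInt_ext _ (fun t => scal (- c) (ext h' t (y - c * (s - t))))).
       rewrite (RInt_scal (V := R_CompleteNormedModule)).
       unfold scal; simpl; unfold mult; simpl. ring.
       apply (transport_ex sg e C' c h' He Hw' s y); lra.
       intros t Ht. rewrite Rmin_left, Rmax_right in Ht by lra.
       apply is_derive_unique, D. lra. }
  assert (Cd : forall s' t, t < sg ->
     continuity_2d_pt (fun u v => Derive (fun z => ext h v (y - c * (z - v))) u) s' t).
  { intros s' t Ht.
    apply continuity_2d_pt_ext_loc with (fun u t => - c * ext h' t (y - c * (u - t))).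
    + exists (mkposreal (sg - t) ltac:(lra)). simpl; intros u v _ Hv.
      apply Rabs_def2 in Hv. symmetry. apply is_derive_unique, D. lra.
    + c2_tac.
      apply (c2_comp (ext h') (fun _ t => t) (fun u t => y - c * (u - t))).
      * apply (ext_c2 sg e C'); auto; lra.
      * apply continuity_2d_pt_id2.
      * c2_tac. }
  apply (is_derive_RInt_param_bound_comp_aux3
           (fun s t => ext h t (y - c * (s - t))) 0 (fun s => s) s 1).
  - exists (mkposreal 1 Rlt_0_1). intros u _.
    apply (transport_ex sg e C c h He Hw u y); lra.
  - exists (mkposreal r Hr). exists (mkposreal 1 Rlt_0_1). intros u _. simpl.
    apply (transport_ex sg e C c h He Hw u y); unfold r; lra.
  - apply rderive_id.
  - exists (mkposreal r Hr). exists (mkposreal 1 Rlt_0_1). simpl. intros u _ t Ht.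
    rewrite Rmax_right in Ht by lra.
    eexists; apply D. unfold r in Ht; lra.
  - intros t Ht. rewrite Rmin_left, Rmax_right in Ht by lra. apply Cd; lra.
  - exists (mkposreal (sg - s) ltac:(lra)). simpl; intros u v _ Hv.
    apply Rabs_def2 in Hv. apply Cd. lra.
  - apply continuity_pt_filterlim.
    apply (transport_integrand sg e C c h He Hw s y); lra.
Qed.

Lemma transport_ext sg e C c h g : 0 < e -> wcont sg e C h ->
  (forall s y, 0 < s < sg -> h s y = g s y) ->
  forall s y, 0 < s < sg -> transport c h s y = transport c g s y.
Proof.
  intros He Hw E s y Hs. apply RInt_ext. intros t Ht.
  rewrite Rmin_left, Rmax_right in Ht by lra. rewrite !ext_pos by lra. apply E; lra.
Qed.

Lemma transport_minus sg e C C' c h g : 0 < e -> wcont sg e C h -> wcont sg e C' g ->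
  forall s y, 0 < s < sg ->
  transport c (fun s y => h s y - g s y) s y = transport c h s y - transport c g s y.
Proof.
  intros He Hw Hw' s y Hs. unfold transport.
  change (RInt (fun t => ext h t (y - c * (s - t))) 0 s - RInt (fun t => ext g t (y - c * (s - t))) 0 s)
   with (minus (RInt (fun t => ext h t (y - c * (s - t))) 0 s) (RInt (fun t => ext g t (y - c * (s - t))) 0 s)).
  rewrite <- (RInt_minus (V := R_CompleteNormedModule)).
  2: apply (transport_ex sg e C c h He Hw s y); lra.
  2: apply (transport_ex sg e C' c g He Hw' s y); lra.
  apply RInt_ext. intros t Ht.
  rewrite Rmin_left, Rmax_right in Ht by lra. rewrite !ext_pos by lra. reflexivity.
Qed.

Lemma transport_scal sg e C c a h : 0 < e -> wcont sg e C h ->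
  forall s y, 0 < s < sg ->
  transport c (fun s y => a * h s y) s y = a * transport c h s y.
Proof.
  intros He Hw s y Hs. unfold transport.
  rewrite <- (RInt_scal (V := R_CompleteNormedModule) (fun t => ext h t (y - c * (s - t)))).
  2: apply (transport_ex sg e C c h He Hw s y); lra.
  apply RInt_ext. intros t Ht.
  rewrite Rmin_left, Rmax_right in Ht by lra. rewrite !ext_pos by lra. reflexivity.
Qed.

Lemma transport_shift c a h s y :
  transport c (fun s y => h s (y + a)) s y = transport c h s (y + a).
Proof.
  apply RInt_ext. intros t _. unfold ext. destruct (Rle_dec t 0); auto.
  f_equal; ring.
Qed.


(** * The singular Volterra equation *)

(** The solution of [r_ss + 2 r_sy = h] with vanishing data at [s = 0]. *)
Definition duhamel (h : R -> R -> R) : R -> R -> R := transport 0 (transport 2 h).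

Lemma wcont_le sg e C C' h : C <= C' -> wcont sg e C h -> wcont sg e C' h.
Proof.
  intros HC [Hc Hb]; split; auto. intros s y Hs.
  eapply Rle_trans; [apply Hb; auto|]. apply Rmult_le_compat_r; auto.
  apply Rpower_nonneg.
Qed.

Lemma wcont_minus sg e C C' h g : wcont sg e C h -> wcont sg e C' g ->
  wcont sg e (C + C') (fun s y => h s y - g s y).
Proof.
  intros [Hc Hb] [Gc Gb]; split.
  - intros; apply continuity_2d_pt_minus; auto.
  - intros s y Hs. eapply Rle_trans; [apply Rabs_triang|].
    rewrite Rabs_Ropp, Rmult_plus_distr_r. apply Rplus_le_compat; auto.
Qed.

Lemma wcont_scal sg e C a h : wcont sg e C h -> wcont sg e (Rabs a * C) (fun s y => a * h s y).
Proof.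
  intros [Hc Hb]; split.
  - intros; apply continuity_2d_pt_mult; auto. apply continuity_2d_pt_const.
  - intros s y Hs. rewrite Rabs_mult, Rmult_assoc.
    apply Rmult_le_compat_l; auto using Rabs_pos.
Qed.

Lemma wcont_shift sg e C h a : wcont sg e C h -> wcont sg e C (fun s y => h s (y + a)).
Proof.
  intros [Hc Hb]; split; auto.
  intros s y Hs. apply (c2_comp h (fun s y => s) (fun s y => y + a)); auto; c2_tac.
Qed.

Lemma duhamel_wcont sg m C h : 2 < m -> wcont sg (m - 2) C h ->
  wcont sg m (C / (m * (m - 1))) (duhamel h).
Proof.
  intros Hm Hw.
  assert (H1 := transport_wcont sg (m - 2) C 2 h ltac:(lra) Hw).
  assert (H2 := transport_wcont sg (m - 2 + 1) (C / (m - 2 + 1)) 0 _ ltac:(lra) H1).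
  replace (m - 2 + 1 + 1) with m in H2 by ring.
  replace (C / (m - 2 + 1) / m) with (C / (m * (m - 1))) in H2 by (field; lra).
  exact H2.
Qed.

Lemma duhamel_minus sg m C C' h g : 2 < m -> wcont sg (m - 2) C h -> wcont sg (m - 2) C' g ->
  forall s y, 0 < s < sg ->
  duhamel (fun s y => h s y - g s y) s y = duhamel h s y - duhamel g s y.
Proof.
  intros Hm Hw Hw' s y Hs.
  assert (W := transport_wcont sg (m - 2) C 2 h ltac:(lra) Hw).
  assert (W' := transport_wcont sg (m - 2) C' 2 g ltac:(lra) Hw').
  unfold duhamel. rewrite <- (transport_minus sg (m - 2 + 1) _ _ 0 _ _ ltac:(lra) W W') by auto.
  symmetry. apply (transport_ext sg (m - 2 + 1) (C / (m - 2 + 1) + C' / (m - 2 + 1))); auto.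
  lra.
  - apply wcont_minus; auto.
  - intros s' y' Hs'. symmetry. apply (transport_minus sg (m - 2) C C'); auto. lra.
Qed.

Lemma duhamel_scal sg m C a h : 2 < m -> wcont sg (m - 2) C h ->
  forall s y, 0 < s < sg ->
  duhamel (fun s y => a * h s y) s y = a * duhamel h s y.
Proof.
  intros Hm Hw s y Hs.
  assert (W := transport_wcont sg (m - 2) C 2 h ltac:(lra) Hw).
  unfold duhamel. rewrite <- (transport_scal sg (m - 2 + 1) _ 0 a _ ltac:(lra) W) by auto.
  symmetry. apply (transport_ext sg (m - 2 + 1) (Rabs a * (C / (m - 2 + 1)))); auto.
  lra.
  - apply wcont_scal; auto.
  - intros s' y' Hs'. symmetry. apply (transport_scal sg (m - 2) C); auto. lra.
Qed.

Lemma duhamel_shift a h s y :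
  duhamel (fun s y => h s (y + a)) s y = duhamel h s (y + a).
Proof.
  unfold duhamel. rewrite <- transport_shift.
  apply RInt_ext. intros t _. unfold ext. destruct (Rle_dec t 0); auto.
  apply transport_shift.
Qed.

Lemma lim_geom_le (x a q A : R) : 0 <= q < 1 -> (forall n, x <= a + q ^ n * A) -> x <= a.
Proof.
  intros Hq H.
  assert (L : is_lim_seq (fun n => a + q ^ n * A) (a + 0 * A)).
  { apply is_lim_seq_plus'. apply is_lim_seq_const.
    apply is_lim_seq_mult'. apply is_lim_seq_geom. rewrite Rabs_pos_eq; lra.
    apply is_lim_seq_const. }
  rewrite Rmult_0_l, Rplus_0_r in L.
  apply (is_lim_seq_le (fun _ => x) (fun n => a + q ^ n * A) x a); auto.
  apply is_lim_seq_const.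
Qed.

Lemma geom_small (q A eps : R) : 0 <= q < 1 -> 0 < eps -> exists n, q ^ n * A < eps.
Proof.
  intros Hq He. apply NNPP. intros H.
  assert (eps <= 0); [|lra].
  apply lim_geom_le with (q := q) (A := A); auto. intros n.
  apply Rnot_lt_le. intros Hn. apply H. exists n. lra.
Qed.

Lemma Rpower_m2 s m A : Rpower s (-2) * (A * Rpower s m) = A * Rpower s (m - 2).
Proof. replace (m - 2) with (-2 + m) by ring. rewrite Rpower_plus. ring. Qed.

Section Volterra.

Variables (sg m La : R).
Hypotheses (Hm : 2 < m) (HLa : 0 <= La < m * (m - 1)).

(** The operator norm of [duhamel (La s^-2 .)] on functions bounded by [s^m] is
    [La / (m (m - 1)) < 1], so that an a priori bound of this kind improves itself. *)
Lemma volterra_bound A C Cg D g : 0 <= C ->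
  (forall s y, 0 < s < sg -> Rabs (D s y) <= A * Rpower s m) ->
  wcont sg (m - 2) Cg g ->
  (forall s y, 0 < s < sg -> D s y = duhamel g s y) ->
  (forall s y, 0 < s < sg ->
     Rabs (g s y) <= La * Rpower s (-2) * Rabs (D s y) + C * Rpower s (m - 2)) ->
  forall s y, 0 < s < sg -> Rabs (D s y) <= C / (m * (m - 1) - La) * Rpower s m.
Proof.
  intros HC HA Hg HD Hgb.
  set (M := m * (m - 1)). set (q := La / M). set (C1 := C / (M - La)).
  assert (HLaM : 0 <= La < M) by exact HLa.
  assert (HM : 0 < M) by lra.
  assert (Hq : 0 <= q < 1).
  { unfold q; split. apply Rmult_le_pos. lra. left; apply Rinv_0_lt_compat; lra.
    apply -> Rcomplements.Rdiv_lt_1; lra. }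
  assert (HA0 : forall s y, 0 < s < sg -> Rabs (D s y) <= (C1 + Rabs A) * Rpower s m).
  { intros s y Hs. eapply Rle_trans; [apply HA; auto|]. apply Rmult_le_compat_r.
    apply Rpower_nonneg.
    assert (0 <= C1). { apply Rmult_le_pos; auto. left; apply Rinv_0_lt_compat; lra. }
    pose proof (Rle_abs A); lra. }
  assert (Hn : forall n s y, 0 < s < sg -> Rabs (D s y) <= (C1 + q ^ n * Rabs A) * Rpower s m).
  { induction n; intros s y Hs.
    - rewrite pow_O, Rmult_1_l; auto.
    - assert (W : wcont sg (m - 2) (La * (C1 + q ^ n * Rabs A) + C) g).
      { split. apply Hg. intros s' y' Hs'. eapply Rle_trans; [apply Hgb; auto|].
        rewrite Rmult_plus_distr_r. apply Rplus_le_compat_r.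
        rewrite !Rmult_assoc. apply Rmult_le_compat_l; [lra|].
        rewrite <- Rpower_m2. apply Rmult_le_compat_l. apply Rpower_nonneg. auto. }
      rewrite HD by auto.
      eapply Rle_trans; [apply (duhamel_wcont sg m _ g Hm W); auto|].
      apply Req_le. f_equal. fold M. unfold q, C1. simpl. field. lra. }
  intros s y Hs.
  apply lim_geom_le with (q := q) (A := Rabs A * Rpower s m); auto.
  intros n. eapply Rle_trans; [apply (Hn n); auto|]. apply Req_le; ring.
Qed.

Section Existence.

Variables (F B : R) (N : R -> R -> R -> R).
Hypotheses (HF : 0 <= F) (HB : F <= B * (m * (m - 1) - La))
  (H0 : forall s y, 0 < s < sg -> Rabs (N s y 0) <= F * Rpower s (m - 2))
  (HL : forall s y r r', 0 < s < sg ->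
     Rabs r <= B * Rpower s m -> Rabs r' <= B * Rpower s m ->
     Rabs (N s y r - N s y r') <= La * Rpower s (-2) * Rabs (r - r'))
  (Hc : forall z, wcont sg m B z -> forall s y, 0 < s < sg ->
     continuity_2d_pt (fun s y => N s y (z s y)) s y).

Lemma ball_nonneg : 0 <= B.
Proof. nra. Qed.

Lemma nonlin_wcont z : wcont sg m B z ->
  wcont sg (m - 2) (B * (m * (m - 1))) (fun s y => N s y (z s y)).
Proof.
  intros Hz; split. apply Hc; auto. intros s y Hs.
  replace (N s y (z s y)) with (N s y 0 + (N s y (z s y) - N s y 0)) by ring.
  eapply Rle_trans; [apply Rabs_triang|].
  assert (Hzb := proj2 Hz s y Hs).
  assert (H1 : Rabs (N s y (z s y) - N s y 0) <= La * B * Rpower s (m - 2)).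
  { eapply Rle_trans; [apply HL; auto|].
    rewrite Rabs_R0. apply Rmult_le_pos. apply ball_nonneg. apply Rpower_nonneg.
    rewrite Rminus_0_r, !Rmult_assoc, <- Rpower_m2.
    apply Rmult_le_compat_l; [lra|]. apply Rmult_le_compat_l; auto. apply Rpower_nonneg. }
  specialize (H0 s y Hs). pose proof (Rpower_pos s (m - 2)). nra.
Qed.

Fixpoint picard (n : nat) : R -> R -> R :=
  match n with
  | O => fun _ _ => 0
  | S n => duhamel (fun s y => N s y (picard n s y))
  end.

Lemma picard_wcont n : wcont sg m B (picard n).
Proof.
  induction n; simpl.
  - split. intros; apply continuity_2d_pt_const. intros. rewrite Rabs_R0.
    apply Rmult_le_pos. apply ball_nonneg. apply Rpower_nonneg.
  - replace B with (B * (m * (m - 1)) / (m * (m - 1))) by (field; lra).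
    apply duhamel_wcont; auto. apply nonlin_wcont; auto.
Qed.

Lemma nonlin_diff_bound z z' A : wcont sg m B z -> wcont sg m B z' ->
  (forall s y, 0 < s < sg -> Rabs (z s y - z' s y) <= A * Rpower s m) ->
  forall s y, 0 < s < sg ->
  Rabs (duhamel (fun s y => N s y (z s y)) s y - duhamel (fun s y => N s y (z' s y)) s y)
    <= La / (m * (m - 1)) * A * Rpower s m.
Proof.
  intros Hz Hz' Hd s y Hs.
  rewrite <- (duhamel_minus sg m _ _ _ _ Hm (nonlin_wcont z Hz) (nonlin_wcont z' Hz')) by auto.
  replace (La / (m * (m - 1)) * A) with (La * A / (m * (m - 1))) by (field; lra).
  apply (duhamel_wcont sg m); auto. split.
  - intros; apply continuity_2d_pt_minus; apply nonlin_wcont; auto.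
  - intros s' y' Hs'. eapply Rle_trans; [apply HL; auto; [apply Hz | apply Hz']; auto|].
    rewrite !Rmult_assoc, <- Rpower_m2.
    apply Rmult_le_compat_l; [lra|]. apply Rmult_le_compat_l; auto. apply Rpower_nonneg.
Qed.

(** Picard iteration; the ball of radius [B] in the norm [sup |r| / s^m] is preserved by the
    choice [F <= B (m (m - 1) - La)]. *)
Lemma volterra_exists : exists z, wcont sg m B z /\
  forall s y, 0 < s < sg -> z s y = duhamel (fun s y => N s y (z s y)) s y.
Proof.
  set (q := La / (m * (m - 1))).
  assert (Hq : 0 <= q < 1).
  { unfold q; split. apply Rmult_le_pos. lra. left; apply Rinv_0_lt_compat; lra.
    apply -> Rcomplements.Rdiv_lt_1; lra. }
  pose proof ball_nonneg as HB0.
  assert (Hstep : forall n s y, 0 < s < sg ->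
    Rabs (picard (S n) s y - picard n s y) <= q ^ n * B * Rpower s m).
  { induction n; intros s y Hs.
    - simpl (picard 0). rewrite Rminus_0_r, pow_O, Rmult_1_l. apply (picard_wcont 1); auto.
    - simpl (q ^ S n). rewrite (Rmult_assoc q).
      apply (nonlin_diff_bound (picard (S n)) (picard n)); auto using picard_wcont. }
  set (B1 := B / (1 - q)).
  assert (HB1 : 0 <= B1).
  { apply Rmult_le_pos; auto. left; apply Rinv_0_lt_compat; lra. }
  assert (Hfar : forall n k s y, 0 < s < sg ->
    Rabs (picard (n + k) s y - picard n s y) <= q ^ n * B1 * (1 - q ^ k) * Rpower s m).
  { intros n k s y Hs. induction k.
    - rewrite Nat.add_0_r, Rminus_diag, Rabs_R0. simpl. lra.
    - rewrite Nat.add_succ_r.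
      replace (picard (S (n + k)) s y - picard n s y) with
       ((picard (S (n + k)) s y - picard (n + k) s y) + (picard (n + k) s y - picard n s y)) by ring.
      eapply Rle_trans; [apply Rabs_triang|].
      specialize (Hstep (n + k)%nat s y Hs). rewrite pow_add in Hstep.
      replace (q ^ n * B1 * (1 - q ^ S k) * Rpower s m) with
       (q ^ n * q ^ k * B * Rpower s m + q ^ n * B1 * (1 - q ^ k) * Rpower s m).
      lra. simpl. unfold B1. field. lra. }
  assert (Hfar' : forall n k s y, 0 < s < sg ->
    Rabs (picard (n + k) s y - picard n s y) <= q ^ n * (B1 * Rpower s m)).
  { intros n k s y Hs. eapply Rle_trans; [apply Hfar; auto|].
    rewrite !Rmult_assoc. apply Rmult_le_compat_l. apply pow_le; lra.
    apply Rmult_le_compat_l; auto. rewrite <- (Rmult_1_l (Rpower s m)) at 2.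
    apply Rmult_le_compat_r. apply Rpower_nonneg.
    assert (0 <= q ^ k) by (apply pow_le; lra). lra. }
  set (z := fun s y => real (Lim_seq (fun n => picard n s y))).
  assert (Hlim : forall s y, 0 < s < sg -> is_lim_seq (fun n => picard n s y) (z s y)).
  { intros s y Hs. apply Lim_seq_correct'. apply ex_lim_seq_cauchy_corr.
    intros eps.
    destruct (geom_small q (B1 * Rpower s m) (eps / 2)) as [n0 Hn0]; auto.
    { pose proof (cond_pos eps); lra. }
    assert (Hb : forall n, (n0 <= n)%nat -> Rabs (picard n s y - picard n0 s y) < eps / 2).
    { intros n Hn. replace n with (n0 + (n - n0))%nat by lia.
      eapply Rle_lt_trans; [apply Hfar'; auto | auto]. }
    exists n0. intros n n' Hn Hn'.
    replace (picard n s y - picard n' s y) with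
      ((picard n s y - picard n0 s y) - (picard n' s y - picard n0 s y)) by ring.
    eapply Rle_lt_trans; [apply Rabs_triang|]. rewrite Rabs_Ropp.
    specialize (Hb n Hn) as Hb1. specialize (Hb n' Hn'). lra. }
  assert (Hclose : forall n s y, 0 < s < sg ->
    Rabs (z s y - picard n s y) <= q ^ n * B1 * Rpower s m).
  { intros n s y Hs. rewrite Rmult_assoc.
    apply (is_lim_seq_le (fun k => Rabs (picard (k + n) s y - picard n s y))
             (fun _ => q ^ n * (B1 * Rpower s m)) (Rabs (z s y - picard n s y))
             (q ^ n * (B1 * Rpower s m))).
    - intros k. rewrite Nat.add_comm. auto.
    - apply (is_lim_seq_abs _ (z s y - picard n s y)). apply is_lim_seq_minus'.
      apply (is_lim_seq_incr_n (fun k => picard k s y) n (z s y)). auto.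
      apply is_lim_seq_const.
    - apply is_lim_seq_const. }
  assert (Hz : wcont sg m B z).
  { split.
    - intros s y Hs eps.
      set (s2 := (s + sg) / 2).
      assert (He3 : 0 < eps / 3) by (pose proof (cond_pos eps); lra).
      destruct (geom_small q (B1 * Rpower s2 m) (eps / 3)) as [n Hn]; auto.
      assert (Hu : forall u v, 0 < u < s2 -> Rabs (z u v - picard n u v) < eps / 3).
      { intros u v Hu. eapply Rle_lt_trans; [apply Hclose; unfold s2 in Hu; lra|].
        eapply Rle_lt_trans; [|apply Hn]. rewrite Rmult_assoc.
        apply Rmult_le_compat_l; [apply pow_le; lra|]. apply Rmult_le_compat_l; auto.
        apply Rle_Rpower_l; lra. }
      destruct (proj1 (picard_wcont n) s y Hs (mkposreal _ He3)) as [d Hd]. simpl in Hd.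
      assert (Hd' : 0 < Rmin d (Rmin s (s2 - s))).
      { repeat apply Rmin_pos; unfold s2; try lra. apply cond_pos. }
      exists (mkposreal _ Hd'). simpl. intros u v Huu Hvv.
      assert (X1 : Rabs (u - s) < d) by (eapply Rlt_le_trans; [apply Huu|apply Rmin_l]).
      assert (X2 : Rabs (v - y) < d) by (eapply Rlt_le_trans; [apply Hvv|apply Rmin_l]).
      assert (X3 : Rabs (u - s) < Rmin s (s2 - s)) by (eapply Rlt_le_trans; [apply Huu|apply Rmin_r]).
      pose proof (Rmin_l s (s2 - s)). pose proof (Rmin_r s (s2 - s)).
      apply Rabs_def2 in X3.
      specialize (Hd u v X1 X2).
      assert (Y1 := Hu u v ltac:(lra)). assert (Y2 := Hu s y ltac:(unfold s2; lra)).
      replace (z u v - z s y) with ((z u v - picard n u v) + (picard n u v - picard n s y)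
        - (z s y - picard n s y)) by ring.
      eapply Rle_lt_trans; [apply Rabs_triang|]. rewrite Rabs_Ropp.
      pose proof (Rabs_triang (z u v - picard n u v) (picard n u v - picard n s y)). lra.
    - intros s y Hs.
      apply (is_lim_seq_le (fun k => Rabs (picard k s y)) (fun _ => B * Rpower s m)
               (Rabs (z s y)) (B * Rpower s m)).
      + intros k. apply (picard_wcont k); auto.
      + apply (is_lim_seq_abs _ (z s y)); auto.
      + apply is_lim_seq_const. }
  exists z; split; auto.
  intros s y Hs. apply Rminus_diag_uniq, Rabs_eq_0, Rle_antisym; [|apply Rabs_pos].
  apply lim_geom_le with (q := q) (A := 2 * B1 * Rpower s m); auto.
  intros n. rewrite Rplus_0_l.
  replace (z s y - duhamel (fun s y => N s y (z s y)) s y) with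
   ((z s y - picard (S n) s y) -
    (duhamel (fun s y => N s y (z s y)) s y - duhamel (fun s y => N s y (picard n s y)) s y))
   by (simpl; ring).
  eapply Rle_trans; [apply Rabs_triang|]. rewrite Rabs_Ropp.
  assert (E1 := Hclose (S n) s y Hs).
  assert (E2 := nonlin_diff_bound z (picard n) (q ^ n * B1) Hz (picard_wcont n) (Hclose n) s y Hs).
  fold q in E2. simpl (q ^ S n) in E1.
  assert (0 <= q ^ n * (B1 * Rpower s m)).
  { apply Rmult_le_pos. apply pow_le; lra. apply Rmult_le_pos; auto. apply Rpower_nonneg. }
  nra.
Qed.

End Existence.

End Volterra.


(** * Regularity of the solution along the surface *)

(** Quantities attached to an increment [h] of [y]: order [j] in [h], size [s^e]. *)
Definition bigO (sg : R) (j : nat) (e : R) (g : nat -> R -> R -> R -> R) : Prop :=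
  exists C, 0 <= C /\ forall i s y h, 0 < s < sg ->
    Rabs (g i s y h) <= C * Rabs h ^ j * Rpower s e.

Lemma bigO_add sg j e f g : bigO sg j e f -> bigO sg j e g ->
  bigO sg j e (fun i s y h => f i s y h + g i s y h).
Proof.
  intros (C & HC & H) (C' & HC' & H'). exists (C + C'); split; [lra|].
  intros i s y h Hs. eapply Rle_trans; [apply Rabs_triang|].
  specialize (H i s y h Hs); specialize (H' i s y h Hs). lra.
Qed.

Lemma bigO_mul sg j j' e e' f g : bigO sg j e f -> bigO sg j' e' g ->
  bigO sg (j + j') (e + e') (fun i s y h => f i s y h * g i s y h).
Proof.
  intros (C & HC & H) (C' & HC' & H'). exists (C * C'); split; [nra|].
  intros i s y h Hs. rewrite Rabs_mult, pow_add, Rpower_plus.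
  replace (C * C' * (Rabs h ^ j * Rabs h ^ j') * (Rpower s e * Rpower s e'))
   with ((C * Rabs h ^ j * Rpower s e) * (C' * Rabs h ^ j' * Rpower s e')) by ring.
  apply Rmult_le_compat; auto using Rabs_pos.
Qed.

Lemma bigO_opp sg j e f : bigO sg j e f -> bigO sg j e (fun i s y h => - f i s y h).
Proof.
  intros (C & HC & H). exists C; split; auto. intros; rewrite Rabs_Ropp; auto.
Qed.

Lemma bigO_dom sg j e f g : (forall i s y h, 0 < s < sg -> Rabs (f i s y h) <= Rabs (g i s y h)) ->
  bigO sg j e g -> bigO sg j e f.
Proof.
  intros E (C & HC & H). exists C; split; auto. intros.
  eapply Rle_trans; [apply E; auto|]. auto.
Qed.

Lemma bigO_le sg j e e' f : sg <= 1 -> e' <= e -> bigO sg j e f -> bigO sg j e' f.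
Proof.
  intros Hs He (C & HC & H). exists C; split; auto. intros i s y h H0.
  eapply Rle_trans; [apply H; auto|]. apply Rmult_le_compat_l.
  apply Rmult_le_pos; auto. apply pow_le, Rabs_pos. apply Rpower_le_exp; lra.
Qed.

Lemma bigO_symb sg k e f : symb sg k e f -> bigO sg 0 e (fun i s y _ => f i s y).
Proof.
  intros H. destruct (symb_bound _ _ _ _ H) as (C & HC & Hb).
  exists C; split; auto. intros. rewrite pow_O, Rmult_1_r; auto.
Qed.

Lemma bigO_symb_shift sg k e f : symb sg k e f -> bigO sg 0 e (fun i s y h => f i s (y + h)).
Proof.
  intros H. destruct (symb_bound _ _ _ _ H) as (C & HC & Hb).
  exists C; split; auto. intros. rewrite pow_O, Rmult_1_r; auto.
Qed.

Lemma bigO_lip sg k e f : symb sg k e f ->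
  bigO sg 1 e (fun i s y h => f i s (y + h) - f i s y).
Proof.
  intros H. destruct (symb_lip _ _ _ _ H) as (C & HC & Hb).
  exists C; split; auto. intros i s y h Hs. rewrite pow_1.
  specialize (Hb i s y (y + h) Hs). replace (y + h - y) with h in Hb by ring. lra.
Qed.

Lemma bigO_taylor sg k e f g : symb sg k e g ->
  (forall i s y, 0 < s < sg -> is_derive (f i s) y (g i s y)) ->
  bigO sg 2 e (fun i s y h => f i s (y + h) - f i s y - h * g i s y).
Proof.
  intros H Hd. destruct (symb_lip _ _ _ _ H) as (C & HC & Hb).
  exists C; split; auto. intros i s y h Hs.
  pose proof (taylor_lip (f i s) (g i s) (C * Rpower s e) y (y + h)) as T.
  replace (y + h - y) with h in T by ring.
  replace (C * Rabs h ^ 2 * Rpower s e) with (C * Rpower s e * h ^ 2).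
  2: { rewrite <- (pow2_abs h). ring. }
  apply T; auto. apply Rmult_le_pos; auto. apply Rpower_nonneg.
Qed.

Lemma symb_wcont sg k e f : symb sg k e f ->
  exists C, 0 <= C /\ forall i, wcont sg e C (f i).
Proof.
  intros H. destruct (symb_bound _ _ _ _ H) as (C & HC & Hb).
  exists C; split; auto. intros i; split; auto. intros; apply (symb_cont _ _ _ _ H); auto.
Qed.

Lemma fam_choice (P : nat -> (R -> R -> R) -> Prop) :
  (forall i, exists z, P i z) -> exists f : fam, forall i, P i (f i).
Proof.
  intros H.
  exists (fun i => proj1_sig (constructive_indefinite_description _ (H i))).
  intros i. apply proj2_sig.
Qed.

Section Regularity.

Variables (sg m La : R).
Hypotheses (Hm : 2 < m) (HLa : 0 <= La < m * (m - 1)).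

(** [volterra_bound] for increments: the order in [h] of the part of the source that is not
    absorbed by the potential passes to the solution. *)
Lemma volterra_bigO j (D g err : nat -> R -> R -> R -> R) :
  (forall h, exists A, forall i, wcont sg m A (fun s y => D i s y h)) ->
  (forall h i, exists Cg, wcont sg (m - 2) Cg (fun s y => g i s y h)) ->
  (forall h i s y, 0 < s < sg -> D i s y h = duhamel (fun s y => g i s y h) s y) ->
  (forall h i s y, 0 < s < sg ->
     Rabs (g i s y h) <= La * Rpower s (-2) * Rabs (D i s y h) + Rabs (err i s y h)) ->
  bigO sg j (m - 2) err -> bigO sg j m D.
Proof.
  intros HA Hg HD Hgb (C & HC & Herr).
  exists (C / (m * (m - 1) - La)). split.
  { apply Rmult_le_pos; auto. left; apply Rinv_0_lt_compat; lra. }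
  intros i s y h Hs. destruct (HA h) as [A HAh]. destruct (Hg h i) as [Cg Hgh].
  eapply Rle_trans.
  - apply (volterra_bound sg m La Hm HLa A (C * Rabs h ^ j) Cg
            (fun s y => D i s y h) (fun s y => g i s y h)); auto.
    + apply Rmult_le_pos; auto. apply pow_le, Rabs_pos.
    + apply HAh.
    + intros s' y' Hs'. eapply Rle_trans; [apply Hgb; auto|].
      apply Rplus_le_compat_l. auto.
  - apply Req_le. field. lra.
Qed.

(** First increments are Lipschitz if the source is, up to a term absorbed by [La]. *)
Lemma volterra_lip (z Phi : fam) (A C : R) (err : nat -> R -> R -> R -> R) :
  (forall i, wcont sg m A (z i)) -> (forall i, wcont sg (m - 2) C (Phi i)) ->
  (forall i s y, 0 < s < sg -> z i s y = duhamel (Phi i) s y) ->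
  (forall h i s y, 0 < s < sg ->
     Rabs (Phi i s (y + h) - Phi i s y)
       <= La * Rpower s (-2) * Rabs (z i s (y + h) - z i s y) + Rabs (err i s y h)) ->
  bigO sg 1 (m - 2) err -> symb sg 0 m z.
Proof.
  intros Hz HP Heq Hd Herr.
  assert (L : bigO sg 1 m (fun i s y h => z i s (y + h) - z i s y)).
  { apply (volterra_bigO 1 _ (fun i s y h => Phi i s (y + h) - Phi i s y) err); auto.
    - intros h. exists (A + A). intros i.
      apply (wcont_minus sg m A A (fun s y => z i s (y + h)) (z i)); auto using wcont_shift.
    - intros h i. exists (C + C).
      apply (wcont_minus sg (m - 2) C C (fun s y => Phi i s (y + h)) (Phi i)); auto using wcont_shift.
    - intros h i s y Hs.
      rewrite (duhamel_minus sg m C C (fun s y => Phi i s (y + h)) (Phi i)); auto.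
      2: apply wcont_shift; auto.
      rewrite duhamel_shift, <- !Heq; auto. }
  destruct L as (C1 & HC1 & L). split; [|split].
  - intros; apply Hz; auto.
  - exists (Rabs A); split; [apply Rabs_pos|]. intros i s y Hs.
    eapply Rle_trans; [apply Hz; auto|]. apply Rmult_le_compat_r.
    apply Rpower_nonneg. apply Rle_abs.
  - exists C1; split; auto. intros i s y y' Hs.
    specialize (L i s y (y' - y) Hs). replace (y + (y' - y)) with y' in L by ring.
    rewrite pow_1 in L. lra.
Qed.

(** The solution of the linearised equation is the derivative: the second-order
    remainder of the solution solves an equation of the same type. *)
Lemma volterra_derive (z q Phi Psi : fam) (A C : R) (W err : nat -> R -> R -> R -> R) :
  (forall i, wcont sg m A (z i)) -> (forall i, wcont sg m A (q i)) ->
  (forall i, wcont sg (m - 2) C (Phi i)) -> (forall i, wcont sg (m - 2) C (Psi i)) ->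
  (forall i s y, 0 < s < sg -> z i s y = duhamel (Phi i) s y) ->
  (forall i s y, 0 < s < sg -> q i s y = duhamel (Psi i) s y) ->
  (forall i s y h, 0 < s < sg -> Rabs (W i s y h) <= La * Rpower s (-2)) ->
  (forall i s y h, 0 < s < sg ->
     Phi i s (y + h) - Phi i s y - h * Psi i s y
       = W i s y h * (z i s (y + h) - z i s y - h * q i s y) + err i s y h) ->
  bigO sg 2 (m - 2) err ->
  forall i s y, 0 < s < sg -> is_derive (z i s) y (q i s y).
Proof.
  intros Hz Hq HP HPs Heq Heq' HW Hd Herr.
  assert (S1 : forall i h, wcont sg (m - 2) (C + C) (fun s y => Phi i s (y + h) - Phi i s y)).
  { intros i h.
    apply (wcont_minus sg (m - 2) C C (fun s y => Phi i s (y + h)) (Phi i)); auto using wcont_shift. }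
  assert (S2 : forall i h, wcont sg (m - 2) (Rabs h * C) (fun s y => h * Psi i s y)).
  { intros i h. apply wcont_scal; auto. }
  assert (L : bigO sg 2 m (fun i s y h => z i s (y + h) - z i s y - h * q i s y)).
  { apply (volterra_bigO 2 _ (fun i s y h => Phi i s (y + h) - Phi i s y - h * Psi i s y) err); auto.
    - intros h. exists (A + A + Rabs h * A). intros i.
      apply (wcont_minus sg m (A + A) (Rabs h * A) (fun s y => z i s (y + h) - z i s y)
        (fun s y => h * q i s y)); auto using wcont_scal.
      apply (wcont_minus sg m A A (fun s y => z i s (y + h)) (z i)); auto using wcont_shift.
    - intros h i. exists (C + C + Rabs h * C).
      apply (wcont_minus sg (m - 2) _ _ (fun s y => Phi i s (y + h) - Phi i s y)
        (fun s y => h * Psi i s y)); auto.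
    - intros h i s y Hs.
      rewrite (duhamel_minus sg m _ _ (fun s y => Phi i s (y + h) - Phi i s y)
        (fun s y => h * Psi i s y) Hm (S1 i h) (S2 i h)); auto.
      rewrite (duhamel_minus sg m C C (fun s y => Phi i s (y + h)) (Phi i)); auto.
      2: apply wcont_shift; auto.
      rewrite (duhamel_scal sg m C); auto.
      rewrite duhamel_shift, <- !Heq, <- Heq'; auto.
    - intros h i s y Hs. rewrite Hd by auto.
      eapply Rle_trans; [apply Rabs_triang|]. apply Rplus_le_compat_r.
      rewrite Rabs_mult. apply Rmult_le_compat_r; auto using Rabs_pos. }
  destruct L as (C1 & HC1 & L). intros i s y Hs.
  apply is_derive_quadratic with (C1 * Rpower s m). intros h.
  eapply Rle_trans; [apply (L i s y h Hs)|]. rewrite <- (pow2_abs h). apply Req_le; ring.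
Qed.

Lemma linear_source_wcont (V f z : fam) A k : symb sg k (-2) V -> symb sg k (m - 2) f ->
  (forall i, wcont sg m A (z i)) -> 0 <= A ->
  exists C, 0 <= C /\ forall i, wcont sg (m - 2) C (fun s y => V i s y * z i s y + f i s y).
Proof.
  intros HV Hf Hz HA.
  destruct (symb_wcont _ _ _ _ HV) as (CV & HCV & HV').
  destruct (symb_wcont _ _ _ _ Hf) as (Cf & HCf & Hf').
  exists (CV * A + Cf). split; [nra|]. intros i; split.
  - intros; apply continuity_2d_pt_plus; [apply continuity_2d_pt_mult|];
    [apply HV' | apply Hz | apply Hf']; auto.
  - intros s y Hs. eapply Rle_trans; [apply Rabs_triang|].
    rewrite Rmult_plus_distr_r, Rabs_mult. apply Rplus_le_compat; [|apply Hf'; auto].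
    replace (CV * A * Rpower s (m - 2)) with ((CV * Rpower s (-2)) * (A * Rpower s m)).
    apply Rmult_le_compat; auto using Rabs_pos; [apply HV' | apply Hz]; auto.
    rewrite Rmult_assoc, Rpower_m2. ring.
Qed.

Lemma linear_exists (V f : fam) k :
  symb sg k (-2) V -> (forall i s y, 0 < s < sg -> Rabs (V i s y) <= La * Rpower s (-2)) ->
  symb sg k (m - 2) f ->
  exists (q : fam) A, 0 <= A /\ (forall i, wcont sg m A (q i)) /\
    forall i s y, 0 < s < sg -> q i s y = duhamel (fun s y => V i s y * q i s y + f i s y) s y.
Proof.
  intros HV HVL Hf.
  destruct (symb_wcont _ _ _ _ Hf) as (F & HF & Hf').
  set (A := F / (m * (m - 1) - La)).
  assert (HA : 0 <= A) by (apply Rmult_le_pos; auto; left; apply Rinv_0_lt_compat; lra).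
  destruct (fam_choice (fun i q => wcont sg m A q /\
    forall s y, 0 < s < sg -> q s y = duhamel (fun s y => V i s y * q s y + f i s y) s y))
    as [q Hq].
  - intros i.
    apply (volterra_exists sg m La Hm HLa F A (fun s y r => V i s y * r + f i s y)); auto.
    + apply Req_le. unfold A. field. lra.
    + intros s y Hs. rewrite Rmult_0_r, Rplus_0_l. apply Hf'; auto.
    + intros s y r r' Hs _ _.
      replace (V i s y * r + f i s y - (V i s y * r' + f i s y)) with (V i s y * (r - r')) by ring.
      rewrite Rabs_mult. apply Rmult_le_compat_r; auto using Rabs_pos.
    + intros z Hz s y Hs. apply continuity_2d_pt_plus; [apply continuity_2d_pt_mult|].
      apply (symb_cont _ _ _ _ HV); auto. apply Hz; auto. apply Hf'; auto.
  - exists q, A. split; auto. split; intros; apply Hq; auto.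
Qed.

(** The derivative is sought as the solution [q1] of the differentiated equation, which has the
    same potential and one derivative less in its source; [volterra_derive] identifies it. *)
Lemma linear_regularity k : forall (V f q : fam) A,
  symb sg k (-2) V -> (forall i s y, 0 < s < sg -> Rabs (V i s y) <= La * Rpower s (-2)) ->
  symb sg k (m - 2) f -> 0 <= A -> (forall i, wcont sg m A (q i)) ->
  (forall i s y, 0 < s < sg -> q i s y = duhamel (fun s y => V i s y * q i s y + f i s y) s y) ->
  symb sg k m q.
Proof.
  induction k; intros V f q A HV HVL Hf HA Hq Heq.
  - destruct (linear_source_wcont V f q A 0 HV Hf Hq HA) as (C & HC & HS).
    apply (volterra_lip q (fun i s y => V i s y * q i s y + f i s y) A C
      (fun i s y h => (V i s (y + h) - V i s y) * q i s (y + h) + (f i s (y + h) - f i s y))); auto.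
    + intros h i s y Hs.
      replace (V i s (y + h) * q i s (y + h) + f i s (y + h) - (V i s y * q i s y + f i s y))
       with (V i s y * (q i s (y + h) - q i s y) +
        ((V i s (y + h) - V i s y) * q i s (y + h) + (f i s (y + h) - f i s y))) by ring.
      eapply Rle_trans; [apply Rabs_triang|]. apply Rplus_le_compat_r.
      rewrite Rabs_mult. apply Rmult_le_compat_r; auto using Rabs_pos.
    + apply bigO_add; [|apply bigO_lip with 0%nat; auto].
      change 1%nat with (1 + 0)%nat. replace (m - 2) with (-2 + m) by ring.
      apply bigO_mul. apply bigO_lip with 0%nat; auto.
      exists A; split; auto. intros. rewrite pow_O, Rmult_1_r. apply Hq; auto.
  - assert (Hqk : symb sg k m q).
    { apply (IHk V f q A); auto using symb_S. }
    assert (Hq0 := symb_0 _ _ _ _ Hqk).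
    pose proof HV as (_ & _ & V1 & HV1 & HV1s).
    pose proof Hf as (_ & _ & f1 & Hf1 & Hf1s).
    set (f' := fun i s y => V1 i s y * q i s y + f1 i s y).
    assert (Hf' : symb sg k (m - 2) f').
    { apply symb_add; auto. replace (m - 2) with (-2 + m) by ring. apply symb_mul; auto. }
    destruct (linear_exists V f' k (symb_S _ _ _ _ HV) HVL Hf') as (q1 & A1 & HA1 & Hq1 & Heq1).
    assert (Hq1k : symb sg k m q1).
    { apply (IHk V f' q1 A1); auto using symb_S. }
    destruct (linear_source_wcont V f q A k (symb_S _ _ _ _ HV) (symb_S _ _ _ _ Hf) Hq HA)
      as (C & HC & HS).
    destruct (linear_source_wcont V f' q1 A1 k (symb_S _ _ _ _ HV) Hf' Hq1 HA1)
      as (C1 & HC1 & HS1).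
    split; [|split].
    + intros; apply Hq; auto.
    + exists A; split; auto. intros; apply Hq; auto.
    + exists q1; split; auto.
      apply (volterra_derive q q1 (fun i s y => V i s y * q i s y + f i s y)
        (fun i s y => V i s y * q1 i s y + f' i s y) (A + A1) (C + C1) (fun i s y h => V i s y)
        (fun i s y h =>
           (V i s (y + h) - V i s y) * (q i s (y + h) - q i s y)
           + (V i s (y + h) - V i s y - h * V1 i s y) * q i s y
           + (f i s (y + h) - f i s y - h * f1 i s y))); auto.
      1-4: intros i; eapply wcont_le; [|solve [eauto]]; lra.
      * intros i s y h Hs. unfold f'. ring.
      * apply bigO_add; [apply bigO_add|].
        -- change 2%nat with (1 + 1)%nat. replace (m - 2) with (-2 + m) by ring.
           apply bigO_mul. apply bigO_lip with (S k); auto. apply bigO_lip with k; auto.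
        -- change 2%nat with (2 + 0)%nat. replace (m - 2) with (-2 + m) by ring.
           apply bigO_mul. apply bigO_taylor with k; auto. apply bigO_symb with k; auto.
        -- apply bigO_taylor with k; auto.
Qed.

End Regularity.


Lemma Rabs_le_inv x a : Rabs x <= a -> - a <= x <= a.
Proof. apply Rcomplements.Rabs_le_between. Qed.

(** Relative increment of the nonlinearity: with [u0] the approximate solution,
    [(u0 + r)^(p+1) - u0^(p+1) = u0^(p+1) powgap (r / u0)]. *)
Definition powgap (p x : R) : R := Rpower (1 + x) (p + 1) - 1.

Lemma is_derive_powgap p x : -1 < x -> is_derive (powgap p) x ((p + 1) * Rpower (1 + x) p).
Proof.
  intros Hx. unfold powgap.
  replace ((p + 1) * Rpower (1 + x) p) with (1 * ((p + 1) * Rpower (1 + x) (p + 1 - 1)) - 0).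
  2: { replace (p + 1 - 1) with p by ring. ring. }
  apply (rderive_minus
    (fun x => Rpower (1 + x) (p + 1)) (fun _ => 1)).
  - apply (rderive_comp
      (fun x => Rpower x (p + 1)) (fun x => 1 + x)).
    apply is_derive_Rpower; lra. auto_derive; auto; ring.
  - apply rderive_const.
Qed.

Lemma minmax_abs x x' xi z : Rabs x <= xi -> Rabs x' <= xi ->
  Rmin x x' <= z <= Rmax x x' -> Rabs z <= xi.
Proof.
  intros Hx Hx' Hz. apply Rabs_le_inv in Hx; apply Rabs_le_inv in Hx'. apply Rabs_le.
  assert (- xi <= Rmin x x') by (apply Rmin_glb; lra).
  assert (Rmax x x' <= xi) by (apply Rmax_lub; lra). lra.
Qed.

Lemma powgap_slope p xi x : 0 < p -> xi <= / 2 -> Rabs x <= xi ->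
  Rabs ((p + 1) * Rpower (1 + x) p) <= (p + 1) * Rpower (1 + xi) p.
Proof.
  intros Hp Hxi Hx. apply Rabs_le_inv in Hx.
  rewrite Rabs_pos_eq. apply Rmult_le_compat_l; [lra|]. apply Rle_Rpower_l; lra.
  apply Rmult_le_pos; [lra|]. apply Rpower_nonneg.
Qed.

Lemma powgap_lip p xi x x' : 0 < p -> xi <= / 2 -> Rabs x <= xi -> Rabs x' <= xi ->
  Rabs (powgap p x' - powgap p x) <= (p + 1) * Rpower (1 + xi) p * Rabs (x' - x).
Proof.
  intros Hp Hxi Hx Hx'.
  apply mvt_lip with (g := fun x => (p + 1) * Rpower (1 + x) p).
  - intros z Hz. apply is_derive_powgap.
    pose proof (minmax_abs x x' xi z Hx Hx' Hz) as H. apply Rabs_le_inv in H. lra.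
  - intros z Hz. apply powgap_slope; auto.
    apply (minmax_abs x x' xi z); auto.
Qed.

Lemma powgap_0 p : powgap p 0 = 0.
Proof.
  unfold powgap. rewrite Rplus_0_r. unfold Rpower. rewrite ln_1, Rmult_0_r, exp_0. ring.
Qed.

Lemma powgap_bound p x : 0 < p -> Rabs x <= / 2 ->
  Rabs (powgap p x) <= (p + 1) * Rpower (1 + / 2) p * Rabs x.
Proof.
  intros Hp Hx. pose proof (powgap_lip p (/ 2) 0 x Hp) as H.
  rewrite powgap_0, !Rminus_0_r in H. apply H; auto; try lra. rewrite Rabs_R0; lra.
Qed.

Lemma powgap_taylor p : 0 < p -> exists C, 0 <= C /\ forall x x',
  Rabs x <= / 2 -> Rabs x' <= / 2 ->
  Rabs (powgap p x' - powgap p x - (x' - x) * ((p + 1) * Rpower (1 + x) p)) <= C * (x' - x) ^ 2.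
Proof.
  intros Hp.
  set (C := (p + 1) * p * (Rpower (/ 2) (p - 1) + Rpower 2 (p - 1))).
  assert (HC : 0 <= C).
  { unfold C. pose proof (Rpower_pos (/2) (p-1)). pose proof (Rpower_pos 2 (p-1)).
    apply Rmult_le_pos; nra. }
  exists C. split; auto. intros x x' Hx Hx'.
  apply (taylor_lip (powgap p) (fun x => (p + 1) * Rpower (1 + x) p)); auto.
  - intros z Hz. apply is_derive_powgap.
    pose proof (minmax_abs x x' _ z Hx Hx' Hz) as H. apply Rabs_le_inv in H. lra.
  - intros z Hz. pose proof (minmax_abs x x' _ z Hx Hx' Hz) as H.
    apply mvt_lip with (g := fun x => (p + 1) * (p * Rpower (1 + x) (p - 1)))
        (f := fun x => (p + 1) * Rpower (1 + x) p).
      * intros w Hw. pose proof (minmax_abs x z _ w Hx H Hw) as Hw'. apply Rabs_le_inv in Hw'.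
        apply (is_derive_scal (fun x => Rpower (1 + x) p)).
        rewrite <- (Rmult_1_l (p * _)).
        apply (rderive_comp
          (fun x => Rpower x p) (fun x => 1 + x)).
        apply is_derive_Rpower; lra. auto_derive; auto; ring.
      * intros w Hw. pose proof (minmax_abs x z _ w Hx H Hw) as Hw'. apply Rabs_le_inv in Hw'.
        rewrite Rabs_pos_eq. 2: { repeat apply Rmult_le_pos; try lra. apply Rpower_nonneg. }
        unfold C. rewrite Rmult_assoc. apply Rmult_le_compat_l; [lra|].
        apply Rmult_le_compat_l; [lra|]. apply Rpower_bound; lra.
Qed.

Lemma symb_one_plus sg k e a : sg <= 1 -> 0 <= e -> symb sg k e a ->
  symb sg k 0 (fun i s y => 1 + a i s y).
Proof.
  intros Hs He H. apply symb_add. apply symb_const. apply symb_le with e; auto.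
Qed.

Lemma symb_powslope sg k e p a : sg <= 1 -> 0 <= e -> symb sg k e a ->
  (forall i s y, 0 < s < sg -> Rabs (a i s y) <= / 2) ->
  symb sg k 0 (fun i s y => (p + 1) * Rpower (1 + a i s y) p).
Proof.
  intros Hs He H Hb. replace 0 with (0 + 0) by ring. apply symb_mul. apply symb_const.
  apply symb_Rpower with (b := / 2); [lra | | apply symb_one_plus with e; auto].
  intros i s y H0. specialize (Hb i s y H0). apply Rabs_le_inv in Hb. lra.
Qed.

(** The gap vanishes to first order at 0, hence keeps the weight of its argument. *)
Lemma symb_powgap sg k e p a : 0 < p -> sg <= 1 -> 0 <= e -> symb sg k e a ->
  (forall i s y, 0 < s < sg -> Rabs (a i s y) <= / 2) ->
  symb sg k e (fun i s y => powgap p (a i s y)).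
Proof.
  intros Hp Hs He H Hb.
  set (M := (p + 1) * Rpower (1 + / 2) p).
  assert (HM : 0 <= M) by (apply Rmult_le_pos; [lra | apply Rpower_nonneg]).
  assert (Hc : forall i s y, 0 < s < sg ->
    continuity_2d_pt (fun s y => powgap p (a i s y)) s y).
  { intros i s y H0. apply (continuity_1d_2d_pt_comp (powgap p) (a i)).
    - apply continuity_pt_filterlim.
      eapply rderive_continuous; apply is_derive_powgap. specialize (Hb i s y H0). apply Rabs_le_inv in Hb. lra.
    - apply (symb_cont _ _ _ _ H); auto. }
  assert (Hbd : exists C, 0 <= C /\ forall i s y, 0 < s < sg ->
    Rabs (powgap p (a i s y)) <= C * Rpower s e).
  { destruct (symb_bound _ _ _ _ H) as (C & HC & HCb). exists (M * C). split; [nra|].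
    intros i s y H0.
    eapply Rle_trans; [apply powgap_bound; auto|].
    fold M. rewrite Rmult_assoc. apply Rmult_le_compat_l; auto. }
  destruct k; (split; [|split]); auto.
  - destruct (symb_lip _ _ _ _ H) as (C & HC & HCl). exists (M * C). split; [nra|].
    intros i s y y' H0. eapply Rle_trans; [apply (powgap_lip p (/ 2)); auto; lra|].
    fold M. rewrite !Rmult_assoc. apply Rmult_le_compat_l; auto.
    rewrite <- Rmult_assoc; auto.
  - pose proof H as (_ & _ & a' & Ha' & Hs').
    exists (fun i s y => a' i s y * ((p + 1) * Rpower (1 + a i s y) p)). split.
    + intros i s y H0. apply (rderive_comp
        (powgap p) (a i s)); auto. apply is_derive_powgap.
      specialize (Hb i s y H0). apply Rabs_le_inv in Hb. lra.
    + replace e with (e + 0) by ring. apply symb_mul; auto.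
      apply symb_powslope with e; auto. apply symb_S; auto.
Qed.

(** The equation of the correction [z] to an approximate solution [u0]: here [X = 1 / u0],
    [P = c rho u0^(p+1)] and [R0] is the error of [u0] in the equation. *)
Section NonlinearRegularity.

Variables (p sg m La xi e1 e2 : R) (P X R0 z : fam) (A : R).
Hypotheses (Hp : 0 < p) (Hsg : sg <= 1) (Hm : 2 < m) (HLa : 0 <= La < m * (m - 1))
  (Hxi : xi <= / 2) (He : e1 + e2 = -2) (He2 : 0 <= e2)
  (HP : ssymb sg e1 P) (HX : ssymb sg e2 X) (HR : ssymb sg (m - 2) R0)
  (HPX : forall i s y, 0 < s < sg ->
     Rabs (P i s y * X i s y) * ((p + 1) * Rpower (1 + xi) p) <= La * Rpower s (-2))
  (HA : 0 <= A) (Hz : forall i, wcont sg m A (z i))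
  (HXA : forall i s y, 0 < s < sg -> Rabs (X i s y) * (A * Rpower s m) <= xi)
  (Heq : forall i s y, 0 < s < sg ->
     z i s y = duhamel (fun s y => P i s y * powgap p (X i s y * z i s y) - R0 i s y) s y).

Let a : fam := fun i s y => X i s y * z i s y.
Let Phi : fam := fun i s y => P i s y * powgap p (a i s y) - R0 i s y.

Lemma nonlinear_weight : e1 + (e2 + m) = m - 2.
Proof. lra. Qed.

Lemma nonlinear_small i s y y' : 0 < s < sg -> Rabs (X i s y * z i s y') <= xi.
Proof.
  intros Hs. eapply Rle_trans; [|apply (HXA i s y Hs)]. rewrite Rabs_mult.
  apply Rmult_le_compat_l; [apply Rabs_pos | apply Hz; auto].
Qed.

Lemma nonlinear_half i s y y' : 0 < s < sg -> Rabs (X i s y * z i s y') <= / 2.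
Proof. intros Hs. eapply Rle_trans; [apply nonlinear_small; auto | auto]. Qed.

Lemma nonlinear_wcont : exists C, 0 <= C /\ forall i, wcont sg (m - 2) C (Phi i).
Proof.
  destruct (symb_wcont _ _ _ _ (HP 0%nat)) as (CP & HCP & WP).
  destruct (symb_wcont _ _ _ _ (HX 0%nat)) as (CX & HCX & WX).
  destruct (symb_wcont _ _ _ _ (HR 0%nat)) as (CR & HCR & WR).
  set (M := (p + 1) * Rpower (1 + / 2) p).
  assert (HM : 0 <= M) by (apply Rmult_le_pos; [lra | apply Rpower_nonneg]).
  exists (CP * (M * (CX * A)) + CR). split.
  { apply Rplus_le_le_0_compat; auto. apply Rmult_le_pos; [auto|].
    apply Rmult_le_pos; [auto|]. apply Rmult_le_pos; auto. }
  intros i; split.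
  - intros s y Hs. apply continuity_2d_pt_minus; [|apply WR; auto].
    apply continuity_2d_pt_mult. apply WP; auto.
    apply (continuity_1d_2d_pt_comp (powgap p) (a i)).
    + apply continuity_pt_filterlim.
      eapply rderive_continuous; apply is_derive_powgap. pose proof (nonlinear_half i s y y Hs : Rabs (a i s y) <= / 2) as H.
      apply Rabs_le_inv in H. lra.
    + apply continuity_2d_pt_mult; [apply WX | apply Hz]; auto.
  - intros s y Hs. unfold Phi. eapply Rle_trans; [apply Rabs_triang|].
    rewrite Rabs_Ropp, Rmult_plus_distr_r. apply Rplus_le_compat; [|apply WR; auto].
    rewrite Rabs_mult.
    replace (CP * (M * (CX * A)) * Rpower s (m - 2)) with
      ((CP * Rpower s e1) * (M * ((CX * Rpower s e2) * (A * Rpower s m)))).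
    2: { rewrite <- nonlinear_weight, !Rpower_plus. ring. }
    apply Rmult_le_compat; auto using Rabs_pos. apply WP; auto.
    apply Rle_trans with (M * Rabs (a i s y)).
    + apply powgap_bound; auto. apply nonlinear_half; auto.
    + apply Rmult_le_compat_l; auto. unfold a. rewrite Rabs_mult.
      apply Rmult_le_compat; auto using Rabs_pos; [apply WX | apply Hz]; auto.
Qed.

Lemma bigO_z_shift : bigO sg 0 m (fun i s y h => z i s (y + h)).
Proof. exists A; split; auto. intros. rewrite pow_O, Rmult_1_r. apply Hz; auto. Qed.

Let M := (p + 1) * Rpower (1 + / 2) p.

Lemma slope_nonneg : 0 <= M.
Proof. apply Rmult_le_pos; [lra | apply Rpower_nonneg]. Qed.

Lemma bigO_gap : bigO sg 0 (e2 + m) (fun i s y h => powgap p (a i s (y + h))).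
Proof.
  apply bigO_dom with (fun i s y h => M * (X i s (y + h) * z i s (y + h))).
  - intros i s y h Hs.
    eapply Rle_trans; [apply powgap_bound; auto; apply nonlinear_half; auto|].
    fold M. rewrite Rabs_mult, (Rabs_pos_eq M) by apply slope_nonneg. apply Rle_refl.
  - replace (e2 + m) with (0 + (e2 + m)) by ring. change 0%nat with (0 + (0 + 0))%nat.
    apply bigO_mul; [|apply bigO_mul].
    + exists M. split. apply slope_nonneg. intros i s y h Hs.
      rewrite pow_O, Rpower_O by lra. rewrite Rabs_pos_eq by apply slope_nonneg. lra.
    + apply bigO_symb_shift with 0%nat; auto.
    + apply bigO_z_shift.
Qed.

Lemma bigO_gap_X : bigO sg 1 (e2 + m)
  (fun i s y h => powgap p (a i s (y + h)) - powgap p (X i s y * z i s (y + h))).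
Proof.
  apply bigO_dom with (fun i s y h => M * ((X i s (y + h) - X i s y) * z i s (y + h))).
  - intros i s y h Hs.
    eapply Rle_trans; [apply (powgap_lip p (/ 2)); auto; try lra; apply nonlinear_half; auto|].
    fold M. unfold a.
    rewrite Rabs_mult, (Rabs_pos_eq M) by apply slope_nonneg.
    apply Req_le. do 2 f_equal. ring.
  - replace (e2 + m) with (0 + (e2 + m)) by ring. change 1%nat with (0 + (1 + 0))%nat.
    apply bigO_mul; [|apply bigO_mul].
    + exists M. split. apply slope_nonneg. intros i s y h Hs.
      rewrite pow_O, Rpower_O by lra. rewrite Rabs_pos_eq by apply slope_nonneg. lra.
    + apply bigO_lip with 0%nat; auto.
    + apply bigO_z_shift.
Qed.

Lemma nonlinear_lip : symb sg 0 m z.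
Proof.
  destruct nonlinear_wcont as (C & HC & W).
  apply (volterra_lip sg m La Hm HLa z Phi A C
    (fun i s y h =>
        (P i s (y + h) - P i s y) * powgap p (a i s (y + h))
         + P i s y * (powgap p (a i s (y + h)) - powgap p (X i s y * z i s (y + h)))
         + - (R0 i s (y + h) - R0 i s y))); auto.
  - intros h i s y Hs.
    replace (Phi i s (y + h) - Phi i s y) with
      (P i s y * (powgap p (X i s y * z i s (y + h)) - powgap p (a i s y))
       + ((P i s (y + h) - P i s y) * powgap p (a i s (y + h))
         + P i s y * (powgap p (a i s (y + h)) - powgap p (X i s y * z i s (y + h)))
         + - (R0 i s (y + h) - R0 i s y))) by (unfold Phi; ring).
    eapply Rle_trans; [apply Rabs_triang|]. apply Rplus_le_compat_r.
    rewrite Rabs_mult.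
    apply Rle_trans with (Rabs (P i s y) * ((p + 1) * Rpower (1 + xi) p *
      Rabs (X i s y * z i s (y + h) - a i s y))).
    + apply Rmult_le_compat_l; [apply Rabs_pos|].
      apply powgap_lip; auto; apply nonlinear_small; auto.
    + unfold a.
      replace (X i s y * z i s (y + h) - X i s y * z i s y)
        with (X i s y * (z i s (y + h) - z i s y)) by ring.
      rewrite Rabs_mult.
      replace (Rabs (P i s y) * ((p + 1) * Rpower (1 + xi) p *
        (Rabs (X i s y) * Rabs (z i s (y + h) - z i s y))))
       with (Rabs (P i s y * X i s y) * ((p + 1) * Rpower (1 + xi) p) *
         Rabs (z i s (y + h) - z i s y)) by (rewrite Rabs_mult; ring).
      apply Rmult_le_compat_r; auto using Rabs_pos.
  - apply bigO_add; [apply bigO_add|].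
    + rewrite <- nonlinear_weight. change 1%nat with (1 + 0)%nat. apply bigO_mul.
      apply bigO_lip with 0%nat; auto. apply bigO_gap.
    + rewrite <- nonlinear_weight. change 1%nat with (0 + 1)%nat. apply bigO_mul.
      apply bigO_symb with 0%nat; auto. apply bigO_gap_X.
    + apply bigO_opp, bigO_lip with 0%nat; auto.
Qed.

(** Bootstrap: [k] derivatives of [z] give [k] derivatives of the coefficients of the
    linearised equation, whose solution is the derivative of [z]. *)
Lemma nonlinear_step k : symb sg k m z -> symb sg (S k) m z.
Proof.
  intros Hzk.
  destruct (ssymb_dy _ _ _ HP) as [dP SP]. destruct (ssymb_dy _ _ _ HX) as [dX SX].
  destruct (ssymb_dy _ _ _ HR) as [dR SR].
  assert (Ha : symb sg k (e2 + m) a) by (apply symb_mul; auto).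
  assert (Ha2 : forall i s y, 0 < s < sg -> Rabs (a i s y) <= / 2).
  { intros; apply nonlinear_half; auto. }
  assert (HK : symb sg k (e2 + m) (fun i s y => powgap p (a i s y))).
  { apply symb_powgap; auto; lra. }
  assert (HK' : symb sg k 0 (fun i s y => (p + 1) * Rpower (1 + a i s y) p)).
  { apply symb_powslope with (e2 + m); auto; lra. }
  set (K' := fun i s y => (p + 1) * Rpower (1 + a i s y) p) in *.
  set (V := fun i s y => P i s y * X i s y * K' i s y).
  set (f := fun i s y => dy P i s y * powgap p (a i s y)
     + P i s y * (K' i s y * (dy X i s y * z i s y)) + (-1) * dy R0 i s y).
  assert (HV : symb sg k (-2) V).
  { replace (-2) with (e1 + e2 + 0) by lra. apply symb_mul; auto. apply symb_mul; auto. }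
  assert (Hf : symb sg k (m - 2) f).
  { apply symb_add; [apply symb_add|].
    - rewrite <- nonlinear_weight. apply symb_mul; auto.
    - replace (m - 2) with (e1 + (0 + (e2 + m))) by lra.
      apply symb_mul; auto. apply symb_mul; auto. apply symb_mul; auto.
    - replace (m - 2) with (0 + (m - 2)) by ring. apply symb_mul; auto. apply symb_const. }
  assert (HVL : forall i s y, 0 < s < sg -> Rabs (V i s y) <= La * Rpower s (-2)).
  { intros i s y Hs. unfold V. rewrite Rabs_mult.
    eapply Rle_trans; [|apply (HPX i s y Hs)]. apply Rmult_le_compat_l; [apply Rabs_pos|].
    apply powgap_slope; auto. apply nonlinear_small; auto. }
  destruct (linear_exists sg m La Hm HLa V f k HV HVL Hf) as (q & B & HB & Hq & Hqeq).
  assert (Hqk := linear_regularity sg m La Hm HLa k V f q B HV HVL Hf HB Hq Hqeq).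
  destruct nonlinear_wcont as (C & HC & W).
  destruct (linear_source_wcont sg m V f q B k HV Hf Hq HB) as (C1 & HC1 & W1).
  split; [|split].
  - intros; apply Hz; auto.
  - exists A; split; auto. intros; apply Hz; auto.
  - exists q; split; auto.
    destruct (powgap_taylor p Hp) as (CT & HCT & HT).
    apply (volterra_derive sg m La Hm HLa z q Phi (fun i s y => V i s y * q i s y + f i s y)
      (A + B) (C + C1) (fun i s y h => V i s y)
      (fun i s y h =>
        P i s y * (K' i s y * ((X i s (y + h) - X i s y - h * dy X i s y) * z i s y
          + (X i s (y + h) - X i s y) * (z i s (y + h) - z i s y)))
        + P i s y * (powgap p (a i s (y + h)) - powgap p (a i s y)
                       - (a i s (y + h) - a i s y) * K' i s y)
        + (P i s (y + h) - P i s y) * (powgap p (a i s (y + h)) - powgap p (a i s y))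
        + (P i s (y + h) - P i s y - h * dy P i s y) * powgap p (a i s y)
        + - (R0 i s (y + h) - R0 i s y - h * dy R0 i s y))); auto.
    1-4: intros i; eapply wcont_le; [|solve [eauto]]; lra.
    + intros i s y h Hs. unfold Phi, V, f, a. ring.
    + assert (Hz0 := symb_0 _ _ _ _ Hzk). assert (Ha0 := symb_0 _ _ _ _ Ha).
      assert (HK0 := symb_0 _ _ _ _ HK). assert (HK0' := symb_0 _ _ _ _ HK').
      assert (HP0 := HP 0%nat). assert (HX0 := HX 0%nat).
      repeat apply bigO_add.
      * replace (m - 2) with (e1 + (0 + (e2 + m))) by lra.
        change 2%nat with (0 + (0 + 2))%nat.
        apply bigO_mul; [apply bigO_symb with 0%nat; auto|].
        apply bigO_mul; [apply bigO_symb with 0%nat; auto|].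
        apply bigO_add.
        -- change 2%nat with (2 + 0)%nat. apply bigO_mul; [|apply bigO_symb with 0%nat; auto].
           apply bigO_taylor with 0%nat; auto.
        -- change 2%nat with (1 + 1)%nat. apply bigO_mul; apply bigO_lip with 0%nat; auto.
      * rewrite <- nonlinear_weight. change 2%nat with (0 + 2)%nat.
        apply bigO_mul; [apply bigO_symb with 0%nat; auto|].
        apply bigO_le with ((e2 + m) + (e2 + m)); auto; [lra|].
        apply bigO_dom with (fun i s y h => CT * ((a i s (y + h) - a i s y) * (a i s (y + h) - a i s y))).
        -- intros i s y h Hs. rewrite (Rabs_pos_eq (CT * _)).
           2: { apply Rmult_le_pos; auto. apply Rle_0_sqr. }
           eapply Rle_trans; [apply HT; apply nonlinear_half; auto|].
           apply Req_le. ring.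
        -- replace (e2 + m + (e2 + m)) with (0 + ((e2 + m) + (e2 + m))) by ring.
           change 2%nat with (0 + (1 + 1))%nat.
           apply bigO_mul; [|apply bigO_mul; apply bigO_lip with 0%nat; auto].
           exists CT. split; auto. intros i s y h Hs.
           rewrite pow_O, Rpower_O by lra. rewrite Rabs_pos_eq by auto. lra.
      * rewrite <- nonlinear_weight. change 2%nat with (1 + 1)%nat.
        apply bigO_mul; [apply bigO_lip with 0%nat; auto|].
        apply (bigO_lip sg 0 (e2 + m) (fun i s y => powgap p (a i s y))); auto.
      * rewrite <- nonlinear_weight. change 2%nat with (2 + 0)%nat.
        apply bigO_mul; [apply bigO_taylor with 0%nat; auto|].
        apply (bigO_symb sg 0 (e2 + m) (fun i s y => powgap p (a i s y))); auto.
      * apply bigO_opp, bigO_taylor with 0%nat; auto.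
Qed.

Lemma nonlinear_regularity : ssymb sg m z.
Proof. intros k; induction k. apply nonlinear_lip. apply nonlinear_step; auto. Qed.

End NonlinearRegularity.


(** * Approximate solution *)

Definition coef (b : nat -> R -> R) : Prop := ssymb 1 0 (fun i _ y => b i y).

(** Polynomials in [s] whose coefficients are smooth in [y].  The expansion only needs their
    closure under the operations and the extraction of the leading coefficient. *)
Inductive spoly : fam -> Prop :=
| sp_coef b : coef b -> spoly (fun i _ y => b i y)
| sp_s : spoly (fun _ s _ => s)
| sp_add f g : spoly f -> spoly g -> spoly (fun i s y => f i s y + g i s y)
| sp_mul f g : spoly f -> spoly g -> spoly (fun i s y => f i s y * g i s y)
| sp_ext f g : (forall i s y, f i s y = g i s y) -> spoly f -> spoly g.

Lemma sp_const c : spoly (fun _ _ _ => c).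
Proof. apply (sp_coef (fun _ _ => c)). intros k. apply symb_const. Qed.

Lemma sp_opp f : spoly f -> spoly (fun i s y => - f i s y).
Proof.
  intros H. apply sp_ext with (fun i s y => (-1) * f i s y). intros; ring.
  apply sp_mul; auto. apply sp_const.
Qed.

Lemma sp_sub f g : spoly f -> spoly g -> spoly (fun i s y => f i s y - g i s y).
Proof. intros; apply sp_add; auto. apply sp_opp; auto. Qed.

Lemma sp_pow n : spoly (fun _ s _ => s ^ n).
Proof. induction n; simpl. apply sp_const. apply sp_mul; auto. apply sp_s. Qed.

Ltac spoly_tac :=
  repeat first [ assumption | apply sp_const | apply sp_s | apply sp_pow
    | apply sp_sub | apply sp_opp | apply sp_add | apply sp_mul | apply sp_coef; assumption ].

Lemma coef_mul b c : coef b -> coef c -> coef (fun i y => b i y * c i y).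
Proof.
  intros Hb Hc k. replace 0 with (0 + 0) by ring. apply symb_mul; auto.
Qed.

Lemma coef_const c : coef (fun _ _ => c).
Proof. intros k; apply symb_const. Qed.

Lemma coef_deriv b : coef b ->
  exists b', coef b' /\ forall i y, is_derive (b i) y (b' i y).
Proof.
  intros H. destruct (ssymb_dy _ _ _ H) as [Hd Hs].
  exists (fun i y => Derive (b i) y). split. exact Hs.
  intros i y. apply (Hd i (/ 2) y). lra.
Qed.

Lemma symb_pow_nat sg k n : symb sg k (INR n) (fun _ s _ => s ^ n).
Proof.
  apply symb_ext with (fun _ s _ => Rpower s (INR n)). intros; apply Rpower_pow; lra.
  apply symb_pow_s.
Qed.

Lemma ssymb_mul0 sg e f g : ssymb sg 0 f -> ssymb sg e g -> ssymb sg e (fun i s y => f i s y * g i s y).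
Proof. intros Hf Hg k. replace e with (0 + e) by ring. apply symb_mul; auto. Qed.

Lemma ssymb_mulr sg e f g : ssymb sg e f -> ssymb sg 0 g -> ssymb sg e (fun i s y => f i s y * g i s y).
Proof. intros Hf Hg k. replace e with (e + 0) by ring. apply symb_mul; auto. Qed.

Lemma ssymb_add sg e f g : ssymb sg e f -> ssymb sg e g -> ssymb sg e (fun i s y => f i s y + g i s y).
Proof. intros Hf Hg k. apply symb_add; auto. Qed.

Lemma ssymb_s sg : sg <= 1 -> ssymb sg 0 (fun _ s _ => s).
Proof.
  intros H k. apply symb_le with 1; auto; try lra.
  apply symb_ext with (fun _ s _ => s ^ 1). intros; ring.
  replace 1 with (INR 1) at 1 by reflexivity. apply (symb_pow_nat sg k 1).
Qed.

Lemma spoly_ssymb f : spoly f -> ssymb 1 0 f.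
Proof.
  induction 1.
  - exact H.
  - apply ssymb_s; lra.
  - apply ssymb_add; auto.
  - apply ssymb_mul0; auto.
  - intros k. apply symb_ext with f; auto.
Qed.

Lemma spoly_split f : spoly f ->
  exists b g, coef b /\ spoly g /\ forall i s y, f i s y = b i y + s * g i s y.
Proof.
  induction 1 as [b Hb | | f g Hf (b & f' & Hb & Sf & Ef) Hg (c & g' & Hc & Sg & Eg)
    | f g Hf (b & f' & Hb & Sf & Ef) Hg (c & g' & Hc & Sg & Eg) | f g E Hf (b & f' & Hb & Sf & Ef)].
  - exists b, (fun _ _ _ => 0). repeat split; auto. spoly_tac. intros; ring.
  - exists (fun _ _ => 0), (fun _ _ _ => 1). repeat split. apply coef_const. spoly_tac.
    intros; ring.
  - exists (fun i y => b i y + c i y), (fun i s y => f' i s y + g' i s y). split.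
    apply ssymb_add; auto. split. spoly_tac. intros; rewrite Ef, Eg; ring.
  - exists (fun i y => b i y * c i y),
      (fun i s y => f' i s y * c i y + b i y * g' i s y + s * (f' i s y * g' i s y)). split.
    apply coef_mul; auto. split. spoly_tac. intros; rewrite Ef, Eg; ring.
  - exists b, f'. repeat split; auto. intros; rewrite <- E; auto.
Qed.

(** For [w = s b] this is [w (w_ss + 2 w_sy) - kk (w_s^2 + 2 w_s w_y - rho)], in terms of the
    derivatives of [b]; it vanishes when [w^(-2/p)] solves the equation and [kk = 1 + 2/p]. *)
Definition residual (kk rho s b bs by_ bss bsy : R) : R :=
  s * b * ((2 * bs + s * bss) + 2 * (by_ + s * bsy))
  - kk * ((b + s * bs) ^ 2 + 2 * (b + s * bs) * (s * by_) - rho).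

Definition is_jet (b bs by_ bss bsy : fam) : Prop :=
  forall i s y, 0 < s < 1 ->
    is_derive (fun s => b i s y) s (bs i s y) /\ is_derive (b i s) y (by_ i s y) /\
    is_derive (fun s => bs i s y) s (bss i s y) /\ is_derive (bs i s) y (bsy i s y).

Lemma is_derive_monomial n x : is_derive (fun x => x ^ n) x (INR n * x ^ pred n).
Proof. apply is_derive_Reals, derivable_pt_lim_pow. Qed.

Lemma is_derive_scalr (f : R -> R) x l c : is_derive f x l -> is_derive (fun x => f x * c) x (l * c).
Proof.
  intros H. replace (l * c) with (l * c + f x * 0) by ring.
  apply (rderive_mult f (fun _ => c)); auto. apply rderive_const.
Qed.

Lemma ssymb_ln : ssymb 1 (- / 4) (fun _ s _ => ln s).
Proof.
  intros k. apply symb_fun_s.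
  - intros s Hs. eapply rderive_continuous; apply is_derive_Reals, derivable_pt_lim_ln; lra.
  - exists 4. split; [lra|]. intros s Hs.
    assert (ln s < 0) by (rewrite <- ln_1; apply ln_increasing; lra).
    rewrite Rabs_left by auto.
    (* [ln x <= x] at [x = s^(-1/4)] *)
    pose proof (exp_ineq1_le (- / 4 * ln s)). unfold Rpower. lra.
Qed.

Section Profile.

Variables (kk : R) (rho b0 ib0 : nat -> R -> R).
Hypotheses (Hrho : coef rho) (Hb0 : coef b0) (Hib0 : coef ib0)
  (Hsq : forall i y, b0 i y * b0 i y = rho i y) (Hinv : forall i y, b0 i y * ib0 i y = 1).

(** Adding [B s^(N+1)] to [w], [N = n + 1], changes the coefficient of [s^N] in the residual by
    [b0 B (N + 1) (N - 2 kk)], and no lower one. *)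
Lemma poly_profile n : (forall j, (1 <= j <= n)%nat -> INR j <> 2 * kk) ->
  exists b bs by_ bss bsy g P : fam,
    (spoly b /\ spoly bs /\ spoly by_ /\ spoly bss /\ spoly bsy /\ spoly g /\ spoly P) /\
    is_jet b bs by_ bss bsy /\
    (forall i s y, b i s y = b0 i y + s * g i s y) /\
    forall i s y, residual kk (rho i y) s (b i s y) (bs i s y) (by_ i s y) (bss i s y) (bsy i s y)
      = s ^ S n * P i s y.
Proof.
  induction n; intros Hj.
  - destruct (coef_deriv b0 Hb0) as (b1 & Hb1 & D1).
    exists (fun i _ y => b0 i y), (fun _ _ _ => 0), (fun i _ y => b1 i y), (fun _ _ _ => 0),
      (fun _ _ _ => 0), (fun _ _ _ => 0),
      (fun i s y => 2 * (1 - kk) * (b0 i y * b1 i y)).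
    split; [repeat split; spoly_tac|]. split; [|split].
    + intros i s y _. split; [|split; [|split]]; auto;
      apply rderive_const.
    + intros; ring.
    + intros. unfold residual. rewrite <- Hsq. ring.
  - destruct IHn as (b & bs & by_ & bss & bsy & g & P & (Sb & Sbs & Sby & Sbss & Sbsy & Sg & SP) &
      J & Eb & ER); [intros; apply Hj; lia|].
    destruct (spoly_split P SP) as (c & P1 & Hc & SP1 & EP).
    set (N := INR (S n)).
    assert (HN1 : N - 2 * kk <> 0). { intros E; apply (Hj (S n)); [lia|]. fold N; lra. }
    assert (HN2 : N + 1 <> 0). { pose proof (pos_INR (S n)). fold N in H. lra. }
    set (a := - / ((N + 1) * (N - 2 * kk))).
    set (B := fun i y => a * (c i y * ib0 i y)).
    assert (HB : coef B). { apply coef_mul. apply coef_const. apply coef_mul; auto. }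
    destruct (coef_deriv B HB) as (B1 & HB1 & DB).
    exists (fun i s y => b i s y + B i y * s ^ S n),
      (fun i s y => bs i s y + B i y * (N * s ^ n)),
      (fun i s y => by_ i s y + B1 i y * s ^ S n),
      (fun i s y => bss i s y + B i y * (N * (INR n * s ^ pred n))),
      (fun i s y => bsy i s y + B1 i y * (N * s ^ n)),
      (fun i s y => g i s y + B i y * s ^ n),
      (fun i s y => P1 i s y + g i s y * B i y * ((N + 1) * (N - 2 * kk))
         + b i s y * (2 * (N + 1) * B1 i y)
         + B i y * (2 * bs i s y + s * bss i s y + 2 * by_ i s y + 2 * (s * bsy i s y))
         + B i y * s ^ n * (B i y * (N * (N + 1)))
         + s ^ S n * B i y * (2 * B1 i y * (N + 1))
         - kk * (2 * bs i s y * B i y * (N + 1) + s ^ n * (B i y * B i y) * ((N + 1) * (N + 1))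
             + 2 * (b i s y + s * bs i s y) * B1 i y
             + 2 * B i y * (N + 1) * by_ i s y
             + 2 * B i y * (N + 1) * B1 i y * s ^ S n)).
    split; [|split; [|split]].
    + repeat split; spoly_tac.
    + intros i s y Hs. destruct (J i s y Hs) as (J1 & J2 & J3 & J4).
      split; [|split; [|split]].
      * apply (rderive_plus
          (fun s => b i s y) (fun s => B i y * s ^ S n)); auto.
        apply (is_derive_scal (fun s => s ^ S n)). apply is_derive_monomial.
      * apply (rderive_plus
          (b i s) (fun y => B i y * s ^ S n)); auto.
        apply is_derive_scalr, DB.
      * apply (rderive_plus
          (fun s => bs i s y) (fun s => B i y * (N * s ^ n))); auto.
        apply (is_derive_scal (fun s => N * s ^ n)), (is_derive_scal (fun s => s ^ n)).
        apply is_derive_monomial.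
      * apply (rderive_plus
          (bs i s) (fun y => B i y * (N * s ^ n))); auto.
        apply is_derive_scalr, DB.
    + intros. rewrite Eb. simpl. ring.
    + intros i s y.
      assert (Hn : s * (INR n * s ^ pred n) = (N - 1) * s ^ n).
      { unfold N. rewrite S_INR. destruct n; simpl; ring. }
      assert (Hlead : B i y * b0 i y * ((N + 1) * (N - 2 * kk)) + c i y = 0).
      { unfold B, a. transitivity (c i y - c i y * (b0 i y * ib0 i y)). field; auto.
        rewrite Hinv; ring. }
      specialize (ER i s y). rewrite EP in ER.
      set (z := INR n * s ^ pred n) in *. clearbody z.
      unfold residual in *. rewrite (Eb i s y) in *.
      change (s ^ S (S n)) with (s * (s * s ^ n)). change (s ^ S n) with (s * s ^ n) in *.
      clearbody N. set (t := s ^ n) in *. clearbody t.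
      apply Rminus_diag_uniq. apply Rminus_diag_eq in ER.
      match type of ER with ?L = 0 =>
      transitivity (L + (s * t) * (B i y * b0 i y * ((N + 1) * (N - 2 * kk)) + c i y)
        + (s * (b0 i y + s * g i s y) + s * (B i y * (s * t))) * (B i y * N) * (s * z - (N - 1) * t)) end.
      ring. rewrite ER, Hlead, Hn. ring.
Qed.


(** At the resonance [S n = 2 kk] no power of [s] removes the leading coefficient;
    a logarithm does, at the price of a slightly weaker remainder. *)
Lemma log_profile n : (1 <= n)%nat -> (forall j, (1 <= j <= n)%nat -> INR j <> 2 * kk) ->
  INR (S n) = 2 * kk ->
  exists b bs by_ bss bsy : fam,
    ssymb 1 0 b /\ ssymb 1 0 bs /\ is_jet b bs by_ bss bsy /\
    ssymb 1 (/ 2) (fun i s y => b i s y - b0 i y) /\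
    ssymb 1 (2 * kk + / 2) (fun i s y =>
      residual kk (rho i y) s (b i s y) (bs i s y) (by_ i s y) (bss i s y) (bsy i s y)).
Proof.
  intros Hn1 Hj Hres.
  destruct (poly_profile n Hj) as (b & bs & by_ & bss & bsy & g & P &
    (Sb & Sbs & Sby & Sbss & Sbsy & Sg & SP) & J & Eb & ER).
  destruct (spoly_split P SP) as (c & P1 & Hc & SP1 & EP).
  set (N := INR (S n)) in *.
  assert (HN2 : N + 1 <> 0). { pose proof (pos_INR (S n)). fold N in H. lra. }
  set (a := - / (N + 1)).
  set (B := fun i y => a * (c i y * ib0 i y)).
  assert (HB : coef B). { apply coef_mul. apply coef_const. apply coef_mul; auto. }
  destruct (coef_deriv B HB) as (B1 & HB1 & DB).
  assert (Sl : forall m, (1 <= m)%nat -> ssymb 1 (3 / 4) (fun _ s _ => s ^ m * ln s)).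
  { intros m Hm k. replace (3 / 4) with (1 + (- / 4)) by field.
    apply symb_mul; [|apply ssymb_ln].
    apply symb_le with (INR m); try lra. replace 1 with (INR 1) by reflexivity.
    apply le_INR; auto. apply symb_pow_nat. }
  assert (Sl0 : forall m, (1 <= m)%nat -> ssymb 1 0 (fun _ s _ => s ^ m * ln s)).
  { intros m Hm k. apply symb_le with (3 / 4); try lra. apply Sl; auto. }
  set (b' := fun i s y => b i s y + B i y * (s ^ S n * ln s)).
  set (bs' := fun i s y => bs i s y + B i y * (N * (s ^ n * ln s) + s ^ n)).
  set (by' := fun i s y => by_ i s y + B1 i y * (s ^ S n * ln s)).
  set (bss' := fun i s y => bss i s y + B i y *
     (N * (INR n * s ^ pred n * ln s + s ^ n * / s) + INR n * s ^ pred n)).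
  set (bsy' := fun i s y => bsy i s y + B1 i y * (N * (s ^ n * ln s) + s ^ n)).
  exists b', bs', by', bss', bsy'. split; [|split; [|split; [|split]]].
  - apply ssymb_add. apply spoly_ssymb; auto. apply ssymb_mul0. exact HB.
    apply Sl0; lia.
  - apply ssymb_add. apply spoly_ssymb; auto. apply ssymb_mul0. exact HB.
    apply ssymb_add. apply ssymb_mul0. apply spoly_ssymb, sp_const. apply Sl0; lia.
    apply spoly_ssymb, sp_pow.
  - intros i s y Hs. destruct (J i s y Hs) as (J1 & J2 & J3 & J4).
    assert (DL : forall m, is_derive (fun s => s ^ m * ln s) s
       (INR m * s ^ pred m * ln s + s ^ m * / s)).
    { intros m. apply (rderive_mult (fun s => s ^ m) ln).
      apply is_derive_monomial. apply is_derive_Reals, derivable_pt_lim_ln; lra. }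
    split; [|split; [|split]].
    + apply (rderive_plus
        (fun s => b i s y) (fun s => B i y * (s ^ S n * ln s))); auto.
      apply (is_derive_scal (fun s => s ^ S n * ln s)).
      replace (N * (s ^ n * ln s) + s ^ n) with (INR (S n) * s ^ pred (S n) * ln s + s ^ S n * / s).
      apply DL. simpl pred. fold N. simpl pow. field. lra.
    + apply (rderive_plus
        (b i s) (fun y => B i y * (s ^ S n * ln s))); auto. apply is_derive_scalr, DB.
    + apply (rderive_plus
        (fun s => bs i s y) (fun s => B i y * (N * (s ^ n * ln s) + s ^ n))); auto.
      apply (is_derive_scal (fun s => N * (s ^ n * ln s) + s ^ n)).
      apply (rderive_plus
        (fun s => N * (s ^ n * ln s)) (fun s => s ^ n)).
      apply (is_derive_scal (fun s => s ^ n * ln s)), DL. apply is_derive_monomial.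
    + apply (rderive_plus
        (bs i s) (fun y => B i y * (N * (s ^ n * ln s) + s ^ n))); auto. apply is_derive_scalr, DB.
  - intros k.
    apply symb_ext with (fun i s y => s * g i s y + B i y * (s ^ S n * ln s)).
    intros; unfold b'; rewrite Eb; ring.
    apply symb_le with (3 / 4); try lra. apply ssymb_add.
    + apply ssymb_mulr; [|apply spoly_ssymb; auto]. intros k'.
      apply symb_le with 1; try lra.
      apply symb_ext with (fun _ s _ => s ^ 1). intros; ring.
      replace 1 with (INR 1) at 2 by reflexivity. apply symb_pow_nat.
    + apply ssymb_mul0. exact HB. apply Sl; lia.
  - set (T0 := fun i s y => P1 i s y + g i s y * B i y * (N + 1) + 2 * b i s y * B1 i y
        - kk * (2 * bs i s y * B i y + s ^ n * (B i y * B i y) + 2 * B i y * by_ i s y)).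
    set (T1 := fun i s y => 2 * b i s y * B1 i y * (N + 1)
        + B i y * (2 * bs i s y + s * bss i s y + 2 * by_ i s y + 2 * (s * bsy i s y))
        + B i y * B i y * s ^ n * (2 * N + 1) + 2 * s ^ S n * B i y * B1 i y
        - kk * (2 * bs i s y * B i y * (N + 1) + 2 * s ^ n * (B i y * B i y) * (N + 1)
                + 2 * (b i s y + s * bs i s y) * B1 i y + 2 * B i y * (N + 1) * by_ i s y
                + 2 * B i y * B1 i y * s ^ S n)).
    set (T2 := fun i s y => B i y * B i y * s ^ n * (N * (N + 1))
        + 2 * s ^ S n * B i y * B1 i y * (N + 1)
        - kk * (s ^ n * (B i y * B i y) * ((N + 1) * (N + 1))
               + 2 * B i y * (N + 1) * B1 i y * s ^ S n)).
    assert (ST0 : spoly T0) by (unfold T0; spoly_tac).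
    assert (ST1 : spoly T1) by (unfold T1; spoly_tac).
    assert (ST2 : spoly T2) by (unfold T2; spoly_tac).
    intros k.
    apply symb_ext with (fun i s y => s ^ S (S n) * (T0 i s y + ln s * T1 i s y
       + ln s * (ln s * T2 i s y))).
    + intros i s y Hs.
      assert (Hz : s * (INR n * s ^ pred n) = (N - 1) * s ^ n).
      { unfold N. rewrite S_INR. destruct n; simpl; ring. }
      assert (Hlead : B i y * b0 i y * (N + 1) + c i y = 0).
      { unfold B, a. transitivity (c i y - c i y * (b0 i y * ib0 i y)). field; auto.
        rewrite Hinv; ring. }
      assert (Hw : s * (s ^ n * / s) = s ^ n) by (field; lra).
      specialize (ER i s y). rewrite EP in ER.
      unfold residual, T0, T1, T2, b', bs', by', bss', bsy' in *.
      set (z := INR n * s ^ pred n) in *. clearbody z.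
      set (w := s ^ n * / s) in *. clearbody w.
      rewrite (Eb i s y) in *.
      change (s ^ S (S n)) with (s * (s * s ^ n)). change (s ^ S n) with (s * s ^ n) in *.
      replace kk with (N / 2) in * by lra.
      clearbody N. set (t := s ^ n) in *. clearbody t. set (l := ln s). clearbody l.
      symmetry. apply Rminus_diag_uniq. apply Rminus_diag_eq in ER.
      match type of ER with ?L = 0 =>
      transitivity (L + (s * t) * (B i y * b0 i y * (N + 1) + c i y)
        + (s * (b0 i y + s * g i s y) + s * (B i y * (s * t * l))) *
          (B i y * ((N * l + 1) * (s * z - (N - 1) * t) + N * (s * w - t)))) end.
      field. rewrite ER, Hlead, Hz, Hw. ring.
    + replace (2 * kk + / 2) with (INR (S (S n)) + (- / 4 + (- / 4))).
      2: { rewrite S_INR. fold N. rewrite Hres. field. }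
      apply symb_mul. apply symb_pow_nat.
      assert (HQ : forall f e, e <= 0 -> spoly f -> ssymb 1 e f).
      { intros f e He Hf k'. apply symb_le with 0; try lra. apply spoly_ssymb; auto. }
      apply symb_add; [apply symb_add|].
      * apply HQ; auto; lra.
      * apply symb_mul. apply ssymb_ln. apply HQ; auto; lra.
      * apply symb_mul. apply ssymb_ln.
        replace (- / 4) with (- / 4 + 0) by ring. apply symb_mul. apply ssymb_ln.
        apply HQ; auto; lra.
Qed.

Lemma approximate_profile : 1 < kk ->
  exists (b bs by_ bss bsy : fam) (d : R), 0 < d /\ ssymb 1 0 b /\ ssymb 1 0 bs /\ is_jet b bs by_ bss bsy /\
    ssymb 1 (/ 2) (fun i s y => b i s y - b0 i y) /\
    ssymb 1 (2 * kk + d) (fun i s y =>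
      residual kk (rho i y) s (b i s y) (bs i s y) (by_ i s y) (bss i s y) (bsy i s y)).
Proof.
  intros Hkk.
  destruct (nfloor_ex (2 * kk)) as [M [HM1 HM2]]; [lra|].
  assert (HM : (2 <= M)%nat).
  { destruct M as [|[|M]]; [| |lia]; simpl in HM2; lra. }
  destruct (Req_dec (INR M) (2 * kk)) as [E|E].
  - destruct M as [|n]; [lia|].
    destruct (log_profile n) as (b & bs & by_ & bss & bsy & H); auto; [lia| |].
    { intros j Hj. assert (INR j <= INR n) by (apply le_INR; lia).
      rewrite S_INR in E. lra. }
    exists b, bs, by_, bss, bsy, (/ 2). split; [lra|]. exact H.
  - destruct (poly_profile M) as (b & bs & by_ & bss & bsy & g & P &
      (Sb & Sbs & Sby & Sbss & Sbsy & Sg & SP) & J & Eb & ER).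
    { intros j Hj. assert (INR j <= INR M) by (apply le_INR; lia). lra. }
    exists b, bs, by_, bss, bsy, (INR (S M) - 2 * kk).
    split; [rewrite S_INR; lra|]. split; [apply spoly_ssymb; auto|].
    split; [apply spoly_ssymb; auto|]. split; [auto|]. split.
    + intros k. apply symb_ext with (fun i s y => s * g i s y).
      intros; rewrite Eb; ring.
      apply ssymb_mulr; [|apply spoly_ssymb; auto]. intros k'.
      apply symb_le with 1; try lra.
      apply symb_ext with (fun _ s _ => s ^ 1). intros; ring.
      replace 1 with (INR 1) at 2 by reflexivity. apply symb_pow_nat.
    + intros k. apply symb_ext with (fun i s y => s ^ S M * P i s y). intros; auto.
      replace (2 * kk + (INR (S M) - 2 * kk)) with (INR (S M) + 0) by ring.
      apply symb_mul. apply symb_pow_nat. apply spoly_ssymb; auto.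
Qed.

End Profile.


(** * Exact solution near the blow-up surface *)

(** Transport commutes with [d_y], so it gains one power of [s] at every order. *)
Lemma symb_transport sg e c h : 0 < e -> ssymb sg e h ->
  ssymb sg (e + 1) (fun i => transport c (h i)).
Proof.
  intros He Hh k. revert h Hh.
  assert (B : forall h, ssymb sg e h -> exists C, 0 <= C /\
    forall i s y, 0 < s < sg -> Rabs (transport c (h i) s y) <= C * Rpower s (e + 1)).
  { intros h Hh. destruct (symb_wcont _ _ _ _ (Hh 0%nat)) as (C & HC & W).
    exists (C / (e + 1)). split.
    apply Rmult_le_pos; auto. left; apply Rinv_0_lt_compat; lra.
    intros i. apply (transport_wcont sg e C c (h i) He (W i)). }
  assert (D : forall h, ssymb sg e h -> forall i s y, 0 < s < sg ->
    continuity_2d_pt (transport c (h i)) s y /\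
    is_derive (transport c (h i) s) y (transport c (dy h i) s y)).
  { intros h Hh i s y Hs. destruct (symb_wcont _ _ _ _ (Hh 0%nat)) as (C & HC & W).
    destruct (ssymb_dy _ _ _ Hh) as [Dh Sh].
    destruct (symb_wcont _ _ _ _ (Sh 0%nat)) as (C' & HC' & W'). split.
    apply (transport_c2 sg e C); auto.
    apply (transport_dy sg e C C' c (h i) (dy h i)); auto. }
  induction k; intros h Hh; (split; [|split]); auto.
  1, 3: intros; apply D; auto.
  - destruct (ssymb_dy _ _ _ Hh) as [Dh Sh]. destruct (B _ Sh) as (C & HC & HB).
    exists C; split; auto. intros i s y y' Hs. apply mvt_lip with (transport c (dy h i) s).
    intros; apply D; auto. intros; apply HB; auto.
  - exists (fun i => transport c (dy h i)). split. intros; apply D; auto.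
    apply IHk. apply (ssymb_dy _ _ _ Hh).
Qed.

(** The potential of the linearised equation has the strength at which [s^(2 + 2/p)] is a
    homogeneous solution. *)
Lemma nlw_indicial p : 0 < p ->
  2 * (p + 2) / p ^ 2 * (p + 1) = (2 + 2 / p) * (2 + 2 / p - 1).
Proof. intros; field; lra. Qed.

(** With [w = s b] and [u0 = w^(-2/p)], the functions [X] and [P] below are [1 / u0] and
    [c rho u0^(p+1)], and [R0] is [u0_ss + 2 u0_sy - P]. *)
Section Exact.

Variables (p d : R) (rho b0 : nat -> R -> R) (b bs by_ bss bsy : fam).
Hypotheses (Hp : 0 < p) (Hd : 0 < d) (Hrho : coef rho) (Hrho2 : forall i y, / 2 <= rho i y)
  (Hsq : forall i y, b0 i y * b0 i y = rho i y) (Hb0 : forall i y, 0 < b0 i y)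
  (Sb : ssymb 1 0 b) (Sbs : ssymb 1 0 bs) (J : is_jet b bs by_ bss bsy)
  (Sd : ssymb 1 (/ 2) (fun i s y => b i s y - b0 i y))
  (SQ : ssymb 1 (2 * (1 + 2 / p) + d) (fun i s y =>
      residual (1 + 2 / p) (rho i y) s (b i s y) (bs i s y) (by_ i s y) (bss i s y) (bsy i s y))).

Let c := 2 * (p + 2) / p ^ 2.
Let m := 2 + 2 / p + d.
Let Q : fam := fun i s y =>
  residual (1 + 2 / p) (rho i y) s (b i s y) (bs i s y) (by_ i s y) (bss i s y) (bsy i s y).
Let w : fam := fun i s y => s * b i s y.
Let P : fam := fun i s y => c * rho i y * Rpower (w i s y) (- (2 / p) - 2).
Let X : fam := fun i s y => Rpower (w i s y) (2 / p).
Let R0 : fam := fun i s y => - (2 / p) * (Rpower (w i s y) (- (2 / p) - 2) * Q i s y).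

Lemma inv_p_pos : 0 < 2 / p.
Proof. apply Rdiv_lt_0_compat; lra. Qed.

Lemma b0_half i y : / 2 <= b0 i y.
Proof. specialize (Hsq i y). specialize (Hrho2 i y). specialize (Hb0 i y). nra. Qed.

(** The relative error of [b0] as an approximation of [b] tends to 0 at the surface. *)
Lemma b_close eps : 0 < eps ->
  exists sg, 0 < sg <= 1 /\ forall i s y, 0 < s < sg -> (1 - eps) * b0 i y <= b i s y.
Proof.
  intros He. destruct (symb_bound _ _ _ _ (Sd 0%nat)) as (C & HC & HB).
  destruct (Rpower_small (/ 2) (eps / 2 / (C + 1))) as [r Hr].
  lra. apply Rdiv_lt_0_compat; lra.
  exists (Rmin 1 r). split; [split; [apply Rmin_pos; [lra|apply cond_pos]|apply Rmin_l]|].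
  intros i s y Hs. pose proof (Rmin_l 1 r). pose proof (Rmin_r 1 r).
  specialize (HB i s y ltac:(lra)). specialize (Hr s ltac:(lra)).
  apply Rabs_le_inv in HB. pose proof (b0_half i y).
  assert (C * Rpower s (/ 2) <= eps / 2).
  { apply Rle_trans with ((C + 1) * (eps / 2 / (C + 1))); [|apply Req_le; field; lra].
    apply Rmult_le_compat; try lra. apply Rpower_nonneg. }
  nra.
Qed.

Lemma b_upper : exists B, 0 < B /\ forall i s y, 0 < s < 1 -> b i s y <= B.
Proof.
  destruct (symb_bound _ _ _ _ (Sb 0%nat)) as (C & HC & HB).
  exists (C + 1). split; [lra|]. intros i s y Hs. specialize (HB i s y Hs).
  rewrite Rpower_O in HB by lra. apply Rabs_le_inv in HB. lra.
Qed.

Section Domain.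

Variables (sg : R).
Hypotheses (Hsg : 0 < sg <= 1) (Hlow : forall i s y, 0 < s < sg -> / 4 <= b i s y).

Lemma w_pos i s y : 0 < s < sg -> 0 < w i s y.
Proof. intros Hs. specialize (Hlow i s y Hs). unfold w. nra. Qed.

Lemma symb_w q : ssymb sg q (fun i s y => Rpower (w i s y) q).
Proof.
  intros k. apply symb_ext with (fun i s y => Rpower s q * Rpower (b i s y) q).
  - intros i s y Hs. specialize (Hlow i s y Hs). unfold w. apply Rpower_mult_distr; lra.
  - replace q with (q + 0) at 1 by ring. apply symb_mul. apply symb_pow_s.
    apply symb_Rpower with (b := / 4); auto; [lra|]. apply symb_sub with 1; auto; lra.
Qed.

Lemma ssymb_sub sg' e f : sg <= sg' -> ssymb sg' e f -> ssymb sg e f.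
Proof. intros H Hf k. apply symb_sub with sg'; auto. Qed.

Lemma symb_P : ssymb sg (- (2 / p) - 2) P.
Proof.
  apply ssymb_mul0; [|apply symb_w].
  apply ssymb_mul0. intros k; apply symb_const. apply ssymb_sub with 1; [lra|exact Hrho].
Qed.

Lemma symb_X : ssymb sg (2 / p) X.
Proof. apply symb_w. Qed.

Lemma symb_R0 : ssymb sg (m - 2) R0.
Proof.
  apply ssymb_mul0. intros k; apply symb_const.
  intros k. replace (m - 2) with ((- (2 / p) - 2) + (2 * (1 + 2 / p) + d)) by (unfold m; ring).
  apply symb_mul. apply symb_w. apply ssymb_sub with 1; [lra|exact SQ].
Qed.

Lemma PX_eq i s y : 0 < s < sg -> P i s y * X i s y = c * rho i y * Rpower (w i s y) (-2).
Proof.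
  intros Hs. unfold P, X. rewrite Rmult_assoc, <- Rpower_plus. do 2 f_equal. ring.
Qed.

Variables (A La xi : R) (z : fam).
Hypotheses (HA : 0 <= A) (HLa : 0 <= La < m * (m - 1)) (Hxi : xi <= / 2)
  (HPX : forall i s y, 0 < s < sg ->
     Rabs (P i s y * X i s y) * ((p + 1) * Rpower (1 + xi) p) <= La * Rpower s (-2))
  (HXA : forall i s y, 0 < s < sg -> Rabs (X i s y) * (A * Rpower s m) <= xi)
  (Hz : forall i, wcont sg m A (z i))
  (Heq : forall i s y, 0 < s < sg ->
     z i s y = duhamel (fun s y => P i s y * powgap p (X i s y * z i s y) - R0 i s y) s y).

Let Phi : fam := fun i s y => P i s y * powgap p (X i s y * z i s y) - R0 i s y.
Let U : fam := fun i s y => Rpower (w i s y) (- (2 / p)) + z i s y.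
Let V0 : fam := fun i s y =>
  - (2 / p) * (Rpower (w i s y) (- (2 / p) - 1) * (b i s y + s * bs i s y)).
Let V : fam := fun i s y => V0 i s y + transport 2 (Phi i) s y.

Lemma m_gt_2 : 2 < m.
Proof. pose proof inv_p_pos. unfold m; lra. Qed.

Lemma symb_z : ssymb sg m z.
Proof.
  pose proof inv_p_pos.
  apply (nonlinear_regularity p sg m La xi (- (2 / p) - 2) (2 / p) P X R0 z A); auto; try lra.
  apply m_gt_2. apply symb_P. apply symb_X. apply symb_R0.
Qed.

Lemma Xz_small i s y : 0 < s < sg -> Rabs (X i s y * z i s y) <= / 2.
Proof.
  intros Hs. apply Rle_trans with xi; auto.
  eapply Rle_trans; [|apply (HXA i s y Hs)]. rewrite Rabs_mult.
  apply Rmult_le_compat_l; [apply Rabs_pos | apply Hz; auto].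
Qed.

Lemma symb_Phi : ssymb sg (m - 2) Phi.
Proof.
  pose proof inv_p_pos. pose proof m_gt_2.
  intros k. apply symb_ext with
    (fun i s y => P i s y * powgap p (X i s y * z i s y) + (-1) * R0 i s y).
  intros; unfold Phi; ring.
  apply symb_add.
  - replace (m - 2) with ((- (2 / p) - 2) + (2 / p + m)) by ring.
    apply symb_mul. apply symb_P.
    apply (symb_powgap sg k (2 / p + m) p (fun i s y => X i s y * z i s y)); auto; try lra.
    apply symb_mul. apply symb_X. apply symb_z. apply Xz_small.
  - apply ssymb_mul0. intros k'; apply symb_const. apply symb_R0.
Qed.

Lemma symb_U : ssymb sg (- (2 / p)) U.
Proof.
  apply ssymb_add. apply symb_w. intros k. apply symb_le with m; [lra| |apply symb_z].
  pose proof inv_p_pos. pose proof m_gt_2. lra.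
Qed.

Lemma symb_V0 : ssymb sg (- (2 / p) - 1) V0.
Proof.
  apply ssymb_mul0. intros k; apply symb_const.
  apply ssymb_mulr. apply symb_w.
  apply ssymb_add. apply ssymb_sub with 1; [lra|exact Sb].
  apply ssymb_mul0. apply ssymb_s; lra. apply ssymb_sub with 1; [lra|exact Sbs].
Qed.

Lemma symb_V : ssymb sg (- (2 / p) - 1) V.
Proof.
  pose proof inv_p_pos. pose proof m_gt_2.
  apply ssymb_add. apply symb_V0. intros k. apply symb_le with (m - 2 + 1); [lra|lra|].
  apply symb_transport. lra. apply symb_Phi.
Qed.

Lemma w_ds i s y : 0 < s < sg -> is_derive (fun s => w i s y) s (b i s y + s * bs i s y).
Proof.
  intros Hs. destruct (J i s y ltac:(lra)) as (J1 & J2 & J3 & J4).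
  rewrite <- (Rmult_1_l (b i s y)).
  apply (rderive_mult (fun s => s) (fun s => b i s y)); auto.
  apply rderive_id.
Qed.

Lemma w_dy i s y : 0 < s < sg -> is_derive (w i s) y (s * by_ i s y).
Proof.
  intros Hs. destruct (J i s y ltac:(lra)) as (J1 & J2 & J3 & J4).
  apply (is_derive_scal (b i s)); auto.
Qed.

Lemma ws_ds i s y : 0 < s < sg ->
  is_derive (fun s => b i s y + s * bs i s y) s (2 * bs i s y + s * bss i s y).
Proof.
  intros Hs. destruct (J i s y ltac:(lra)) as (J1 & J2 & J3 & J4).
  replace (2 * bs i s y + s * bss i s y) with (bs i s y + (1 * bs i s y + s * bss i s y)) by ring.
  apply (rderive_plus
    (fun s => b i s y) (fun s => s * bs i s y)); auto.
  apply (rderive_mult (fun s => s) (fun s => bs i s y)); auto.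
  apply rderive_id.
Qed.

Lemma ws_dy i s y : 0 < s < sg ->
  is_derive (fun y => b i s y + s * bs i s y) y (by_ i s y + s * bsy i s y).
Proof.
  intros Hs. destruct (J i s y ltac:(lra)) as (J1 & J2 & J3 & J4).
  apply (rderive_plus
    (b i s) (fun y => s * bs i s y)); auto.
  apply (is_derive_scal (bs i s)); auto.
Qed.

Lemma is_derive_Rpower_comp (f : R -> R) x l q : 0 < f x -> is_derive f x l ->
  is_derive (fun x => Rpower (f x) q) x (l * (q * Rpower (f x) (q - 1))).
Proof.
  intros Hf Hl. apply (rderive_comp
    (fun x => Rpower x q) f); auto. apply is_derive_Rpower; auto.
Qed.

Lemma U_ds i s y : 0 < s < sg -> is_derive (fun s => U i s y) s (V i s y).
Proof.
  intros Hs. pose proof m_gt_2 as Hm.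
  apply (rderive_plus
    (fun s => Rpower (w i s y) (- (2 / p))) (fun s => z i s y)).
  - unfold V0.
    replace (- (2 / p) * (Rpower (w i s y) (- (2 / p) - 1) * (b i s y + s * bs i s y)))
     with ((b i s y + s * bs i s y) * (- (2 / p) * Rpower (w i s y) (- (2 / p) - 1))) by ring.
    apply (is_derive_Rpower_comp (fun s => w i s y)). apply w_pos; auto. apply w_ds; auto.
  - destruct (ssymb_dy _ _ _ symb_Phi) as [DPhi SPhi].
    pose proof (symb_transport sg (m - 2) 2 Phi ltac:(lra) symb_Phi) as ST.
    destruct (ssymb_dy _ _ _ ST) as [DT ST'].
    destruct (symb_wcont _ _ _ _ (ST 0%nat)) as (C & HC & W).
    destruct (symb_wcont _ _ _ _ (ST' 0%nat)) as (C' & HC' & W').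
    replace (transport 2 (Phi i) s y) with
      (transport 2 (Phi i) s y - 0 * transport 0 (dy (fun i => transport 2 (Phi i)) i) s y) by ring.
    apply is_derive_ext_loc with (fun s => transport 0 (transport 2 (Phi i)) s y).
    + apply locally_between with 0 sg; auto. intros; symmetry; apply Heq; auto.
    + apply (transport_ds sg (m - 2 + 1) C C'); auto. lra.
Qed.

Lemma U_factor i s y : 0 < s < sg ->
  U i s y = Rpower (w i s y) (- (2 / p)) * (1 + X i s y * z i s y).
Proof.
  intros Hs. unfold U, X. rewrite Rmult_plus_distr_l, <- Rmult_assoc, <- Rpower_plus.
  replace (- (2 / p) + 2 / p) with 0 by ring. rewrite Rpower_O by (apply w_pos; auto). ring.
Qed.

(** The approximate solution misses the equation by [R0], which the source [Phi] restores. *)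
Lemma V_ds i s y : 0 < s < sg -> is_derive (fun s => V i s y) s
    (- 2 * dy V i s y + c * rho i y * Rpower (U i s y) (p + 1)).
Proof.
  intros Hs. pose proof m_gt_2 as Hm. pose proof (w_pos i s y Hs) as Hw.
  destruct (ssymb_dy _ _ _ symb_Phi) as [DPhi SPhi].
  destruct (symb_wcont _ _ _ _ (symb_Phi 0%nat)) as (C & HC & W).
  destruct (symb_wcont _ _ _ _ (SPhi 0%nat)) as (C' & HC' & W').
  set (t := transport 2 (dy Phi i) s y).
  set (B := b i s y). set (B1 := bs i s y). set (B2 := bss i s y).
  set (By := by_ i s y). set (Bsy := bsy i s y).
  set (om := Rpower (w i s y) (- (2 / p) - 2)).
  assert (Hom : Rpower (w i s y) (- (2 / p) - 1) = w i s y * om).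
  { unfold om. rewrite <- (Rpower_1 (w i s y)) at 2 by auto. rewrite <- Rpower_plus.
    f_equal; ring. }
  assert (Hom' : Rpower (w i s y) (- (2 / p) - 1 - 1) = om) by (unfold om; f_equal; ring).
  assert (Edy : dy V i s y = - (2 / p) * ((s * By * ((- (2 / p) - 1) * om)) * (B + s * B1)
      + w i s y * om * (By + s * Bsy)) + t).
  { apply is_derive_unique.
    apply (rderive_plus
      (V0 i s) (transport 2 (Phi i) s)).
    - rewrite <- Hom, <- Hom'.
      apply (is_derive_scal (fun y => Rpower (w i s y) (- (2 / p) - 1) * (b i s y + s * bs i s y))).
      apply (rderive_mult (fun y => Rpower (w i s y) (- (2 / p) - 1))
        (fun y => b i s y + s * bs i s y)).
      apply (is_derive_Rpower_comp (w i s)); auto. apply w_dy; auto.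
      apply ws_dy; auto.
    - apply (transport_dy sg (m - 2) C C' 2 (Phi i) (dy Phi i)); auto. lra. }
  assert (Es : is_derive (fun s => V i s y) s
     (- (2 / p) * (((B + s * B1) * ((- (2 / p) - 1) * om)) * (B + s * B1)
      + w i s y * om * (2 * B1 + s * B2)) + (Phi i s y - 2 * t))).
  { apply (rderive_plus
      (fun s => V0 i s y) (fun s => transport 2 (Phi i) s y)).
    - rewrite <- Hom, <- Hom'.
      apply (is_derive_scal (fun s => Rpower (w i s y) (- (2 / p) - 1) * (b i s y + s * bs i s y))).
      apply (rderive_mult (fun s => Rpower (w i s y) (- (2 / p) - 1))
        (fun s => b i s y + s * bs i s y)).
      apply (is_derive_Rpower_comp (fun s => w i s y)); auto. apply w_ds; auto.
      apply ws_ds; auto.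
    - apply (transport_ds sg (m - 2) C C' 2 (Phi i) (dy Phi i)); auto. lra. }
  assert (EU : Rpower (U i s y) (p + 1) = om * (1 + powgap p (X i s y * z i s y))).
  { unfold powgap. rewrite (U_factor i s y Hs), <- Rpower_mult_distr, Rpower_mult.
    - unfold om. replace (- (2 / p) * (p + 1)) with (- (2 / p) - 2) by (field; lra). ring.
    - apply Rpower_pos.
    - pose proof (Xz_small i s y Hs) as H. apply Rabs_le_inv in H. lra. }
  rewrite Edy, EU.
  match type of Es with is_derive _ _ ?l => match goal with |- is_derive _ _ ?l' =>
    replace l' with l; [exact Es|] end end.
  unfold Phi, P, R0, Q, residual. fold om. fold B B1 B2 By Bsy.
  replace c with (2 / p * (1 + 2 / p)) by (unfold c; field; lra).
  unfold w. fold B. ring.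
Qed.

Lemma U_lower Bu : 0 < Bu -> (forall i s y, 0 < s < 1 -> b i s y <= Bu) ->
  forall i s y, 0 < s < sg ->
    / 2 * Rpower Bu (- (2 / p)) * Rpower s (- (2 / p)) <= U i s y.
Proof.
  intros HBu HB i s y Hs. pose proof inv_p_pos as Hp2.
  rewrite (U_factor i s y Hs).
  pose proof (Xz_small i s y Hs) as H. apply Rabs_le_inv in H.
  apply Rle_trans with (Rpower (w i s y) (- (2 / p)) * / 2).
  2: { apply Rmult_le_compat_l; [apply Rpower_nonneg | lra]. }
  specialize (Hlow i s y Hs). specialize (HB i s y ltac:(lra)).
  unfold w. rewrite <- Rpower_mult_distr by lra.
  assert (Rpower Bu (- (2 / p)) <= Rpower (b i s y) (- (2 / p))).
  { rewrite !Rpower_Ropp. apply Rinv_le_contravar. apply Rpower_pos.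
    apply Rle_Rpower_l; lra. }
  pose proof (Rpower_pos s (- (2 / p))). nra.
Qed.

End Domain.

(** All smallness conditions hold near the surface because the order [m] of the
    correction exceeds the critical exponent [2 + 2 / p]. *)
Lemma exact_exists : exists (sg k0 : R) (U V : fam), 0 < sg <= 1 /\ 0 < k0 /\
  ssymb sg (- (2 / p)) U /\ ssymb sg (- (2 / p) - 1) V /\
  forall i s y, 0 < s < sg ->
    is_derive (fun s => U i s y) s (V i s y) /\
    is_derive (fun s => V i s y) s
      (- 2 * dy V i s y + c * rho i y * Rpower (U i s y) (p + 1)) /\
    k0 * Rpower s (- (2 / p)) <= U i s y.
Proof.
  pose proof inv_p_pos as Hp2. pose proof m_gt_2 as Hm.
  set (mu := c * (p + 1)).
  assert (Hmu : mu = (2 + 2 / p) * (2 + 2 / p - 1)) by (apply nlw_indicial; auto).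
  assert (Hmu2 : 0 < mu) by (rewrite Hmu; nra).
  assert (Hmm : mu < m * (m - 1)) by (rewrite Hmu; unfold m; nra).
  set (La := (mu + m * (m - 1)) / 2).
  assert (HLa : 0 <= La < m * (m - 1)) by (unfold La; lra).
  (* [r ^ 3] is the room between the linearised potential and [La] *)
  set (r := Rpower (La / mu) (/ 3)).
  assert (Hr3 : r * r * r = La / mu).
  { unfold r. rewrite <- !Rpower_plus. replace (/ 3 + / 3 + / 3) with 1 by field.
    apply Rpower_1. apply Rdiv_lt_0_compat; unfold La; lra. }
  assert (Hr : 1 < r).
  { unfold r. rewrite <- (Rpower_O (La / mu)) by (apply Rdiv_lt_0_compat; unfold La; lra).
    apply Rpower_lt; [|lra]. apply Rmult_lt_reg_r with mu; auto.
    replace (La / mu * mu) with La by (field; lra). unfold La; lra. }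
  set (xi := Rmin (/ 2) (Rpower r (/ p) - 1)).
  assert (Hrp : 1 < Rpower r (/ p)).
  { rewrite <- (Rpower_O r) by lra. apply Rpower_lt; auto. apply Rinv_0_lt_compat; auto. }
  assert (Hxi : 0 < xi <= / 2).
  { split. apply Rmin_pos; lra. apply Rmin_l. }
  assert (Hxir : Rpower (1 + xi) p <= r).
  { replace r with (Rpower (Rpower r (/ p)) p).
    apply Rle_Rpower_l; [lra|]. pose proof (Rmin_r (/ 2) (Rpower r (/ p) - 1)). fold xi in H. lra.
    rewrite Rpower_mult, Rinv_l, Rpower_1; lra. }
  set (eps := Rmin (/ 2) (1 - / r)).
  assert (Hir : 0 < / r < 1).
  { split. apply Rinv_0_lt_compat; lra. rewrite <- Rinv_1. apply Rinv_lt_contravar; lra. }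
  assert (Heps : 0 < eps) by (apply Rmin_pos; lra).
  destruct (b_close eps Heps) as (s1 & Hs1 & Hclose).
  assert (Hlow1 : forall i s y, 0 < s < s1 -> / 4 <= b i s y /\ b0 i y <= r * b i s y).
  { intros i s y Hs. specialize (Hclose i s y Hs). pose proof (b0_half i y).
    pose proof (Rmin_l (/ 2) (1 - / r)). pose proof (Rmin_r (/ 2) (1 - / r)). fold eps in H0, H1.
    split. nra.
    assert (/ r * b0 i y <= b i s y) by nra.
    replace (b0 i y) with (r * (/ r * b0 i y)) by (field; lra).
    apply Rmult_le_compat_l; lra. }
  destruct (symb_bound _ _ _ _ (symb_R0 s1 Hs1 (fun i s y H => proj1 (Hlow1 i s y H)) 0%nat))
    as (F & HF & HFb).
  destruct (symb_bound _ _ _ _ (symb_X s1 Hs1 (fun i s y H => proj1 (Hlow1 i s y H)) 0%nat))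
    as (CX & HCX & HXb).
  set (A := F / (m * (m - 1) - La)).
  assert (HA : 0 <= A) by (apply Rmult_le_pos; auto; left; apply Rinv_0_lt_compat; lra).
  destruct (Rpower_small (2 / p + m) (xi / (CX * A + 1))) as [s2 Hs2]; [lra| |].
  { apply Rdiv_lt_0_compat. lra. assert (0 <= CX * A) by (apply Rmult_le_pos; auto). lra. }
  set (sg := Rmin s1 s2).
  pose proof (Rmin_l s1 s2 : sg <= s1) as L1. pose proof (Rmin_r s1 s2 : sg <= s2) as L2.
  assert (Hsg : 0 < sg <= 1).
  { split; [|lra]. apply Rmin_pos; [lra | apply cond_pos]. }
  assert (Hlow : forall i s y, 0 < s < sg -> / 4 <= b i s y).
  { intros; apply Hlow1; lra. }
  assert (HXA : forall i s y, 0 < s < sg -> Rabs (X i s y) * (A * Rpower s m) <= xi).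
  { intros i s y Hs.
    apply Rle_trans with (CX * Rpower s (2 / p) * (A * Rpower s m)).
    { apply Rmult_le_compat_r. apply Rmult_le_pos; auto. apply Rpower_nonneg.
      apply HXb; lra. }
    replace (CX * Rpower s (2 / p) * (A * Rpower s m)) with (CX * A * Rpower s (2 / p + m)).
    2: { rewrite Rpower_plus; ring. }
    assert (0 <= CX * A) by (apply Rmult_le_pos; auto).
    apply Rle_trans with ((CX * A + 1) * (xi / (CX * A + 1))); [|apply Req_le; field; lra].
    apply Rmult_le_compat; auto; try lra. apply Rpower_nonneg.
    left; apply Hs2. lra. }
  assert (HPX : forall i s y, 0 < s < sg ->
     Rabs (P i s y * X i s y) * ((p + 1) * Rpower (1 + xi) p) <= La * Rpower s (-2)).
  { intros i s y Hs. rewrite (PX_eq sg i s y Hs).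
    destruct (Hlow1 i s y ltac:(lra)) as [Hb1 Hb2].
    assert (Hrb : rho i y <= r * r * (b i s y * b i s y)).
    { rewrite <- Hsq. specialize (Hb0 i y). nra. }
    assert (Hw2 : Rpower (w i s y) (-2) = Rpower s (-2) * / (b i s y * b i s y)).
    { unfold w. rewrite <- Rpower_mult_distr by lra. f_equal.
      replace (-2) with (- (2)) by ring. rewrite Rpower_Ropp. f_equal.
      replace 2 with (1 + 1) by ring. rewrite Rpower_plus, Rpower_1; lra. }
    assert (Hc0 : 0 < c).
    { unfold c. apply Rdiv_lt_0_compat. lra. apply pow_lt; lra. }
    rewrite Hw2. pose proof (Rpower_pos s (-2)) as Hs0.
    set (q := Rpower s (-2)) in *. clearbody q.
    set (B := b i s y) in *. assert (HB2 : 0 < B * B) by nra.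
    specialize (Hrho2 i y).
    rewrite Rabs_pos_eq.
    2: { pose proof (Rinv_0_lt_compat _ HB2). pose proof (Rpower_pos (1 + xi) p).
         assert (0 < c * rho i y) by (apply Rmult_lt_0_compat; lra).
         assert (0 < q * / (B * B)) by (apply Rmult_lt_0_compat; lra).
         left. apply Rmult_lt_0_compat; assumption. }
    replace (c * rho i y * (q * / (B * B)) * ((p + 1) * Rpower (1 + xi) p))
      with (mu * (rho i y * / (B * B)) * Rpower (1 + xi) p * q) by (unfold mu; ring).
    apply Rmult_le_compat_r; [lra|].
    assert (rho i y * / (B * B) <= r * r).
    { replace (r * r) with (r * r * (B * B) * / (B * B)) by (field; nra).
      apply Rmult_le_compat_r; auto. left; apply Rinv_0_lt_compat; auto. }
    replace La with (mu * (r * r) * r) by (rewrite Rmult_assoc, Hr3; field; lra).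
    apply Rmult_le_compat; auto.
    - apply Rmult_le_pos; [lra|]. apply Rmult_le_pos; [lra|]. left; apply Rinv_0_lt_compat; auto.
    - apply Rpower_nonneg.
    - apply Rmult_le_compat_l; lra. }
  pose proof (symb_P sg Hsg Hlow) as SP. pose proof (symb_X sg Hsg Hlow) as SX.
  pose proof (symb_R0 sg Hsg Hlow) as SR.
  destruct (fam_choice (fun i z => wcont sg m A z /\
    forall s y, 0 < s < sg ->
     z s y = duhamel (fun s y => P i s y * powgap p (X i s y * z s y) - R0 i s y) s y)) as [z Hz].
  { intros i.
    assert (Hsm : forall s y u, 0 < s < sg -> Rabs u <= A * Rpower s m -> Rabs (X i s y * u) <= xi).
    { intros s y u Hs Hu. eapply Rle_trans; [|apply (HXA i s y Hs)]. rewrite Rabs_mult.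
      apply Rmult_le_compat_l; auto using Rabs_pos. }
    apply (volterra_exists sg m La Hm HLa F A
      (fun s y u => P i s y * powgap p (X i s y * u) - R0 i s y)); auto.
    - apply Req_le. unfold A. field. lra.
    - intros s y Hs. rewrite Rmult_0_r, powgap_0, Rmult_0_r, Rminus_0_l, Rabs_Ropp.
      apply HFb; lra.
    - intros s y u u' Hs Hu Hu'.
      replace (P i s y * powgap p (X i s y * u) - R0 i s y -
        (P i s y * powgap p (X i s y * u') - R0 i s y))
       with (P i s y * (powgap p (X i s y * u) - powgap p (X i s y * u'))) by ring.
      rewrite Rabs_mult.
      apply Rle_trans with (Rabs (P i s y) * ((p + 1) * Rpower (1 + xi) p *
         Rabs (X i s y * u - X i s y * u'))).
      + apply Rmult_le_compat_l; [apply Rabs_pos|]. apply powgap_lip; auto; lra.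
      + replace (X i s y * u - X i s y * u') with (X i s y * (u - u')) by ring.
        rewrite Rabs_mult.
        replace (Rabs (P i s y) * ((p + 1) * Rpower (1 + xi) p * (Rabs (X i s y) * Rabs (u - u'))))
         with (Rabs (P i s y * X i s y) * ((p + 1) * Rpower (1 + xi) p) * Rabs (u - u'))
          by (rewrite Rabs_mult; ring).
        apply Rmult_le_compat_r; auto using Rabs_pos.
    - intros u Hu s y Hs. apply continuity_2d_pt_minus.
      2: apply (symb_cont _ _ _ _ (SR 0%nat)); auto.
      apply continuity_2d_pt_mult. apply (symb_cont _ _ _ _ (SP 0%nat)); auto.
      apply (continuity_1d_2d_pt_comp (powgap p) (fun s y => X i s y * u s y)).
      + apply continuity_pt_filterlim.
        eapply rderive_continuous; apply is_derive_powgap.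
        pose proof (Hsm s y (u s y) Hs ltac:(apply Hu; auto)) as H. apply Rabs_le_inv in H. lra.
      + apply continuity_2d_pt_mult. apply (symb_cont _ _ _ _ (SX 0%nat)); auto. apply Hu; auto. }
  destruct b_upper as (Bu & HBu & HB).
  assert (Hxi' : xi <= / 2) by lra.
  assert (Hz1 : forall i, wcont sg m A (z i)) by (intros; apply Hz).
  assert (Hz2 := fun i => proj2 (Hz i)). simpl in Hz2.
  exists sg, (/ 2 * Rpower Bu (- (2 / p))).
  exists (fun i s y => Rpower (w i s y) (- (2 / p)) + z i s y).
  exists (fun i s y =>
    - (2 / p) * (Rpower (w i s y) (- (2 / p) - 1) * (b i s y + s * bs i s y))
    + transport 2 (fun s y => P i s y * powgap p (X i s y * z i s y) - R0 i s y) s y).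
  split; [auto|]. split.
  { apply Rmult_lt_0_compat; [lra | apply Rpower_pos]. }
  split; [apply (symb_U sg Hsg Hlow A La xi z); auto|].
  split; [apply (symb_V sg Hsg Hlow A La xi z); auto|].
  intros i s y Hs. split; [|split].
  - apply (U_ds sg Hsg Hlow A La xi z); auto.
  - apply (V_ds sg Hsg Hlow A La xi z); auto.
  - apply (U_lower sg Hsg Hlow A xi z); auto.
Qed.

End Exact.

Theorem blowup_profile (p : R) (rho : nat -> R -> R) : 0 < p -> coef rho ->
  (forall i y, / 2 <= rho i y) ->
  exists (sg k0 : R) (U V : fam), 0 < sg <= 1 /\ 0 < k0 /\
  ssymb sg (- (2 / p)) U /\ ssymb sg (- (2 / p) - 1) V /\
  forall i s y, 0 < s < sg ->
    is_derive (fun s => U i s y) s (V i s y) /\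
    is_derive (fun s => V i s y) s
      (- 2 * dy V i s y + 2 * (p + 2) / p ^ 2 * rho i y * Rpower (U i s y) (p + 1)) /\
    k0 * Rpower s (- (2 / p)) <= U i s y.
Proof.
  intros Hp Hrho Hr2.
  set (b0 := fun i y => Rpower (rho i y) (/ 2)).
  set (ib0 := fun i y => Rpower (rho i y) (- / 2)).
  assert (C : forall q, coef (fun i y => Rpower (rho i y) q)).
  { intros q k. apply (symb_Rpower 1 k (/ 2) (fun i _ y => rho i y)); auto. lra. }
  assert (Hsq : forall i y, b0 i y * b0 i y = rho i y).
  { intros i y. unfold b0. rewrite <- Rpower_plus. replace (/ 2 + / 2) with 1 by field.
    apply Rpower_1. specialize (Hr2 i y). lra. }
  assert (Hinv : forall i y, b0 i y * ib0 i y = 1).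
  { intros i y. unfold b0, ib0. rewrite <- Rpower_plus. replace (/ 2 + - / 2) with 0 by field.
    apply Rpower_O. specialize (Hr2 i y). lra. }
  destruct (approximate_profile (1 + 2 / p) rho b0 ib0 (C _) (C _) Hsq Hinv)
    as (b & bs & by_ & bss & bsy & d & Hd & Sb & Sbs & J & Sd & SQ).
  { pose proof (Rdiv_lt_0_compat 2 p ltac:(lra) Hp). lra. }
  apply (exact_exists p d rho b0 b bs by_ bss bsy); auto.
  intros; apply Rpower_pos.
Qed.


(** * Smoothness in both variables *)

Lemma differentiable_of_partials (f f1 : R -> R -> R) (l2 x y a b : R) : a < x < b ->
  (forall u v, a < u < b -> is_derive (fun u => f u v) u (f1 u v)) ->
  continuity_2d_pt f1 x y -> is_derive (f x) y l2 ->
  differentiable_pt_lim f x y (f1 x y) l2.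
Proof.
  intros Hx H1 Hc H2. apply filterdiff_differentiable_pt_lim.
  apply is_derive_filterdiff; auto.
  - destruct (locally_between a b x (fun u => a < u < b) Hx) as [d Hd]; auto.
    exists d. intros [u v] [Hu _]. apply H1, Hd, Hu.
  - apply continuity_2d_pt_filterlim, Hc.
Qed.

(** Mixed derivatives commute as soon as one order exists and is continuous:
    differentiate [f s y = f s0 y + int g] under the integral. *)
Lemma dy_ds_commute sg e e' f g : ssymb sg e f -> ssymb sg e' g ->
  (forall i s y, 0 < s < sg -> is_derive (fun s => f i s y) s (g i s y)) ->
  forall i s y, 0 < s < sg -> is_derive (fun s => dy f i s y) s (dy g i s y).
Proof.
  intros Sf Sg Hd i s0 y Hs0.
  destruct (ssymb_dy _ _ _ Sf) as [Df Sf']. destruct (ssymb_dy _ _ _ Sg) as [Dg Sg'].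
  assert (Hin : forall a b t, 0 < a < sg -> 0 < b < sg -> Rmin a b <= t <= Rmax a b -> 0 < t < sg).
  { intros a b t Ha Hb Ht. split.
    eapply Rlt_le_trans; [|apply Ht]. apply Rmin_glb_lt; lra.
    eapply Rle_lt_trans; [apply Ht|]. apply Rmax_lub_lt; lra. }
  assert (Hex : forall h : fam, (forall i s y, 0 < s < sg -> continuity_2d_pt (h i) s y) ->
    forall a b y, 0 < a < sg -> 0 < b < sg -> ex_RInt (fun t => h i t y) a b).
  { intros h Hh a b y' Ha Hb. apply (ex_RInt_continuous (V := R_CompleteNormedModule)).
    intros z Hz. apply (c2_slice (h i)), Hh. apply (Hin a b); auto. }
  assert (Hint : forall s y, 0 < s < sg -> f i s y = f i s0 y + RInt (fun t => g i t y) s0 s).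
  { intros s y' Hs.
    assert (E : is_RInt (fun t => g i t y') s0 s (minus (f i s y') (f i s0 y'))).
    { apply (is_RInt_derive (V := R_CompleteNormedModule) (fun s => f i s y')).
      intros t Ht. apply Hd. apply (Hin s0 s); auto.
      intros t Ht. apply (c2_slice (g i)), (symb_cont _ _ _ _ (Sg 0%nat)). apply (Hin s0 s); auto. }
    rewrite (is_RInt_unique _ _ _ _ E). unfold minus, plus, opp; simpl. ring. }
  apply is_derive_ext_loc with (fun s => dy f i s0 y + RInt (fun t => dy g i t y) s0 s).
  - apply locally_between with 0 sg; auto. intros s Hs.
    symmetry. apply is_derive_unique.
    apply is_derive_ext with (fun y => f i s0 y + RInt (fun t => g i t y) s0 s).
    { intros; symmetry; auto. }
    apply (rderive_plus
      (f i s0) (fun y => RInt (fun t => g i t y) s0 s)); auto.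
    apply (is_derive_RInt_param (fun y t => g i t y) s0 s y).
    + exists (mkposreal 1 Rlt_0_1). intros u _ t Ht. eexists. apply Dg. apply (Hin s0 s); auto.
    + intros t Ht. apply (c2_comp (dy g i) (fun _ t => t) (fun y _ => y)).
      apply (symb_cont _ _ _ _ (Sg' 0%nat)). apply (Hin s0 s); auto.
      apply continuity_2d_pt_id2. apply continuity_2d_pt_id1.
    + exists (mkposreal 1 Rlt_0_1). intros u _. apply Hex; auto.
      intros; apply (symb_cont _ _ _ _ (Sg 0%nat)); auto.
  - rewrite <- (Rplus_0_l (dy g i s0 y)).
    apply (rderive_plus
      (fun _ => dy f i s0 y) (fun s => RInt (fun t => dy g i t y) s0 s)).
    apply rderive_const.
    apply (is_derive_RInt (V := R_NormedModule) (fun t => dy g i t y) _ s0).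
    + apply locally_between with 0 sg; auto. intros s Hs.
      apply (RInt_correct (V := R_CompleteNormedModule)). apply Hex; try lra.
      intros; apply (symb_cont _ _ _ _ (Sg' 0%nat)); auto.
    + apply (c2_slice (dy g i)), (symb_cont _ _ _ _ (Sg' 0%nat)); auto.
Qed.

(** An algebra that contains the solution and is closed under both derivatives: its elements
    are then smooth in both variables, without any formula for the mixed derivatives. *)
Inductive alg (U V : fam) : fam -> Prop :=
| alg_U : alg U V U
| alg_V : alg U V V
| alg_coef b : coef b -> alg U V (fun i _ y => b i y)
| alg_pow q : alg U V (fun i s y => Rpower (U i s y) q)
| alg_add f g : alg U V f -> alg U V g -> alg U V (fun i s y => f i s y + g i s y)
| alg_mul f g : alg U V f -> alg U V g -> alg U V (fun i s y => f i s y * g i s y)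
| alg_dy f : alg U V f -> alg U V (dy f).

Section Algebra.

Variables (sg k0 a e' c : R) (U V : fam) (rho : nat -> R -> R).
Variable p : R.
Hypotheses (Hsg : 0 < sg <= 1) (Hk0 : 0 < k0) (SU : ssymb sg a U) (SV : ssymb sg e' V)
  (Hrho : coef rho)
  (HU : forall i s y, 0 < s < sg -> is_derive (fun s => U i s y) s (V i s y))
  (HV : forall i s y, 0 < s < sg -> is_derive (fun s => V i s y) s
      (- 2 * dy V i s y + c * rho i y * Rpower (U i s y) (p + 1)))
  (Hlow : forall i s y, 0 < s < sg -> k0 * Rpower s a <= U i s y).

Lemma profile_pos i s y : 0 < s < sg -> 0 < U i s y.
Proof.
  intros Hs. eapply Rlt_le_trans; [|apply (Hlow i s y Hs)].
  apply Rmult_lt_0_compat; auto. apply Rpower_pos.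
Qed.

Lemma symb_pow_U q : ssymb sg (a * q) (fun i s y => Rpower (U i s y) q).
Proof.
  intros k. apply symb_ext with
    (fun i s y => Rpower s (a * q) * Rpower (Rpower s (- a) * U i s y) q).
  - intros i s y Hs. rewrite <- Rpower_mult, Rpower_mult_distr.
    f_equal. rewrite <- Rmult_assoc, <- Rpower_plus, Rplus_opp_r, Rpower_O by lra. ring.
    apply Rpower_pos. apply Rmult_lt_0_compat. apply Rpower_pos. apply profile_pos; auto.
  - replace (a * q) with (a * q + 0) at 1 by ring. apply symb_mul. apply symb_pow_s.
    apply symb_Rpower with (b := k0); auto.
    + intros i s y Hs. specialize (Hlow i s y Hs).
      apply Rmult_le_compat_l with (r := Rpower s (- a)) in Hlow; [|apply Rpower_nonneg].
      replace (Rpower s (- a) * (k0 * Rpower s a)) with k0 in Hlow; auto.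
      rewrite (Rmult_comm k0), <- Rmult_assoc, <- Rpower_plus, Rplus_opp_l, Rpower_O by lra. ring.
    + replace 0 with (- a + a) by ring. apply symb_mul; auto. apply symb_pow_s.
Qed.

Lemma alg_symb f : alg U V f -> exists e, ssymb sg e f.
Proof.
  induction 1 as [| | b Hb | q | f g _ [e1 H1] _ [e2 H2] | f g _ [e1 H1] _ [e2 H2] | f _ [e H]].
  - exists a; auto.
  - exists e'; auto.
  - exists 0. intros k; apply symb_sub with 1; [lra|apply Hb].
  - exists (a * q). apply symb_pow_U.
  - exists (Rmin e1 e2). apply ssymb_add; intros k.
    apply symb_le with e1; auto; [lra | apply Rmin_l].
    apply symb_le with e2; auto; [lra | apply Rmin_r].
  - exists (e1 + e2). intros k; apply symb_mul; auto.
  - exists e. apply (ssymb_dy _ _ _ H).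
Qed.

Lemma alg_is_dy f : alg U V f -> forall i s y, 0 < s < sg -> is_derive (f i s) y (dy f i s y).
Proof. intros H. destruct (alg_symb f H) as [e He]. apply (ssymb_dy _ _ _ He). Qed.

Lemma alg_cont f : alg U V f -> forall i s y, 0 < s < sg -> continuity_2d_pt (f i) s y.
Proof. intros H. destruct (alg_symb f H) as [e He]. apply (symb_cont _ _ _ _ (He 0%nat)). Qed.

Lemma alg_const r : alg U V (fun _ _ _ => r).
Proof. apply (alg_coef U V (fun _ _ => r)), coef_const. Qed.

(** The equation itself expresses the [s]-derivative of [V] inside the algebra. *)
Lemma alg_ds f : alg U V f -> exists g, alg U V g /\
  forall i s y, 0 < s < sg -> is_derive (fun s => f i s y) s (g i s y).
Proof.
  induction 1 as [| | b Hb | q | f g Hf [f' [Sf Df]] Hg [g' [Sg Dg]]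
    | f g Hf [f' [Sf Df]] Hg [g' [Sg Dg]] | f Hf [f' [Sf Df]]].
  - exists V. split; [apply alg_V | auto].
  - exists (fun i s y => - 2 * dy V i s y + c * rho i y * Rpower (U i s y) (p + 1)). split; auto.
    apply alg_add; apply alg_mul.
    apply alg_const. apply alg_dy, alg_V.
    apply alg_mul. apply alg_const. apply alg_coef; auto. apply alg_pow.
  - exists (fun _ _ _ => 0). split; [apply alg_const |]. intros.
    apply rderive_const.
  - exists (fun i s y => V i s y * (q * Rpower (U i s y) (q - 1))). split.
    apply alg_mul. apply alg_V. apply alg_mul. apply alg_const. apply alg_pow.
    intros i s y Hs. apply (is_derive_Rpower_comp (fun s => U i s y)); auto. apply profile_pos; auto.
  - exists (fun i s y => f' i s y + g' i s y). split. apply alg_add; auto. intros.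
    apply (rderive_plus
      (fun s => f i s y) (fun s => g i s y)); auto.
  - exists (fun i s y => f' i s y * g i s y + f i s y * g' i s y). split.
    apply alg_add; apply alg_mul; auto. intros.
    apply (rderive_mult (fun s => f i s y) (fun s => g i s y)); auto.
  - exists (dy f'). split. apply alg_dy; auto.
    destruct (alg_symb f Hf) as [e He]. destruct (alg_symb f' Sf) as [e1 He1].
    apply (dy_ds_commute sg e e1); auto.
Qed.

End Algebra.


(** * A smooth function vanishing exactly on a closed set *)

(** A set of functions closed under differentiation consists of smooth functions. *)
Lemma closure_Derive_n (G : (R -> R) -> Prop) (O : R -> Prop) :
  (forall x, O x -> locally x O) ->
  (forall f, G f -> exists g, G g /\ forall x, O x -> is_derive f x (g x)) ->
  forall f, G f -> forall n, exists g, G g /\ forall x, O x -> Derive_n f n x = g x.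
Proof.
  intros HO HG f Hf n. induction n as [|n [g [Hg E]]].
  - exists f; auto.
  - destruct (HG g Hg) as [g' [Hg' D]]. exists g'. split; auto.
    intros x Hx. simpl. rewrite (Derive_ext_loc _ g).
    + apply is_derive_unique; auto.
    + apply (filter_imp O); auto.
Qed.

Lemma closure_ex_derive_n (G : (R -> R) -> Prop) (O : R -> Prop) :
  (forall x, O x -> locally x O) ->
  (forall f, G f -> exists g, G g /\ forall x, O x -> is_derive f x (g x)) ->
  forall f, G f -> forall n x, O x -> ex_derive_n f n x.
Proof.
  intros HO HG f Hf n x Hx. destruct n as [|n]; [exact I|].
  destruct (closure_Derive_n G O HO HG f Hf n) as [g [Hg E]].
  destruct (HG g Hg) as [g' [Hg' D]].
  simpl. apply ex_derive_ext_loc with g.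
  - apply (filter_imp O); auto. intros; symmetry; auto.
  - eexists; apply D; auto.
Qed.

(** The derivatives of [exp (- 1 / x)], extended by 0, are combinations of these functions. *)
Definition flat (n : nat) (x : R) : R :=
  if Rle_dec x 0 then 0 else (/ x) ^ n * exp (- / x).

Lemma exp_mult_pow n x : exp (INR n * x) = exp x ^ n.
Proof.
  induction n. simpl. rewrite Rmult_0_l, exp_0; auto.
  rewrite S_INR, Rmult_plus_distr_r, Rmult_1_l, exp_plus, IHn. simpl. ring.
Qed.

Lemma pow_le_exp n z : 0 <= z -> z ^ n <= INR n ^ n * exp z.
Proof.
  intros Hz. destruct n as [|n].
  - simpl. pose proof (exp_ineq1_le z). lra.
  - assert (Hn : 0 < INR (S n)) by (apply lt_0_INR; lia).
    replace z with (INR (S n) * (z / INR (S n))) at 2 by (field; lra).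
    rewrite exp_mult_pow, <- Rpow_mult_distr.
    apply pow_incr. split; auto.
    pose proof (exp_ineq1_le (z / INR (S n))).
    apply Rle_trans with (INR (S n) * (z / INR (S n))).
    apply Req_le; field; lra. apply Rmult_le_compat_l; lra.
Qed.

Lemma flat_bound n x : 0 <= flat n x <= INR n ^ n.
Proof.
  unfold flat. destruct (Rle_dec x 0) as [H|H].
  - split; [lra|]. apply pow_le, pos_INR.
  - assert (Hz : 0 < / x) by (apply Rinv_0_lt_compat; lra). split.
    + apply Rmult_le_pos. apply pow_le; lra. left; apply exp_pos.
    + apply Rmult_le_reg_r with (exp (/ x)). apply exp_pos.
      rewrite Rmult_assoc, <- exp_plus, Rplus_opp_l, exp_0, Rmult_1_r.
      apply pow_le_exp; lra.
Qed.

Lemma flat_pos x : 0 < x -> 0 < flat 0 x.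
Proof.
  intros H. unfold flat. destruct (Rle_dec x 0); [lra|].
  simpl. rewrite Rmult_1_l. apply exp_pos.
Qed.

Lemma flat_neg n x : x <= 0 -> flat n x = 0.
Proof. intros H. unfold flat. destruct (Rle_dec x 0); lra. Qed.

Lemma flat_derive n x : is_derive (flat n) x (- INR n * flat (S n) x + flat (S (S n)) x).
Proof.
  destruct (Rtotal_order x 0) as [H|[->|H]].
  - rewrite !flat_neg by lra.
    replace (- INR n * 0 + 0) with 0 by ring.
    apply is_derive_ext_loc with (fun _ => 0).
    + apply locally_between with (x - 1) 0. lra. intros; rewrite flat_neg; lra.
    + apply rderive_const.
  - rewrite !flat_neg by lra. replace (- INR n * 0 + 0) with 0 by ring.
    apply is_derive_quadratic with (INR (S (S n)) ^ (S (S n))).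
    intros h. rewrite (flat_neg n 0), Rplus_0_l, Rmult_0_r, !Rminus_0_r by lra.
    pose proof (flat_bound (S (S n)) h) as Hb.
    replace (flat n h) with (flat (S (S n)) h * h ^ 2).
    2: { unfold flat. destruct (Rle_dec h 0). ring. simpl. field; lra. }
    rewrite Rabs_pos_eq. apply Rmult_le_compat_r. apply pow2_ge_0. lra.
    apply Rmult_le_pos; [lra|apply pow2_ge_0].
  - apply is_derive_ext_loc with (fun x => (/ x) ^ n * exp (- / x)).
    + apply locally_between with 0 (x + 1). lra. intros u Hu.
      unfold flat. destruct (Rle_dec u 0); lra.
    + unfold flat. destruct (Rle_dec x 0); [lra|].
      replace (- INR n * ((/ x) ^ S n * exp (- / x)) + (/ x) ^ S (S n) * exp (- / x)) with
       ((- (/ x ^ 2) * (INR n * (/ x) ^ pred n)) * exp (- / x)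
         + (/ x) ^ n * ((/ x ^ 2) * exp (- / x))).
      2: { destruct n; simpl; field; lra. }
      apply (rderive_mult (fun x => (/ x) ^ n) (fun x => exp (- / x))).
      * apply (rderive_comp (fun x => x ^ n) Rinv).
        apply is_derive_Reals, derivable_pt_lim_pow.
        auto_derive; [lra|]. field; lra.
      * apply (rderive_comp exp (fun x => - / x)).
        apply is_derive_Reals, derivable_pt_lim_exp.
        auto_derive; [lra|]. field; lra.
      *
Qed.

(** The derivatives of the bump [flat 0 (1 + x) flat 0 (1 - x)], supported in [[-1, 1]]. *)
Inductive bumps : (R -> R) -> Prop :=
| bumps_base a b : bumps (fun x => flat a (1 + x) * flat b (1 - x))
| bumps_add f g : bumps f -> bumps g -> bumps (fun x => f x + g x)
| bumps_scal c f : bumps f -> bumps (fun x => c * f x).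

Lemma bumps_derive f : bumps f -> exists g, bumps g /\ forall x, is_derive f x (g x).
Proof.
  induction 1 as [a b | f g _ [f' [Hf Df]] _ [g' [Hg Dg]] | c f _ [f' [Hf Df]]].
  - exists (fun x =>
      (- INR a * (flat (S a) (1 + x) * flat b (1 - x)) + flat (S (S a)) (1 + x) * flat b (1 - x))
      + (INR b * (flat a (1 + x) * flat (S b) (1 - x))
          + (-1) * (flat a (1 + x) * flat (S (S b)) (1 - x)))).
    split.
    + repeat first [apply bumps_base | apply bumps_add | apply bumps_scal].
    + intros x.
      replace (- INR a * (flat (S a) (1 + x) * flat b (1 - x)) + flat (S (S a)) (1 + x) * flat b (1 - x)
        + (INR b * (flat a (1 + x) * flat (S b) (1 - x))
          + (-1) * (flat a (1 + x) * flat (S (S b)) (1 - x)))) with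
       ((1 * (- INR a * flat (S a) (1 + x) + flat (S (S a)) (1 + x))) * flat b (1 - x)
        + flat a (1 + x) * (-1 * (- INR b * flat (S b) (1 - x) + flat (S (S b)) (1 - x)))) by ring.
      apply (rderive_mult (fun x => flat a (1 + x)) (fun x => flat b (1 - x))).
      apply (rderive_comp (flat a) (fun x => 1 + x)).
      apply flat_derive. auto_derive; auto; ring.
      apply (rderive_comp (flat b) (fun x => 1 - x)).
      apply flat_derive. auto_derive; auto; ring.
  - exists (fun x => f' x + g' x). split. apply bumps_add; auto. intros.
    apply (rderive_plus f g); auto.
  - exists (fun x => c * f' x). split. apply bumps_scal; auto. intros.
    apply (is_derive_scal f); auto.
Qed.

Lemma bumps_bound f : bumps f -> exists C, 0 <= C /\ forall x, Rabs (f x) <= C.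
Proof.
  induction 1 as [a b | f g _ [C [HC Bf]] _ [D [HD Bg]] | c f _ [C [HC Bf]]].
  - exists (INR a ^ a * INR b ^ b). split.
    apply Rmult_le_pos; apply pow_le, pos_INR.
    intros x. pose proof (flat_bound a (1 + x)). pose proof (flat_bound b (1 - x)).
    rewrite Rabs_pos_eq. apply Rmult_le_compat; lra. apply Rmult_le_pos; lra.
  - exists (C + D). split; [lra|]. intros x. eapply Rle_trans; [apply Rabs_triang|].
    specialize (Bf x); specialize (Bg x); lra.
  - exists (Rabs c * C). split. apply Rmult_le_pos; auto using Rabs_pos.
    intros x. rewrite Rabs_mult. apply Rmult_le_compat_l; auto using Rabs_pos.
Qed.

Definition bump (k : nat) : R -> R := Derive_n (fun x => flat 0 (1 + x) * flat 0 (1 - x)) k.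

Lemma bump_bumps k : exists g, bumps g /\ forall x, bump k x = g x.
Proof.
  destruct (closure_Derive_n bumps (fun _ => True)) with (n := k)
    (f := fun x => flat 0 (1 + x) * flat 0 (1 - x)) as [g [Hg E]].
  - intros; apply filter_true.
  - intros f Hf. destruct (bumps_derive f Hf) as [g [Hg D]]. exists g; auto.
  - apply bumps_base.
  - exists g. auto.
Qed.

Lemma bump_derive k x : is_derive (bump k) x (bump (S k) x).
Proof.
  destruct (bump_bumps k) as [g [Hg E]]. destruct (bumps_derive g Hg) as [g' [Hg' D]].
  replace (bump (S k) x) with (g' x).
  apply is_derive_ext with g. intros; auto. apply D.
  symmetry. unfold bump. simpl. rewrite (Derive_ext _ g) by exact E. apply is_derive_unique, D.
Qed.

Lemma bump_bound k : exists C, 0 <= C /\ forall x, Rabs (bump k x) <= C.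
Proof.
  destruct (bump_bumps k) as [g [Hg E]]. destruct (bumps_bound g Hg) as [C [HC H]].
  exists C. split; auto. intros; rewrite E; auto.
Qed.

Lemma bump_pos x : -1 < x < 1 -> 0 < bump 0 x.
Proof. intros H. apply Rmult_lt_0_compat; apply flat_pos; lra. Qed.

Lemma bump_out x : x <= -1 \/ 1 <= x -> bump 0 x = 0.
Proof.
  intros [H|H]; unfold bump; simpl.
  rewrite (flat_neg 0 (1 + x)) by lra; ring. rewrite (flat_neg 0 (1 - x)) by lra; ring.
Qed.

Lemma bump_nonneg x : 0 <= bump 0 x.
Proof.
  unfold bump; simpl. pose proof (flat_bound 0 (1 + x)). pose proof (flat_bound 0 (1 - x)).
  apply Rmult_le_pos; lra.
Qed.

Section ClosedSet.

Variable E : R -> Prop.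
Hypothesis HE : closed_set E.

(** An enumeration of intervals with rational centre and radius [1 / scale]; the bumps of those
    that miss [E] are added up. *)
Definition center (n : nat) : R :=
  let (c, j) := Cantor.of_nat n in let (a, b) := Cantor.of_nat c in (INR a - INR b) / INR (S j).
Definition scale (n : nat) : R := let (c, j) := Cantor.of_nat n in INR (S j).

Definition weight (n : nat) : R :=
  if excluded_middle_informative (forall z, Rabs (z - center n) < / scale n -> ~ E z)
  then (/ 2) ^ n * (/ INR (S n)) ^ n else 0.

Definition bterm (k n : nat) (x : R) : R :=
  weight n * scale n ^ k * bump k ((x - center n) * scale n).

Lemma scale_bound n : 0 < scale n <= INR (S n).
Proof.
  unfold scale. pose proof (Cantor.cancel_to_of n) as H.
  destruct (Cantor.of_nat n) as [c j].
  pose proof (Cantor.to_nat_non_decreasing c j). rewrite H in H0.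
  split. apply lt_0_INR; lia. apply le_INR; lia.
Qed.

Lemma weight_bound n : 0 <= weight n <= (/ 2) ^ n * (/ INR (S n)) ^ n.
Proof.
  assert (0 <= (/ 2) ^ n * (/ INR (S n)) ^ n).
  { apply Rmult_le_pos; apply pow_le. lra. left; apply Rinv_0_lt_compat, lt_0_INR; lia. }
  unfold weight. destruct (excluded_middle_informative _); lra.
Qed.

(** The factor [(n + 1)^-n] beats the scale [(n + 1)^k] of the [k]-th derivative. *)
Lemma weight_scale k n : weight n * scale n ^ k <= INR (S k) ^ k * (/ 2) ^ n.
Proof.
  pose proof (scale_bound n) as Hs. pose proof (weight_bound n) as Hw.
  assert (H1 : 1 <= INR (S n)) by (rewrite S_INR; pose proof (pos_INR n); lra).
  assert (H2 : 1 <= INR (S k)) by (rewrite S_INR; pose proof (pos_INR k); lra).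
  assert (H0 : 0 < / INR (S n) <= 1).
  { split. apply Rinv_0_lt_compat; lra. rewrite <- Rinv_1. apply Rinv_le_contravar; lra. }
  apply Rle_trans with ((/ 2) ^ n * (/ INR (S n)) ^ n * INR (S n) ^ k).
  { apply Rmult_le_compat; try lra. apply pow_le; lra. apply pow_incr; lra. }
  rewrite Rmult_assoc, Rmult_comm. apply Rmult_le_compat_r. apply pow_le; lra.
  destruct (Compare_dec.le_lt_dec k n) as [H|H].
  - apply Rle_trans with 1; [|apply pow_R1_Rle; lra].
    replace n with (k + (n - k))%nat at 2 by lia. rewrite pow_add.
    apply Rle_trans with ((/ INR (S n)) ^ k * INR (S n) ^ k * (/ INR (S n)) ^ (n - k)).
    apply Req_le; ring.
    rewrite <- Rpow_mult_distr, Rinv_l, pow1, Rmult_1_l by lra.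
    rewrite <- (pow1 (n - k)). apply pow_incr; lra.
  - apply Rle_trans with (1 * INR (S n) ^ k).
    apply Rmult_le_compat_r. apply pow_le; lra. rewrite <- (pow1 n). apply pow_incr; lra.
    rewrite Rmult_1_l. apply pow_incr. split; [lra|]. apply le_INR; lia.
Qed.

Lemma bterm_bound k : exists D, 0 <= D /\ forall n x, Rabs (bterm k n x) <= D * (/ 2) ^ n.
Proof.
  destruct (bump_bound k) as [C [HC H]]. exists (INR (S k) ^ k * C).
  split. apply Rmult_le_pos; auto. apply pow_le, pos_INR.
  intros n x. unfold bterm. rewrite Rabs_mult.
  rewrite (Rabs_pos_eq (weight n * _)).
  2: { apply Rmult_le_pos. apply weight_bound. apply pow_le. pose proof (scale_bound n); lra. }
  replace (INR (S k) ^ k * C * (/ 2) ^ n) with (INR (S k) ^ k * (/ 2) ^ n * C) by ring.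
  apply Rmult_le_compat; auto using Rabs_pos, weight_scale.
  apply Rmult_le_pos. apply weight_bound. apply pow_le. pose proof (scale_bound n); lra.
Qed.

Lemma bterm_derive k n x : is_derive (bterm k n) x (bterm (S k) n x).
Proof.
  unfold bterm.
  replace (weight n * scale n ^ S k * bump (S k) ((x - center n) * scale n)) with
   (weight n * scale n ^ k * (scale n * bump (S k) ((x - center n) * scale n))) by (simpl; ring).
  apply (is_derive_scal (fun x => bump k ((x - center n) * scale n))).
  apply (rderive_comp
    (bump k) (fun x => (x - center n) * scale n)).
  apply bump_derive. auto_derive; auto; ring.
Qed.

Lemma is_series_half D : is_series (fun n => D * (/ 2) ^ n) (D * 2).
Proof.
  pose proof (is_series_geom (/ 2) ltac:(rewrite Rabs_pos_eq; lra)) as H.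
  replace (/ (1 - / 2)) with 2 in H by field.
  apply (is_series_scal (K := R_AbsRing) (V := R_NormedModule) D _ 2 H).
Qed.

Lemma series_half_bound (a : nat -> R) D : (forall n, Rabs (a n) <= D * (/ 2) ^ n) ->
  ex_series a /\ Rabs (Series a) <= D * 2.
Proof.
  intros H.
  assert (Ex : ex_series (fun n => Rabs (a n))).
  { apply (ex_series_le (K := R_AbsRing) (V := R_CompleteNormedModule) _ (fun n => D * (/ 2) ^ n)).
    intros n. unfold norm; simpl. unfold abs; simpl. rewrite Rabs_Rabsolu. auto.
    eexists; apply is_series_half. }
  split. apply ex_series_Rabs; auto.
  eapply Rle_trans; [apply Series_Rabs; auto|].
  rewrite <- (is_series_unique _ _ (is_series_half D)).
  apply Series_le. intros n; split; auto using Rabs_pos. eexists; apply is_series_half.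
Qed.

Definition height (k : nat) (x : R) : R := Series (fun n => bterm k n x).

Lemma ex_height k x : ex_series (fun n => bterm k n x).
Proof.
  destruct (bterm_bound k) as [D [HD H]]. apply (series_half_bound _ D). auto.
Qed.

Lemma height_bound k : exists C, 0 <= C /\ forall x, Rabs (height k x) <= C.
Proof.
  destruct (bterm_bound k) as [D [HD H]]. exists (D * 2). split; [lra|].
  intros x. apply (series_half_bound _ D). auto.
Qed.

Lemma height_derive k x : is_derive (height k) x (height (S k) x).
Proof.
  destruct (bterm_bound (S (S k))) as [D [HD H]].
  apply is_derive_quadratic with (D * 2). intros h. unfold height.
  assert (Ex1 := ex_height k (x + h)). assert (Ex2 := ex_height k x).
  assert (Ex3 := ex_height (S k) x).
  rewrite <- Series_scal_l, <- Series_minus, <- Series_minus; auto.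
  2: apply (ex_series_minus (K := R_AbsRing) (V := R_NormedModule)); auto.
  2: apply (ex_series_scal (K := R_AbsRing) (V := R_NormedModule)); auto.
  replace (D * 2 * h ^ 2) with (D * h ^ 2 * 2) by ring.
  apply series_half_bound. intros n.
  replace (D * h ^ 2 * (/ 2) ^ n) with (D * (/ 2) ^ n * (x + h - x) ^ 2) by ring.
  replace (h * bterm (S k) n x) with ((x + h - x) * bterm (S k) n x) by ring.
  apply taylor_lip. apply Rmult_le_pos; auto. apply pow_le; lra. intros; apply bterm_derive.
  intros z Hz. apply mvt_lip with (g := bterm (S (S k)) n). intros; apply bterm_derive. intros; apply H.
Qed.

Lemma bterm_nonneg n x : 0 <= bterm 0 n x.
Proof.
  unfold bterm. apply Rmult_le_pos; [|apply bump_nonneg].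
  apply Rmult_le_pos. apply weight_bound. simpl; lra.
Qed.

Lemma height_ge n x : bterm 0 n x <= height 0 x.
Proof.
  apply Rle_trans with (sum_n (fun n => bterm 0 n x) n).
  - destruct n. rewrite sum_O; lra. rewrite sum_Sn.
    assert (0 <= sum_n (fun n => bterm 0 n x) n).
    { induction n. rewrite sum_O. apply bterm_nonneg. rewrite sum_Sn.
      pose proof (bterm_nonneg (S n) x). unfold plus; simpl. lra. }
    unfold plus; simpl. lra.
  - assert (L := Series_correct _ (ex_height 0 x)).
    apply (is_lim_seq_incr_compare _ _ L).
    intros m. rewrite sum_Sn. pose proof (bterm_nonneg (S m) x). unfold plus; simpl. lra.
Qed.

Lemma height_nonneg x : 0 <= height 0 x.
Proof. eapply Rle_trans; [apply (bterm_nonneg 0 x) | apply height_ge]. Qed.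

Lemma height_zero x : E x -> height 0 x = 0.
Proof.
  intros Hx. apply is_series_unique.
  apply is_series_ext with (fun _ => 0).
  2: { pose proof (is_series_half 0) as H. rewrite Rmult_0_l in H.
       apply (is_series_ext _ (fun _ => 0) _ (fun n => Rmult_0_l _) H). }
  intros n. symmetry. unfold bterm, weight.
  destruct (excluded_middle_informative _) as [H|H]; [|simpl; ring].
  rewrite bump_out. simpl; ring.
  pose proof (scale_bound n) as Hs.
  assert (Hf : / scale n <= Rabs (x - center n)).
  { apply Rnot_lt_le. intros Hlt. apply (H x Hlt Hx). }
  apply Rmult_le_compat_r with (r := scale n) in Hf; [|lra].
  rewrite Rinv_l in Hf by lra.
  unfold Rabs in Hf. destruct (Rcase_abs (x - center n)); lra.
Qed.

Lemma height_pos x : ~ E x -> 0 < height 0 x.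
Proof.
  intros Hx. destruct (HE x Hx) as [d Hd].
  destruct (nfloor_ex (2 / d)) as [j [_ Hj]].
  { left; apply Rdiv_lt_0_compat; [lra | apply cond_pos]. }
  pose proof (cond_pos d) as Hd0.
  assert (HJ : 0 < INR (S j)) by (apply lt_0_INR; lia).
  assert (Hj2 : 2 * / INR (S j) < d).
  { rewrite <- S_INR in Hj. apply Rmult_lt_reg_r with (INR (S j)); auto.
    rewrite Rmult_assoc, Rinv_l, Rmult_1_r by lra.
    apply Rmult_lt_compat_r with (r := d) in Hj; auto.
    replace (2 / d * d) with 2 in Hj by (field; lra). lra. }
  set (z := x * INR (S j)). destruct (archimed z) as [Hz1 Hz2].
  set (c := (up z - 1)%Z).
  assert (Hc : IZR c = IZR (up z) - 1) by (unfold c; rewrite minus_IZR; auto).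
  set (n := Cantor.to_nat (Cantor.to_nat (Z.to_nat c, Z.to_nat (- c)), j)).
  assert (Hab : INR (Z.to_nat c) - INR (Z.to_nat (- c)) = IZR c).
  { rewrite !INR_IZR_INZ, <- minus_IZR. f_equal. lia. }
  assert (Hcen : center n = IZR c / INR (S j)).
  { unfold center, n. rewrite !Cantor.cancel_of_to. f_equal. exact Hab. }
  assert (Hsc : scale n = INR (S j)).
  { unfold scale, n. rewrite !Cantor.cancel_of_to. reflexivity. }
  assert (Hxc : (x - center n) * scale n = z - IZR c).
  { rewrite Hcen, Hsc. unfold z. field. lra. }
  assert (Hdist : Rabs (x - center n) < / INR (S j)).
  { apply Rmult_lt_reg_r with (INR (S j)); auto. rewrite Rinv_l by lra.
    rewrite <- (Rabs_pos_eq (INR (S j))) at 1 by lra. rewrite <- Rabs_mult, <- Hsc, Hxc.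
    apply Rabs_def1; lra. }
  eapply Rlt_le_trans; [|apply (height_ge n)].
  unfold bterm. rewrite Hxc. apply Rmult_lt_0_compat; [|apply bump_pos; lra].
  simpl. rewrite Rmult_1_r. unfold weight.
  destruct (excluded_middle_informative _) as [H|H].
  - apply Rmult_lt_0_compat; apply pow_lt. lra. apply Rinv_0_lt_compat, lt_0_INR; lia.
  - exfalso. apply H. intros y Hy. apply Hd. unfold disc.
    rewrite Hsc in Hy.
    replace (y - x) with ((y - center n) - (x - center n)) by ring.
    eapply Rle_lt_trans; [apply Rabs_triang|]. rewrite Rabs_Ropp. lra.
Qed.

End ClosedSet.


(** * Characteristic coordinates adapted to a surface *)

Section Coordinates.

Variables (h h1 r : R -> R) (H M : R).
Hypotheses (Hh : forall y, is_derive h y (h1 y)) (Hr : forall y, r y = 1 - 2 * h1 y)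
  (Hr2 : forall y, / 2 <= r y) (Hb : forall y, 0 <= h y <= H)
  (HM : forall y y', Rabs (h1 y' - h1 y) <= M * Rabs (y' - y)).

Let kap (y : R) : R := y - 2 * h y.

Lemma kap_derive y : is_derive kap y (r y).
Proof.
  rewrite Hr. apply (rderive_minus (fun y => y) (fun y => 2 * h y)).
  apply rderive_id. apply (is_derive_scal h); auto.
Qed.

Lemma kap_expand y y' : Rabs (y' - y) <= 2 * Rabs (kap y' - kap y).
Proof.
  destruct (MVT_gen kap y y' r) as [c [Hc1 Hc2]].
  - intros; apply kap_derive.
  - intros. apply continuity_pt_filterlim.
    eapply rderive_continuous; apply kap_derive.
  - rewrite Hc2, Rabs_mult. specialize (Hr2 c). rewrite (Rabs_pos_eq (r c)) by lra.
    pose proof (Rabs_pos (y' - y)). nra.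
Qed.

Lemma kap_surj z : exists y, kap y = z.
Proof.
  destruct (IVT_gen kap z (z + 2 * H) z) as [y [_ Hy]].
  - intros y. apply continuity_pt_filterlim.
    eapply rderive_continuous; apply kap_derive.
  - assert (kap z <= z) by (unfold kap; specialize (Hb z); lra).
    assert (z <= kap (z + 2 * H)) by (unfold kap; specialize (Hb (z + 2 * H)); lra).
    rewrite Rmin_left, Rmax_right by lra. lra.
  - exists y; auto.
Qed.

(** The function [y - 2 h y] relates [y] to the null coordinate [x - (t - T)]; its slope [r] is
    bounded below, so it has a smooth inverse. *)
Lemma kap_inverse : exists Y : R -> R,
  (forall z, Y z - 2 * h (Y z) = z) /\ (forall y, Y (y - 2 * h y) = y) /\
  forall z, is_derive Y z (/ r (Y z)).
Proof.
  set (Y := fun z => proj1_sig (constructive_indefinite_description _ (kap_surj z))).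
  assert (HY : forall z, kap (Y z) = z).
  { intros z. unfold Y. destruct (constructive_indefinite_description _ (kap_surj z)); auto. }
  exists Y. split; [exact HY|]. split.
  { intros y. apply Rminus_diag_uniq. apply Rabs_eq_0. apply Rle_antisym; [|apply Rabs_pos].
    eapply Rle_trans; [apply kap_expand|]. rewrite HY. fold (kap y).
    rewrite Rminus_diag, Rabs_R0; lra. }
  intros z. apply is_derive_quadratic with (2 * (2 * M * 4)). intros d.
  set (y := Y z). set (y' := Y (z + d)).
  assert (Hd : Rabs (y' - y) <= 2 * Rabs d).
  { eapply Rle_trans; [apply kap_expand|]. unfold y, y'. rewrite !HY.
    replace (z + d - z) with d by ring. lra. }
  assert (M0 : 0 <= M).
  { specialize (HM 0 1). pose proof (Rabs_pos (h1 1 - h1 0)).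
    rewrite Rminus_0_r, (Rabs_pos_eq 1) in HM by lra. lra. }
  assert (T : Rabs (kap y' - kap y - (y' - y) * r y) <= 2 * M * (y' - y) ^ 2).
  { apply (taylor_lip kap r). lra. intros; apply kap_derive.
    intros x Hx. rewrite !Hr.
    replace (1 - 2 * h1 x - (1 - 2 * h1 y)) with (- 2 * (h1 x - h1 y)) by ring.
    rewrite Rabs_mult, Rabs_left, Rmult_assoc by lra.
    replace (- -2) with 2 by ring. apply Rmult_le_compat_l; [lra|].
    apply HM. }
  replace (kap y' - kap y) with d in T by (unfold y, y'; rewrite !HY; ring).
  specialize (Hr2 y).
  replace (y' - y - d * / r y) with (- / r y * (d - (y' - y) * r y)) by (field; lra).
  rewrite Rabs_mult, Rabs_Ropp.
  assert (Hi : 0 < / r y <= 2).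
  { split. apply Rinv_0_lt_compat; lra. rewrite <- (Rinv_inv 2). apply Rinv_le_contravar; lra. }
  rewrite (Rabs_pos_eq (/ r y)) by lra.
  assert (Hsq : (y' - y) ^ 2 <= 4 * d ^ 2).
  { rewrite <- (pow2_abs (y' - y)), <- (pow2_abs d).
    replace (4 * Rabs d ^ 2) with ((2 * Rabs d) ^ 2) by ring.
    apply pow_incr. split; auto using Rabs_pos. }
  replace (2 * (2 * M * 4) * d ^ 2) with (2 * (2 * M * (4 * d ^ 2))) by ring.
  apply Rmult_le_compat; try lra. apply Rabs_pos.
  eapply Rle_trans; [exact T|]. apply Rmult_le_compat_l; lra.
Qed.

End Coordinates.

Section Pullback.

Variables (Y ir : R -> R) (sg T : R).
Hypothesis (HY : forall z, is_derive Y z (ir (Y z))).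

(** Solving [x - (t - T) = y - 2 h y] and [x + (t - T) = y - 2 s] for [y] and [s]; then
    [s = h y - (t - T)]. *)
Definition ycoord (t x : R) : R := Y (x - (t - T)).
Definition scoord (t x : R) : R := / 2 * (ycoord t x - (t - T + x)).

Lemma ycoord_dx t x : is_derive (ycoord t) x (ir (ycoord t x)).
Proof.
  rewrite <- (Rmult_1_l (ir _)).
  apply (rderive_comp Y (fun x => x - (t - T))).
  apply HY. auto_derive; auto; ring.
Qed.

Lemma ycoord_dt t x : is_derive (fun t => ycoord t x) t (- ir (ycoord t x)).
Proof.
  replace (- ir (ycoord t x)) with (-1 * ir (ycoord t x)) by ring.
  apply (rderive_comp Y (fun t => x - (t - T))).
  apply HY. auto_derive; auto; ring.
Qed.

Lemma scoord_dx t x : is_derive (scoord t) x ((ir (ycoord t x) - 1) / 2).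
Proof.
  replace ((ir (ycoord t x) - 1) / 2) with (/ 2 * (ir (ycoord t x) - 1)) by field.
  apply (is_derive_scal (fun x => ycoord t x - (t - T + x))), (rderive_minus (ycoord t)).
  apply ycoord_dx. auto_derive; auto; ring.
Qed.

Lemma scoord_dt t x : is_derive (fun t => scoord t x) t ((- ir (ycoord t x) - 1) / 2).
Proof.
  replace ((- ir (ycoord t x) - 1) / 2) with (/ 2 * (- ir (ycoord t x) - 1)) by field.
  apply (is_derive_scal (fun t => ycoord t x - (t - T + x))).
  apply (rderive_minus (fun t => ycoord t x)).
  apply ycoord_dt. auto_derive; auto; ring.
Qed.

Lemma ycoord_c2 t x : continuity_2d_pt ycoord t x.
Proof.
  apply (continuity_1d_2d_pt_comp Y (fun t x => x - (t - T))); [|c2_tac].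
  apply continuity_pt_filterlim. eapply rderive_continuous; apply HY.
Qed.

Lemma scoord_c2 t x : continuity_2d_pt scoord t x.
Proof.
  pose proof (ycoord_c2 t x). unfold scoord. c2_tac.
Qed.

Definition pull (f : R -> R -> R) (t x : R) : R := f (scoord t x) (ycoord t x).

(** Derivative of a pulled-back function along [t] for [e = -1], along [x] for [e = 1]. *)
Definition along (e : R) (fs fy : R -> R -> R) (s y : R) : R :=
  fs s y * ((e * ir y - 1) / 2) + fy s y * (e * ir y).

Lemma pull_derive (f fs fy : R -> R -> R) :
  (forall s y, 0 < s < sg -> is_derive (fun s => f s y) s (fs s y)) ->
  (forall s y, 0 < s < sg -> continuity_2d_pt fs s y) ->
  (forall s y, 0 < s < sg -> is_derive (f s) y (fy s y)) ->
  forall t x, 0 < scoord t x < sg ->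
    is_derive (fun t => pull f t x) t (pull (along (-1) fs fy) t x) /\
    is_derive (pull f t) x (pull (along 1 fs fy) t x).
Proof.
  intros Hs Hc Hy t x Hd.
  assert (D : differentiable_pt_lim f (scoord t x) (ycoord t x) (fs (scoord t x) (ycoord t x))
     (fy (scoord t x) (ycoord t x))).
  { apply (differentiable_of_partials f fs) with (a := 0) (b := sg); auto. }
  unfold pull at 2 4, along.
  replace (-1 * ir (ycoord t x)) with (- ir (ycoord t x)) by ring. rewrite Rmult_1_l.
  split; apply is_derive_Reals.
  - apply (derivable_pt_lim_comp_2d f (fun t => scoord t x) (fun t => ycoord t x)); auto.
    apply is_derive_Reals, scoord_dt. apply is_derive_Reals, ycoord_dt.
  - apply (derivable_pt_lim_comp_2d f (scoord t) (ycoord t)); auto.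
    apply is_derive_Reals, scoord_dx. apply is_derive_Reals, ycoord_dx.
Qed.

Lemma pull_c2 f : (forall s y, 0 < s < sg -> continuity_2d_pt f s y) ->
  forall t x, 0 < scoord t x < sg -> continuity_2d_pt (pull f) t x.
Proof.
  intros Hf t x Hd. apply (c2_comp f scoord ycoord); auto. apply scoord_c2. apply ycoord_c2.
Qed.

(** The terms with [ir'] and with two [y]-derivatives cancel in the difference: in the new
    coordinates [d_t + d_x = - d_s], so the wave operator is [ir (d_s^2 + 2 d_s d_y)]. *)
Lemma pull_wave (f fs fss fy fsy fyy : R -> R -> R) (ir1 : R -> R) :
  (forall y, is_derive ir y (ir1 y)) ->
  (forall s y, 0 < s < sg ->
    is_derive (fun s => f s y) s (fs s y) /\ is_derive (f s) y (fy s y) /\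
    is_derive (fun s => fs s y) s (fss s y) /\ is_derive (fs s) y (fsy s y) /\
    is_derive (fun s => fy s y) s (fsy s y) /\ is_derive (fy s) y (fyy s y)) ->
  (forall s y, 0 < s < sg -> continuity_2d_pt fs s y /\
     continuity_2d_pt fss s y /\ continuity_2d_pt fsy s y) ->
  exists ut utt ux uxx : R -> R -> R, forall t x, 0 < scoord t x < sg ->
    is_derive (fun t => pull f t x) t (ut t x) /\ is_derive (fun t => ut t x) t (utt t x) /\
    is_derive (pull f t) x (ux t x) /\ is_derive (ux t) x (uxx t x) /\
    utt t x - uxx t x = pull (fun s y => ir y * (fss s y + 2 * fsy s y)) t x.
Proof.
  intros Hir Hf Hc.
  set (fe := fun e s y => fsy s y * ((e * ir y - 1) / 2) + fs s y * (/ 2 * (e * ir1 y))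
                + (fyy s y * (e * ir y) + fy s y * (e * ir1 y))).
  assert (De : forall e t x, 0 < scoord t x < sg ->
    is_derive (fun t => pull (along e fs fy) t x) t (pull (along (-1) (along e fss fsy) (fe e)) t x) /\
    is_derive (pull (along e fs fy) t) x (pull (along 1 (along e fss fsy) (fe e)) t x)).
  { intros e.
    assert (D1 : forall y, is_derive (fun y => e * ir y) y (e * ir1 y)).
    { intros y. apply (is_derive_scal ir); auto. }
    assert (D2 : forall y, is_derive (fun y => (e * ir y - 1) / 2) y (/ 2 * (e * ir1 y))).
    { intros y. apply is_derive_ext with (fun y => / 2 * (e * ir y - 1)).
      intros; simpl; field. rewrite <- (Rminus_0_r (e * ir1 y)).
      apply (is_derive_scal (fun y => e * ir y - 1)).
      apply (rderive_minus (fun y => e * ir y) (fun _ => 1)); auto. apply rderive_const. }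
    apply pull_derive; intros s y Hs; destruct (Hf s y Hs) as (F1 & F2 & F3 & F4 & F5 & F6).
    - apply (rderive_plus (fun s => fs s y * ((e * ir y - 1) / 2)) (fun s => fy s y * (e * ir y)));
        apply is_derive_scalr; auto.
    - destruct (Hc s y Hs) as (C1 & C2 & C3).
      apply continuity_2d_pt_plus; apply continuity_2d_pt_mult; auto;
        [apply (c2_of_1d_snd (fun y => (e * ir y - 1) / 2)) | apply (c2_of_1d_snd (fun y => e * ir y))];
        eapply rderive_continuous; auto.
    - apply (rderive_plus (fun y => fs s y * ((e * ir y - 1) / 2)) (fun y => fy s y * (e * ir y))).
      apply (rderive_mult (fs s) (fun y => (e * ir y - 1) / 2)); auto.
      apply (rderive_mult (fy s) (fun y => e * ir y)); auto. }
  exists (pull (along (-1) fs fy)), (pull (along (-1) (along (-1) fss fsy) (fe (-1)))),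
    (pull (along 1 fs fy)), (pull (along 1 (along 1 fss fsy) (fe 1))).
  intros t x Hd.
  destruct (pull_derive f fs fy) with (t := t) (x := x) as [Q1 Q2]; auto;
    [intros; apply Hf; auto | intros; apply Hc; auto | intros; apply Hf; auto |].
  split; [exact Q1|]. split; [apply De; auto|]. split; [exact Q2|]. split; [apply De; auto|].
  unfold pull, along, fe. field.
Qed.

End Pullback.


(** * The solution in the original coordinates *)

Lemma alg_pull sg k0 a e' c U V rho p ir i Y T :
  0 < sg <= 1 -> 0 < k0 -> ssymb sg a U -> ssymb sg e' V -> coef rho -> coef ir ->
  (forall i s y, 0 < s < sg -> is_derive (fun s => U i s y) s (V i s y)) ->
  (forall i s y, 0 < s < sg -> is_derive (fun s => V i s y) s
      (- 2 * dy V i s y + c * rho i y * Rpower (U i s y) (p + 1))) ->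
  (forall i s y, 0 < s < sg -> k0 * Rpower s a <= U i s y) ->
  (forall z, is_derive Y z (ir i (Y z))) ->
  forall f, alg U V f -> exists ft fx, alg U V ft /\ alg U V fx /\
    forall t x, 0 < scoord Y T t x < sg ->
      is_derive (fun t => pull Y T (f i) t x) t (pull Y T (ft i) t x) /\
      is_derive (pull Y T (f i) t) x (pull Y T (fx i) t x).
Proof.
  intros Hsg Hk0 SU SV Hrho Hir HU HV Hlow HY f Hf.
  destruct (alg_ds sg k0 a e' c U V rho p Hsg Hk0 SU SV Hrho HU HV Hlow f Hf) as [fs [Hfs Ds]].
  assert (Ai : alg U V (fun i _ y => ir i y)) by (apply alg_coef; auto).
  assert (Ac : forall r, alg U V (fun _ _ _ => r)) by (intros; apply alg_const).
  exists (fun i s y => fs i s y * (/ 2 * ((-1) * ir i y + (-1))) + dy f i s y * ((-1) * ir i y)).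
  exists (fun i s y => fs i s y * (/ 2 * (ir i y + (-1))) + dy f i s y * ir i y).
  split.
  { apply alg_add; apply alg_mul; auto. apply alg_mul; auto. apply alg_add; auto. apply alg_mul; auto.
    apply alg_dy; auto. apply alg_mul; auto. }
  split.
  { apply alg_add; apply alg_mul; auto. apply alg_mul; auto. apply alg_add; auto.
    apply alg_dy; auto. }
  intros t x Hd.
  destruct (pull_derive Y (ir i) sg T HY (f i) (fs i) (dy f i)) with (t := t) (x := x) as [Q1 Q2]; auto.
  - apply (alg_cont sg k0 a e' U V Hsg Hk0 SU SV Hlow fs Hfs).
  - apply (alg_is_dy sg k0 a e' U V Hsg Hk0 SU SV Hlow f Hf).
  - split.
    + match type of Q1 with is_derive _ _ ?l => match goal with |- is_derive _ _ ?l' =>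
        replace l' with l; [exact Q1|] end end. unfold pull, along. field.
    + match type of Q2 with is_derive _ _ ?l => match goal with |- is_derive _ _ ?l' =>
        replace l' with l; [exact Q2|] end end. unfold pull, along. field.
Qed.

Lemma is_derive_t_of (T : R) (u : R -> R -> R) (t x l : R) :
  is_derive (fun s => u s x) t l -> is_derive_t T u t x l.
Proof.
  intros H. unfold is_derive_t. apply D_in_imp with no_cond. intros; exact I.
  apply derivable_pt_lim_D_in. apply is_derive_Reals, H.
Qed.

Lemma Ck_strip_of_closure (T : R) (G : (R -> R -> R) -> Prop) :
  (forall u, G u -> (forall t x, time T t -> continuity_2d_pt u t x) /\
     exists ut ux, G ut /\ G ux /\ forall t x, time T t ->
       is_derive (fun t => u t x) t (ut t x) /\ is_derive (u t) x (ux t x)) ->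
  forall u, G u -> smooth_strip T u.
Proof.
  intros HG u Hu k. revert u Hu. induction k; intros u Hu;
    destruct (HG u Hu) as [Hc (ut & ux & Ht & Hx & D)].
  all: split; [apply continuous_on_forall; intros [t x] Htx;
    apply continuity_2d_pt_filterlim, Hc, Htx |]; auto.
  exists ut, ux. split; [|split; [|split]]; auto.
  - intros t x Htx. apply is_derive_t_of, D, Htx.
  - intros t x Htx. apply D, Htx.
Qed.

(** Uniformity in [i] is what the bounds of the unscaled function give, as [eps i <= 1]. *)
Lemma scaled_coef (f : nat -> R -> R) (eps : nat -> R) :
  (forall i, 0 <= eps i <= 1) -> (forall k x, is_derive (f k) x (f (S k) x)) ->
  (forall k, exists C, 0 <= C /\ forall x, Rabs (f k x) <= C) ->
  forall k, coef (fun i y => eps i * f k y).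
Proof.
  intros He Hd Hb k n. revert k.
  assert (B : forall k i s y C, (forall x, Rabs (f k x) <= C) -> 0 <= C ->
    Rabs (eps i * f k y) <= C * Rpower s 0).
  { intros k i s y C HC HC0. unfold Rpower. rewrite Rmult_0_l, exp_0, Rmult_1_r, Rabs_mult.
    rewrite (Rabs_pos_eq (eps i)) by apply He. rewrite <- (Rmult_1_l C).
    apply Rmult_le_compat; try apply He; auto. apply Rabs_pos. }
  assert (D : forall k i y, is_derive (fun y => eps i * f k y) y (eps i * f (S k) y)).
  { intros. apply (is_derive_scal (f k)); auto. }
  induction n; intros k; (split; [|split]).
  1, 4: intros i s y _; apply c2_of_1d_snd, (ex_derive_continuous (K := R_AbsRing)
    (V := R_NormedModule)); eexists; apply D.
  1, 3: destruct (Hb k) as (C & HC & H); exists C; split; auto.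
  - destruct (Hb (S k)) as (C & HC & H). exists C; split; auto. intros i s y y' _.
    apply mvt_lip with (f := fun y => eps i * f k y) (g := fun y => eps i * f (S k) y); auto.
  - exists (fun i _ y => eps i * f (S k) y). split; auto.
Qed.

Theorem corollary1p2 (p : R) (hp : 0 < p) (E : R -> Prop) (hE : compact E) :
  exists (f g : R -> R) (T : R) (u : R -> R -> R),
    smooth f /\ smooth g /\ 0 < T /\
    smooth_strip T u /\ solves_nlw p T u /\
    (forall x, u 0 x = f x) /\
    (forall x, is_derive_t T u 0 x (g x)) /\
    (exists v : R -> R, smooth_off E v /\
       forall x, ~ E x ->
         filterlim (fun t => u t x) (at_left T) (locally (v x))) /\
    (forall x, E x ->
       filterlim (fun t => u t x) (at_left T) (Rbar_locally p_infty)).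
Proof.
  pose proof (compact_P2 E hE) as HE.
  destruct (height_bound E 0) as (C0 & HC0 & B0).
  destruct (height_bound E 1) as (C1 & HC1 & B1).
  destruct (height_bound E 2) as (C2 & HC2 & B2).
  set (eps := fun i : nat => / (4 * (C1 + 1)) * / INR (S i)).
  assert (Heps0 : forall i, 0 < / INR (S i) <= 1).
  { intros i. assert (1 <= INR (S i)) by (rewrite S_INR; pose proof (pos_INR i); lra).
    split. apply Rinv_0_lt_compat; lra. rewrite <- Rinv_1. apply Rinv_le_contravar; lra. }
  assert (HK : 0 < / (4 * (C1 + 1)) <= / 4).
  { split. apply Rinv_0_lt_compat; lra. apply Rinv_le_contravar; lra. }
  assert (Heps : forall i, 0 < eps i <= / (4 * (C1 + 1))).
  { intros i. specialize (Heps0 i). unfold eps. split; nra. }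
  assert (Heps1 : forall i, 0 <= eps i <= 1) by (intros i; specialize (Heps i); lra).
  set (rho := fun i y => 1 + (-2) * (eps i * height E 1 y)).
  assert (Hrho : coef rho).
  { apply ssymb_add. intros k; apply symb_const. apply ssymb_mul0. intros k; apply symb_const.
    apply (scaled_coef (height E)); auto. apply height_derive. apply height_bound. }
  assert (Hr2 : forall i y, / 2 <= rho i y).
  { intros i y. unfold rho. specialize (Heps i). specialize (B1 y). apply Rabs_le_inv in B1.
    assert (eps i * C1 <= / 4).
    { apply Rle_trans with (/ (4 * (C1 + 1)) * C1). apply Rmult_le_compat_r; lra.
      apply Rle_trans with (/ (4 * (C1 + 1)) * (C1 + 1)). apply Rmult_le_compat_l; lra.
      apply Req_le; field; lra. }
    nra. }
  destruct (blowup_profile p rho hp Hrho Hr2) as (sg & k0 & U & V & Hsg & Hk0 & SU & SV & HUV).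
  (* the profile is uniform in [i], so the surface can now be chosen flatter than [sg] *)
  assert (Hi : exists i, eps i * C0 < sg / 4).
  { destruct (nfloor_ex (4 * (C0 + 1) / sg)) as [i [_ Hi]].
    { left; apply Rdiv_lt_0_compat; lra. }
    exists i. rewrite <- S_INR in Hi. assert (HI : 0 < INR (S i)) by (apply lt_0_INR; lia).
    apply Rle_lt_trans with (/ INR (S i) * C0).
    { apply Rmult_le_compat_r; auto. unfold eps. specialize (Heps0 i). nra. }
    apply Rmult_lt_reg_l with (INR (S i)); auto.
    rewrite <- Rmult_assoc, Rinv_r, Rmult_1_l by lra.
    apply Rmult_lt_compat_r with (r := sg) in Hi; [|lra].
    replace (4 * (C0 + 1) / sg * sg) with (4 * (C0 + 1)) in Hi by (field; lra). lra. }
  destruct Hi as [i Hi].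
  set (h := fun y => eps i * height E 0 y).
  assert (Hh : forall y, 0 <= h y <= sg / 4).
  { intros y. unfold h. pose proof (height_nonneg E y). specialize (B0 y). apply Rabs_le_inv in B0.
    specialize (Heps i). split. apply Rmult_le_pos; lra. nra. }
  destruct (kap_inverse h (fun y => eps i * height E 1 y) (rho i) (sg / 4) C2)
    as (Y & HY1 & HY2 & HYd); auto.
  { intros y. apply (is_derive_scal (height E 0)), height_derive. }
  { intros y; unfold rho; ring. }
  { intros y y'. replace (eps i * height E 1 y' - eps i * height E 1 y) with
      (eps i * (height E 1 y' - height E 1 y)) by ring.
    rewrite Rabs_mult, Rabs_pos_eq by apply Heps1.
    rewrite <- (Rmult_1_l (C2 * _)). apply Rmult_le_compat; try apply Heps1. apply Rabs_pos.
    apply mvt_lip with (height E 2). intros; apply height_derive. intros; apply B2. }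
  set (ir := fun i y => Rpower (rho i y) (-1)).
  assert (Hir : coef ir).
  { intros k. apply (symb_Rpower 1 k (/ 2) (fun i _ y => rho i y)); auto. lra. }
  assert (Hir1 : forall y, ir i y * rho i y = 1).
  { intros y. unfold ir. rewrite <- (Rpower_1 (rho i y)) at 2 by (specialize (Hr2 i y); lra).
    rewrite <- Rpower_plus. replace (-1 + 1) with 0 by ring. apply Rpower_O.
    specialize (Hr2 i y); lra. }
  assert (HY : forall z, is_derive Y z (ir i (Y z))).
  { intros z. replace (ir i (Y z)) with (/ rho i (Y z)); auto.
    specialize (Hir1 (Y z)). specialize (Hr2 i (Y z)).
    replace (ir i (Y z)) with (ir i (Y z) * rho i (Y z) * / rho i (Y z)) by (field; lra).
    rewrite Hir1; ring. }
  set (c := 2 * (p + 2) / p ^ 2) in *.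
  assert (HU := fun i s y H => proj1 (HUV i s y H)).
  assert (HV := fun i s y H => proj1 (proj2 (HUV i s y H))).
  assert (Hlow := fun i s y H => proj2 (proj2 (HUV i s y H))).
  simpl in HU, HV, Hlow.
  set (T := sg / 4).
  assert (HT : 0 < T) by (unfold T; lra).
  assert (HS : forall t x, scoord Y T t x = h (ycoord Y T t x) - (t - T)).
  { intros t x. unfold scoord. pose proof (HY1 (x - (t - T))) as H.
    fold (ycoord Y T t x) in H. lra. }
  assert (HSr : forall t x, 0 <= t < T -> 0 < scoord Y T t x < sg).
  { intros t x Ht. rewrite HS. pose proof (Hh (ycoord Y T t x)). unfold T in *. lra. }
  assert (HSE : forall x, E x -> scoord Y T T x = 0).
  { intros x Hx. assert (Hhx : h x = 0) by (unfold h; rewrite height_zero; auto; ring).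
    assert (ycoord Y T T x = x).
    { unfold ycoord. pose proof (HY2 x) as H. rewrite Hhx in H.
      replace (x - (T - T)) with (x - 2 * 0) by ring. exact H. }
    rewrite HS, H, Hhx. ring. }
  assert (HSn : forall x, ~ E x -> 0 < scoord Y T T x < sg).
  { intros x Hx. rewrite HS. pose proof (Hh (ycoord Y T T x)) as H.
    split; [|lra]. destruct (Req_dec (h (ycoord Y T T x)) 0) as [H0|H0]; [|lra].
    exfalso. apply Hx.
    assert (Hy : ycoord Y T T x = x).
    { pose proof (HY1 (x - (T - T))) as H1. fold (ycoord Y T T x) in H1. lra. }
    rewrite Hy in H0. destruct (classic (E x)) as [|Hn]; auto.
    pose proof (height_pos E HE x Hn). specialize (Heps i).
    unfold h in H0. assert (0 < eps i * height E 0 x) by (apply Rmult_lt_0_compat; lra). lra. }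
  assert (HA := fun f Hf => alg_pull sg k0 _ _ c U V rho p ir i Y T Hsg Hk0 SU SV Hrho Hir
    HU HV Hlow HY f Hf).
  set (u := pull Y T (U i)).
  destruct (HA U (alg_U U V)) as (Ut & Ux & AUt & AUx & DU).
  (* time slices of the pulled-back algebra are closed under differentiation *)
  set (slice := fun (t : R) (f : R -> R) => exists F, alg U V F /\ f = pull Y T (F i) t).
  assert (Hslice : forall t (O : R -> Prop), (forall x, O x -> locally x O) ->
    (forall x, O x -> 0 < scoord Y T t x < sg) ->
    forall F, alg U V F -> forall n x, O x -> ex_derive_n (pull Y T (F i) t) n x).
  { intros t O HO HOs F HF. apply (closure_ex_derive_n (slice t) O HO).
    - intros f [F' [HF' ->]]. destruct (HA F' HF') as (Ft & Fx & AFt & AFx & DF).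
      exists (pull Y T (Fx i) t). split. exists Fx; auto. intros x Hx. apply DF; auto.
    - exists F; auto. }
  exists (u 0), (pull Y T (Ut i) 0), T, u.
  split; [|split; [|split; [|split; [|split; [|split; [|split; [|split]]]]]]]; auto.
  - intros n x. apply (Hslice 0 (fun _ => True)); auto. intros; apply filter_true.
    intros; apply HSr; lra. apply alg_U.
  - intros n x. apply (Hslice 0 (fun _ => True)); auto. intros; apply filter_true.
    intros; apply HSr; lra.
  - apply (Ck_strip_of_closure T (fun w => exists F, alg U V F /\ w = pull Y T (F i))).
    2: { exists U. split; [apply alg_U | auto]. }
    intros w [F [HF ->]]. split.
    + intros t x Ht. apply (pull_c2 Y (ir i) sg T HY); auto.
      apply (alg_cont sg k0 _ _ U V Hsg Hk0 SU SV Hlow F HF).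
    + destruct (HA F HF) as (Ft & Fx & AFt & AFx & DF).
      exists (pull Y T (Ft i)), (pull Y T (Fx i)).
      split; [exists Ft; auto|]. split; [exists Fx; auto|]. intros t x Ht. apply DF; auto.
  - destruct (coef_deriv ir Hir) as (ir1 & _ & Dir).
    destruct (ssymb_dy _ _ _ SU) as [DyU SyU]. destruct (ssymb_dy _ _ _ SV) as [DyV SyV].
    destruct (ssymb_dy _ _ _ SyU) as [DyyU SyyU].
    destruct (pull_wave Y (ir i) sg T HY (U i) (V i)
      (fun s y => - 2 * dy V i s y + c * rho i y * Rpower (U i s y) (p + 1))
      (dy U i) (dy V i) (dy (dy U) i) (ir1 i)) as (ut & utt & ux & uxx & Hw).
    + intros; apply Dir.
    + intros s y Hs. split; [|split; [|split; [|split; [|split]]]]; auto.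
      apply (dy_ds_commute sg _ _ U V SU SV); auto.
    + intros s y Hs. split; [|split].
      * apply (symb_cont _ _ _ _ (SV 0%nat)); auto.
      * destruct (alg_ds sg k0 _ _ c U V rho p Hsg Hk0 SU SV Hrho HU HV Hlow V (alg_V U V))
          as [g [Ag Dg]].
        apply c2_ext_strip with (s1 := 0) (s2 := sg) (f := g i); auto.
        { intros s' y' Hs'. rewrite <- (is_derive_unique _ _ _ (Dg i s' y' Hs')).
          apply is_derive_unique; auto. }
        apply (alg_cont sg k0 _ _ U V Hsg Hk0 SU SV Hlow g Ag); auto.
      * apply (symb_cont _ _ _ _ (SyV 0%nat)); auto.
    + exists ut, utt, ux, uxx.
      split; [|split; [|split; [|split]]]; intros t x Ht;
        destruct (Hw t x (HSr t x Ht)) as (W1 & W2 & W3 & W4 & W5).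
      1, 2: apply is_derive_t_of; auto. 1, 2: auto.
      rewrite W5. unfold nonlinearity, u, pull.
      set (s := scoord Y T t x). set (y := ycoord Y T t x).
      assert (HUp : 0 < U i s y).
      { apply (profile_pos sg k0 (- (2 / p)) U Hk0 Hlow). apply HSr; auto. }
      rewrite Rabs_pos_eq by lra.
      replace (Rpower (U i s y) p * U i s y) with (Rpower (U i s y) (p + 1)).
      2: { rewrite Rpower_plus, Rpower_1; auto. }
      fold c.
      replace (ir i y * (-2 * dy V i s y + c * rho i y * Rpower (U i s y) (p + 1) + 2 * dy V i s y))
        with (ir i y * rho i y * (c * Rpower (U i s y) (p + 1))) by ring.
      rewrite Hir1. ring.
  - intros x. apply is_derive_t_of. apply DU. apply HSr; lra.
  - exists (u T). split.
    + intros n x Hx. apply (Hslice T (fun x => ~ E x)); auto. apply alg_U.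
    + intros x Hx. apply (filterlim_filter_le_1 (G := at_left T) (F := locally T)).
      apply filter_le_within.
      apply (ex_derive_continuous (K := R_AbsRing) (V := R_NormedModule) (fun t => u t x)).
      exists (pull Y T (Ut i) T x). exact (proj1 (DU T x (HSn x Hx))).
  - intros x Hx P [M HM].
    assert (Hp2 : 0 < 2 / p) by (apply Rdiv_lt_0_compat; lra).
    set (M1 := Rabs M + 1). assert (HM1 : 0 < M1) by (unfold M1; pose proof (Rabs_pos M); lra).
    destruct (Rpower_small (2 / p) (k0 / M1) Hp2) as [d Hd].
    { apply Rdiv_lt_0_compat; auto. }
    pose proof (scoord_c2 Y (ir i) T HY T x) as Hc.
    destruct (Hc d) as [d' Hd'].
    assert (Hm : 0 < Rmin d' T) by (apply Rmin_pos; auto; apply cond_pos).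
    exists (mkposreal _ Hm). simpl. intros t Ht HtT. apply HM.
    change (Rabs (t - T) < Rmin d' T) in Ht.
    pose proof (Rmin_l d' T). pose proof (Rmin_r d' T).
    specialize (Hd' t x ltac:(lra) ltac:(rewrite Rminus_diag, Rabs_R0; apply cond_pos)).
    apply Rabs_def2 in Ht.
    rewrite (HSE x Hx), Rminus_0_r in Hd'. apply Rabs_def2 in Hd'.
    assert (Hst : 0 < scoord Y T t x < sg) by (apply HSr; lra).
    specialize (Hd (scoord Y T t x) ltac:(lra)).
    apply Rlt_le_trans with M1. { unfold M1. pose proof (Rle_abs M). lra. }
    eapply Rle_trans; [|apply (Hlow i _ (ycoord Y T t x) Hst)].
    rewrite Rpower_Ropp. pose proof (Rpower_pos (scoord Y T t x) (2 / p)) as Hs0.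
    apply Rmult_le_reg_r with (Rpower (scoord Y T t x) (2 / p)); auto.
    rewrite Rmult_assoc, Rinv_l, Rmult_1_r by lra.
    apply Rmult_lt_compat_l with (r := M1) in Hd; auto.
    replace (M1 * (k0 / M1)) with k0 in Hd by (field; lra). lra.
Qed.
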